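(* Let $n\ge1$, let $\gamma\in\mathbb{R}$ with $|\gamma|<\sqrt{n/e}$, and let $a\ge2$ be an odd integer. Let $\mu$ be the polyharmonic LQG measure on $\mathbb{T}^n$ and, for odd $L$, let $\mu_L$ be the discrete LQG measure on $\mathbb{T}^n_L$ (regarded as a measure on $\mathbb{T}^n$), both with parameter $\gamma$ and built from the same i.i.d. standard normal variables as described in the context. Then $\mu_{a^\ell}\to\mu$ as $\ell\to\infty$ in $\mathbf P$-probability and in $L^1(\mathbf P)$; that is, for every $f\in\mathcal C(\mathbb{T}^n)$, $\int f\,d\mu_{a^\ell}\to\int f\,d\mu$ as $\ell\to\infty$ in $\mathbf P$-probability and in $L^1(\mathbf P)$.
   Context: $\mathbb{T}^n=(\mathbb{R}/\mathbb{Z})^n$ with Lebesgue measure $dx$; $L$ is an odd positive integer; $\mathbb{T}^n_L=(\frac1L\mathbb{Z})^n/\mathbb{Z}^n\subset\mathbb{T}^n$; $m_L=L^{-n}\sum_{v\in\mathbb{T}^n_L}\delta_v$; $\mathbb{Z}^n_L=\{z\in\mathbb{Z}^n:\max_k|z_k|<L/2\}$; $a_n=\frac{2}{\Gamma(n/2)(4\pi)^{n/2}}$; $\lambda_z=(2\pi|z|)^2$; $\lambda_{L,z}=4L^2\sum_{k=1}^n\sin^2(\pi z_k/L)$. Fix $\hat{\mathbb{Z}}^n\subset\mathbb{Z}^n\setminus\{0\}$ with $\mathbb{Z}^n\setminus\{0\}=\hat{\mathbb{Z}}^n\,\dot\cup\,(-\hat{\mathbb{Z}}^n)$ and set $\varphi_0=1$,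 $\varphi_z(x)=\sqrt2\cos(2\pi z\cdot x)$ for $z\in\hat{\mathbb{Z}}^n$, $\varphi_z(x)=\sqrt2\sin(2\pi z\cdot x)$ for $z\in-\hat{\mathbb{Z}}^n$. Let $(\xi_z)_{z\in\mathbb{Z}^n\setminus\{0\}}$ be i.i.d. standard normal variables on $(\Omega,\mathfrak A,\mathbf P)$. Discrete field and discrete LQG measure: $h_L(v)=a_n^{-1/2}\sum_{z\in\mathbb{Z}^n_L\setminus\{0\}}\lambda_{L,z}^{-n/4}\xi_z\varphi_z(v)$, $v\in\mathbb{T}^n_L$, with covariance $k_L(v,u)=\frac1{a_n}\sum_{z\in\mathbb{Z}^n_L\setminus\{0\}}\lambda_{L,z}^{-n/2}\cos(2\pi z\cdot(v-u))$, and $d\mu_L(v)=\exp\big(\gamma h_L(v)-\frac{\gamma^2}2k_L(v,v)\big)dm_L(v)$. LQG measure on $\mathbb{T}^n$: put $h_{\sharp,L}(x)=a_n^{-1/2}\sum_{z\in\mathbb{Z}^n_L\setminus\{0\}}\lambda_z^{-n/4}\xi_z\varphi_z(x)$, $k_{\sharp,L}(x,y)=\frac1{a_n}\sum_{z\in\mathbb{Z}^n_L\setminus\{0\}}\lambda_z^{-n/2}\cos(2\pi z\cdot(x-y))$ and $d\mu_{\sharp,L}(x)=\exp\big(\gamma h_{\sharp,L}(x)-\frac{\gamma^2}2k_{\sharp,L}(x,x)\big)dx$. It is known that for $|\gamma|<\sqrt{2n}$ there is an a.s. unique random Borel measure $\mu$ on $\mathbb{T}^n$ with $\mu_{\sharp,L}\to\mu$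 weakly, $\mathbf P$-a.s., as $L\to\infty$ (and $\int f\,d\mu_{\sharp,L}\to\int f\,d\mu$ a.s. and in $L^1(\mathbf P)$ for each $f\in L^1(\mathbb{T}^n)$); $\mu$ is called the polyharmonic LQG measure. *)

(* Defs.v *)
From HB Require Import structures.
From mathcomp Require Import all_boot all_order all_algebra.
From mathcomp Require Import generic_quotient finmap.
From mathcomp Require Import all_classical all_reals all_analysis measurable_realfun.

Set Implicit Arguments.
Unset Strict Implicit.
Unset Printing Implicit Defensive.

Import Order.TTheory GRing.Theory Num.Theory.
Import numFieldNormedType.Exports.

Local Open Scope classical_set_scope.
Local Open Scope quotient_scope.
Local Open Scope ring_scope.

Section torus.
Context (R : realType) (n : nat).

Definition lattice_eq (x y : 'rV[R]_n) : bool :=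
  [forall k, x 0 k - y 0 k \is a Num.int].

Lemma lattice_eq_is_equiv : equiv_class_of lattice_eq.
Proof.
split=> [x|x y|y x z].
- by apply/forallP => k; rewrite subrr rpred0.
- by apply/forallP/forallP => h k; rewrite -opprB rpredN.
- move=> /forallP xy /forallP yz; apply/forallP => k.
  by rewrite -(subrKA (y 0 k)) rpredD.
Qed.

Canonical lattice_equiv := EquivRelPack lattice_eq_is_equiv.

Definition torus : Type := quotient_topology {eq_quot lattice_equiv}.

HB.instance Definition _ := Topological.on torus.
HB.instance Definition _ := Quotient.on torus.
HB.instance Definition _ := isPointed.Build torus (\pi_torus (0 : 'rV[R]_n)).

Definition torus_display : measure_display. Proof. by constructor. Qed.

Definition torus_borel : set (set torus) := <<s @open torus >>.

Let torus_borel0 : torus_borel set0.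
Proof. exact: sigma_algebra0. Qed.

Let torus_borelC (A : set torus) : torus_borel A -> torus_borel (~` A).
Proof. exact: sigma_algebraC. Qed.

Let torus_borel_bigcup (F : (set torus)^nat) :
  (forall i, torus_borel (F i)) -> torus_borel (\bigcup_i F i).
Proof. exact: sigma_algebra_bigcup. Qed.

HB.instance Definition _ := @isMeasurable.Build torus_display torus torus_borel
  torus_borel0 torus_borelC torus_borel_bigcup.

Definition torus_proj (x : 'rV[R]_n) : torus := \pi_torus x.

Lemma torus_projP (x y : 'rV[R]_n) :
  torus_proj x = torus_proj y <-> lattice_eq x y.
Proof.
rewrite -[lattice_eq x y]/(lattice_equiv x y) -eqmodE.
by split=> [h|/eqP //]; apply/eqP.
Qed.

Lemma lattice_eq_repr (x : 'rV[R]_n) : lattice_eq (repr (torus_proj x)) x.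
Proof. by apply/torus_projP; rewrite /torus_proj reprK. Qed.

Lemma torus_proj_continuous : continuous torus_proj.
Proof. exact: pi_continuous. Qed.

Lemma torus_open_measurable (U : set torus) : open U -> measurable U.
Proof. exact: sub_sigma_algebra. Qed.

Lemma torus_continuous_measurable (f : torus -> R) :
  continuous f -> measurable_fun setT f.
Proof.
move=> /continuousP cf.
apply: (measurability _ (RGenOpens.measurableE R)) => _ [_ [a [b ->] <-]].
by rewrite setTI; apply: torus_open_measurable; apply: cf; exact: itv_open.
Qed.

End torus.

Section lebesgue_torus.
Context (R : realType).

Local Notation MR := (measurableTypeR R).

Definition cons_pair n (p : MR * n.-tuple MR) : n.+1.-tuple MR :=
  [the n.+1.-tuple MR of p.1 :: p.2].

Lemma measurable_cons_pair n : measurable_fun setT (@cons_pair n).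
Proof. exact: measurable_cons. Qed.

HB.instance Definition _ n :=
  isMeasurableFun.Build _ _ _ _ (@cons_pair n) (@measurable_cons_pair n).

(* n-fold product of the Lebesgue measure on [0, 1] *)
Fixpoint lebesgue_cube n : probability (n.-tuple MR) R :=
  if n is m.+1 then
    distribution (uniform_prob (@ltr01 R) \x lebesgue_cube m)%E (@cons_pair m)
  else \d_ [tuple].

Definition cube_torus n (t : n.-tuple MR) : torus R n :=
  torus_proj (\row_k tnth t k).

Lemma measurable_open_tuple n (V : set 'rV[R]_n) : open V ->
  measurable [set t : n.-tuple MR | V (\row_k tnth t k)].
Proof.
move=> oV.
pose box (p : {ffun 'I_n -> rat} * nat) : set (n.-tuple MR) :=
  \bigcap_(i in [set: 'I_n])
    ((@tnth n MR ^~ i) @^-1` ball (ratr (p.1 i) : R) p.2.+1%:R^-1).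
have mbox p : measurable (box p).
  apply: fin_bigcap_measurable => [|i _]; first exact: finite_finset.
  rewrite -[X in measurable X]setTI; apply: measurable_tnth => //.
  exact: measurable_ball.
have -> : [set t : n.-tuple MR | V (\row_k tnth t k)] =
    \bigcup_p (if pselect (box p `<=` [set t | V (\row_k tnth t k)])
               then box p else set0).
  apply/seteqP; split=> [t Vt|t [p _]]; last by case: pselect => // h /h.
  have /nbhs_ballP[e /= e0 eV] : nbhs (\row_k tnth t k) V.
    exact: open_nbhs_nbhs.
  have [k ke] : exists k : nat, k.+1%:R^-1 < e / 2.
    by have [|k] := @ltr_add_invr R 0 (e / 2); [rewrite divr_gt0|
      rewrite add0r => ke; exists k].
  have k0 : 0 < k.+1%:R^-1 :> R by rewrite invr_gt0.
  have /choice[q qP] : forall i : 'I_n, exists q : rat,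
      ball (ratr q : R) k.+1%:R^-1 (tnth t i).
    move=> i; have [|q] := @rat_in_itvoo R (tnth t i) (tnth t i + k.+1%:R^-1).
      by rewrite ltrDl.
    rewrite in_itv/= => /andP[q1 q2]; exists q.
    by rewrite /ball/= gtr0_norm ?subr_gt0// ltrBlDl.
  exists ([ffun i => q i], k) => //; case: pselect => [_ i _|].
    by rewrite /= ffunE; exact: qP.
  case=> s bs /=; apply: eV; split=> // i j; rewrite ord1 !mxE [e]splitr.
  have := bs j I; rewrite /= ffunE => sj.
  apply: le_lt_trans (ler_distD (ratr (q j)) _ _) _; apply: ltrD.
    by rewrite distrC; apply: lt_trans (qP j) ke.
  exact: lt_trans sj ke.
apply: countable_bigcupT_measurable => [|p]; first exact: countableP.
by case: pselect => h; [exact: mbox|exact: measurable0].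
Qed.

Lemma measurable_cube_torus n : measurable_fun setT (@cube_torus n).
Proof.
apply: (@measurability _ _ _ _ _ _ (@open (torus R n))) => // _ [U oU <-].
rewrite setTI; apply: (@measurable_open_tuple _ (@torus_proj R n @^-1` U)).
by move/continuousP: (@torus_proj_continuous R n); exact.
Qed.

HB.instance Definition _ n :=
  isMeasurableFun.Build _ _ _ _ (@cube_torus n) (@measurable_cube_torus n).

Definition lebesgue_torus n : probability (torus R n) R :=
  distribution (lebesgue_cube n) (@cube_torus n).

End lebesgue_torus.

Section grid.
Context (R : realType) (n L : nat).

Definition grid_point (j : {ffun 'I_n -> 'I_L}) : torus R n :=
  torus_proj (\row_k ((j k)%:R / L%:R)).

Definition grid_measure (A : set (torus R n)) : \bar R :=
  ((L%:R ^- n)%:E * \sum_j \d_(grid_point j) A)%E.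

Let grid_measure0 : grid_measure set0 = 0%E.
Proof. by rewrite /grid_measure big1 ?mule0// => j _; rewrite measure0. Qed.

Let grid_measure_ge0 A : (0 <= grid_measure A)%E.
Proof.
by rewrite mule_ge0 ?sume_ge0// lee_fin invr_ge0 exprn_ge0.
Qed.

Let grid_measure_sigma_additive : semi_sigma_additive grid_measure.
Proof.
move=> F mF tF mUF; rewrite /grid_measure.
rewrite (_ : (fun k => _) = (fun k => (L%:R ^- n)%:E *
    \sum_j \sum_(0 <= i < k) \d_(grid_point j) (F i))%E); last first.
  apply/funext => k; rewrite -ge0_sume_distrr; last first.
    by move=> i _; apply: sume_ge0.
  by rewrite exchange_big.
apply: cvgeZl => //; apply: cvg_nnesum => j _.
  by apply: nearW => k; apply: sume_ge0.
exact: measure_semi_sigma_additive.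
Qed.

HB.instance Definition _ := isMeasure.Build _ _ _ grid_measure
  grid_measure0 grid_measure_ge0 grid_measure_sigma_additive.

End grid.
Arguments grid_measure : clear implicits.

Section exp_density.
Context d (T : measurableType d) (R : realType).
Variables (m : {measure set T -> \bar R}) (g : {mfun T >-> R}).

Definition exp_density (A : set T) : \bar R :=
  (\int[m]_(x in A) (expR (g x))%:E)%E.

Let exp_density0 : exp_density set0 = 0%E.
Proof. exact: integral_set0. Qed.

Let exp_density_ge0 A : (0 <= exp_density A)%E.
Proof. by apply: integral_ge0 => x _; rewrite lee_fin expR_ge0. Qed.

Let exp_density_sigma_additive : semi_sigma_additive exp_density.
Proof.
apply: semi_sigma_additive_nng_induced => [|x]; last by rewrite lee_fin expR_ge0.
by apply/measurable_EFinP; apply: measurableT_comp.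
Qed.

HB.instance Definition _ := isMeasure.Build _ _ _ exp_density
  exp_density0 exp_density_ge0 exp_density_sigma_additive.

End exp_density.

Section lqg.
Context (R : realType) (n : nat).

Definition Euler_Gamma (s : R) : R :=
  \int[lebesgue_measure]_(t in `]0%R, +oo[) (t `^ (s - 1) * expR (- t)).

Definition lqg_const : R :=
  2 / (Euler_Gamma (n%:R / 2) * (4 * pi) `^ (n%:R / 2)).

Definition zdot (z : 'rV[int]_n) (x : 'rV[R]_n) : R :=
  \sum_k (z 0 k)%:~R * x 0 k.

Definition znorm (z : 'rV[int]_n) : R :=
  Num.sqrt (\sum_k (z 0 k)%:~R ^+ 2).

Definition eigenvalue_torus (z : 'rV[int]_n) : R := (2 * pi * znorm z) ^+ 2.

Definition eigenvalue_grid (L : nat) (z : 'rV[int]_n) : R :=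
  4 * L%:R ^+ 2 * \sum_k sin (pi * (z 0 k)%:~R / L%:R) ^+ 2.

Definition zbox (L : nat) : set 'rV[int]_n :=
  [set z | forall k, `|(z 0 k)%:~R| < L%:R / 2 :> R].

Definition half_lattice (H : set 'rV[int]_n) : Prop :=
  H `|` [set - z | z in H] = ~` [set 0] /\ H `&` [set - z | z in H] = set0.

(* When [half_lattice H], the last case is that of z in -H. *)
Definition fourier_basis (H : set 'rV[int]_n) (z : 'rV[int]_n)
    (x : 'rV[R]_n) : R :=
  if z == 0 then 1
  else if z \in H then Num.sqrt 2 * cos (2 * pi * zdot z x)
  else Num.sqrt 2 * sin (2 * pi * zdot z x).

Definition log_field (H : set 'rV[int]_n) (lam : 'rV[int]_n -> R) (L : nat)
    (xi : 'rV[int]_n -> R) (x : 'rV[R]_n) : R :=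
  (Num.sqrt lqg_const)^-1 * \sum_(z \in zbox L `\ 0)
    lam z `^ (- (n%:R / 4)) * xi z * fourier_basis H z x.

Definition log_cov (lam : 'rV[int]_n -> R) (L : nat) (x y : 'rV[R]_n) : R :=
  lqg_const^-1 * \sum_(z \in zbox L `\ 0)
    lam z `^ (- (n%:R / 2)) * cos (2 * pi * zdot z (x - y)).

(* [repr] may be used since [log_field] is Z^n-periodic. *)
Definition lqg_exponent (H : set 'rV[int]_n) (gamma : R)
    (lam : 'rV[int]_n -> R) (L : nat) (xi : 'rV[int]_n -> R)
    (x : torus R n) : R :=
  gamma * log_field H lam L xi (repr x)
    - gamma ^+ 2 / 2 * log_cov lam L (repr x) (repr x).

Lemma periodic_Dint (f : R -> R) (x : R) (m : int) :
  periodic f (pi *+ 2) -> f (x + 2 * pi * m%:~R) = f x.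
Proof.
move=> pf.
have pfn k y : f (y + 2 * pi * k%:R) = f y.
  by rewrite mulr_natr mulr_natl periodicn.
case: m => k; first by rewrite -pmulrn.
by rewrite NegzE mulrNz mulrN -(pfn k.+1 (x - _)) -pmulrn subrK.
Qed.

Lemma zdot_lattice (z : 'rV[int]_n) (x y : 'rV[R]_n) : lattice_eq x y ->
  exists m : int, zdot z x = zdot z y + m%:~R.
Proof.
move=> /forallP xy; rewrite /zdot.
suff /intrP[m mE] : \sum_k (z 0 k)%:~R * (x 0 k - y 0 k) \is a @Num.int R.
  exists m; rewrite -mE -big_split/=; apply: eq_bigr => k _.
  by rewrite mulrBr addrC subrK.
by apply: rpred_sum => k _; rewrite rpredM// intr_int.
Qed.

Lemma fourier_basis_lattice H z (x y : 'rV[R]_n) : lattice_eq x y ->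
  fourier_basis H z x = fourier_basis H z y.
Proof.
move=> /(zdot_lattice z)[m mE]; rewrite /fourier_basis mE mulrDr.
by rewrite !(periodic_Dint _ _ (@cosD2pi R)) !(periodic_Dint _ _ (@sinD2pi R)).
Qed.

Lemma zdot_continuous (z : 'rV[int]_n) : continuous (zdot z).
Proof.
apply: (@continuous_big R _ +%R 0 predT _ 'rV[R]_n _
  (fun k x => (z 0 k)%:~R * x 0 k)) => [x|k _ x].
  by apply: cvgD; [exact: cvg_fst|exact: cvg_snd].
by apply: cvgMl_tmp; [exact: nbhs_filter|exact: coord_continuous].
Qed.

Lemma fourier_basis_continuous H z : continuous (fourier_basis H z).
Proof.
have trigc (f : R -> R) : continuous f ->
    continuous (fun x => Num.sqrt 2 * f (2 * pi * zdot z x)).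
  move=> cf x.
  apply: (@continuous_comp _ _ _ (zdot z) (fun y => Num.sqrt 2 * f (2 * pi * y))).
    exact: zdot_continuous.
  apply: continuousM; first exact: cst_continuous.
  apply: (@continuous_comp _ _ _ (fun y => 2 * pi * y) f); last exact: cf.
  by apply: continuousM; [exact: cst_continuous|exact: cvg_id].
rewrite /fourier_basis; case: (z == 0); first by move=> x; exact: cst_continuous.
case: (z \in H); apply: trigc; [exact: continuous_cos|exact: continuous_sin].
Qed.

Lemma fourier_basis_torus_continuous H z :
  continuous (fun x : torus R n => fourier_basis H z (repr x)).
Proof.
apply/quotient_continuous => x.
rewrite (_ : _ \o _ = fourier_basis H z); first exact: fourier_basis_continuous.
apply/funext => y /=; apply: fourier_basis_lattice.
exact: lattice_eq_repr.
Qed.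

Lemma finite_zbox L : finite_set (zbox L).
Proof.
pose g (j : {ffun 'I_n -> 'I_(L + L).+1}) : 'rV[int]_n :=
  \row_k ((j k)%:Z - L%:Z).
apply: (@sub_finite_set _ _ (g @` setT)); last by apply: finite_image; exact: finite_finset.
move=> z zL; have zk k : `|z 0 k| <= L%:Z.
  rewrite -(ler_int R) intr_norm; apply: ltW.
  by apply: lt_le_trans (zL k) _; rewrite ler_pdivrMr// ler_peMr// ler1n.
exists [ffun k : 'I_n => inord `|(z 0 k + L%:Z)%R|%N] => //.
apply/rowP => k; rewrite mxE ffunE.
have := zk k; rewrite ler_norml => /andP[lz zl].
have zL0 : 0 <= z 0 k + L%:Z by rewrite -lerBlDr sub0r.
rewrite inordK; first by rewrite gez0_abs// addrK.
by rewrite ltnS -lez_nat gez0_abs// PoszD lerD2r.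
Qed.

Lemma measurable_lqg_exponent H gamma lam L xi :
  measurable_fun setT (lqg_exponent H gamma lam L xi).
Proof.
have fz : finite_set (zbox L `\ 0) by apply: finite_setD; exact: finite_zbox.
apply: measurable_funB; apply: measurable_funM => //.
  rewrite /log_field; under eq_fun do rewrite (fsbig_finite _ _ fz)/=.
  apply: measurable_funM => //; apply: measurable_sum => z.
  apply: measurable_funM => //; apply: torus_continuous_measurable.
  exact: fourier_basis_torus_continuous.
rewrite /log_cov (_ : (fun x : torus R n => _) = cst (log_cov lam L 0 0))//.
by apply/funext => x; rewrite /log_cov !subrr.
Qed.

HB.instance Definition _ H gamma lam L xi :=
  isMeasurableFun.Build _ _ _ _ (lqg_exponent H gamma lam L xi)
    (measurable_lqg_exponent H gamma lam L xi).

Definition lqg_sharp (H : set 'rV[int]_n) (gamma : R) (L : nat)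
    (xi : 'rV[int]_n -> R) : {measure set (torus R n) -> \bar R} :=
  exp_density (lebesgue_torus R n) (lqg_exponent H gamma eigenvalue_torus L xi).

Definition lqg_grid (H : set 'rV[int]_n) (gamma : R) (L : nat)
    (xi : 'rV[int]_n -> R) : {measure set (torus R n) -> \bar R} :=
  exp_density (grid_measure R n L)
    (lqg_exponent H gamma (eigenvalue_grid L) L xi).

Definition weak_cvg (m_ : nat -> {measure set (torus R n) -> \bar R})
    (m : {measure set (torus R n) -> \bar R}) : Prop :=
  forall f : torus R n -> R, continuous f ->
    (\int[m_ k]_x (f x)%:E)%E @[k --> \oo] --> (\int[m]_x (f x)%:E)%E.

End lqg.

Section probability.
Context d (Omega : measurableType d) (R : realType) (P : probability Omega R).

Definition mutually_independent (I : choiceType) (D : set I)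
    (X : I -> {RV P >-> R}) : Prop :=
  forall (J : {fset I}) (B : I -> set R),
    [set` J] `<=` D -> (forall i, measurable (B i)) ->
    P (\bigcap_(i in [set` J]) X i @^-1` B i) =
    (\big[*%E/1]_(i <- J) P (X i @^-1` B i))%E.

Definition iid_std_normal (I : choiceType) (D : set I)
    (X : I -> {RV P >-> R}) : Prop :=
  mutually_independent D X /\
  forall i, D i -> forall A, measurable A ->
    distribution P (X i) A = normal_prob 0 1 A.

(* m.*2.+1 runs through the odd L. *)
Definition is_lqg n (H : set 'rV[int]_n) (gamma : R)
    (xi : 'rV[int]_n -> {RV P >-> R}) (mu : R.-ker Omega ~> torus R n) : Prop :=
  {ae P, forall w,
    weak_cvg (fun m => lqg_sharp H gamma m.*2.+1 (fun z => xi z w)) (mu w)}.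

Definition cvg_in_probability (X_ : nat -> Omega -> R) (X : Omega -> R) : Prop :=
  forall eps : R, 0 < eps ->
    P [set w | eps <= `|X_ k w - X w|] @[k --> \oo] --> 0%E.

Definition cvg_in_L1 (X_ : nat -> Omega -> R) (X : Omega -> R) : Prop :=
  [/\ forall k, P.-integrable setT (EFin \o X_ k),
      P.-integrable setT (EFin \o X) &
      (\int[P]_w `|X_ k w - X w|%:E)%E @[k --> \oo] --> 0%E].

End probability.

(* Main.v *)
Require Import Defs.
From HB Require Import structures.
From mathcomp Require Import all_boot all_order all_algebra finmap.
From mathcomp Require Import all_classical all_reals all_analysis.
From mathcomp Require Import measurable_realfun ring lra zify.

Set Implicit Arguments.
Unset Strict Implicit.
Unset Printing Implicit Defensive.

Import Order.TTheory GRing.Theory Num.Theory.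
Import numFieldNormedType.Exports.

Local Open Scope classical_set_scope.
Local Open Scope ring_scope.

(* Only second moments are needed: |gamma| < sqrt (n / e) forces 2 gamma^2 < n.
   Compare, on a grid with N = 2k+1 points per side, the integral of a bounded
   function against exp (gamma h - gamma^2 k / 2) with the one obtained by keeping
   only the frequencies |z| < 2^J.  The second moment of the difference is at most a
   grid average of |exp (b K) - exp (b K_J)|, where b = gamma^2, K is the covariance
   kernel and K_J its low-frequency part.  The kernels and their exponentials have
   nonnegative Fourier coefficients with respect to the grid, so the average of
   exp (b K_j) against the j-th dyadic shell of K is at most the largest coefficient of
   the shell, O (2^(-nj)), times exp (b K_j (0)) = O (2^(2bj)); the logarithmic bound
   K_j (0) <= 2 ln 2^j + O (1) comes from the theta function and is where the constant
   a_n enters (the optimal factor is 1; the loss pays for a crude comparison of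
   lambda_{L,z} with lambda_z and is affordable because e > 2).  This gives a bound
   O (s^J), s < 1, uniform in N, both for the eigenvalues lambda_{L,z} and for the
   larger lambda_z.  Riemann sums and Fatou's lemma carry the bound for lambda_z over to
   the torus and then to mu, which avoids all exchanges of integrals.  At a fixed cutoff
   J the grid integrals converge in L^1 by dominated convergence. *)

(** * Positive definite functions on grids *)

Section waves.
Context {R : realType} {n : nat}.
Implicit Types (z w : 'rV[int]_n) (x y : 'rV[R]_n).

(** The sharpness comes from Fourier inversion. If [F] has nonnegative coefficients on the grid,
    they add up to [F 0], so pairing [F] with a shell whose coefficients are at most [A] costs only
    [A * F 0], without pointwise control of the kernels near the diagonal. For this the frequencies
    must form a complete set of residues modulo N, symmetric under negation, as they do for odd N =
    2k+1. The factor 2 in the logarithmic bound has the following origin: for frequencies small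
    compared with N, lambda_{L,z} is at least (1 - 1/(2n))^2 lambda_z, and by Bernoulli's inequality
    the power -n/2 turns this into a factor at most 2; the other frequencies contribute O (1) in
    total. The shell terms thus decay like 2^((2b-n)j). A shell is a signed function, controlled in
    absolute value through its square, which costs a square root of this rate; another one is lost
    between second moments and L^1. Since mu is known only as an almost sure limit, even the
    integrability of the limit has to come out of these bounds. *)

Definition wave z x : R := cos (2 * pi * zdot z x).

Lemma zdotDl z w x : zdot (z + w) x = zdot z x + zdot w x.
Proof.
by rewrite /zdot -big_split/=; apply: eq_bigr => k _; rewrite mxE intrD mulrDl.
Qed.

Lemma zdotNl z x : zdot (- z) x = - zdot z x.
Proof.
by rewrite /zdot -sumrN; apply: eq_bigr => k _; rewrite mxE mulrNz mulNr.
Qed.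

Lemma zdotDr z x y : zdot z (x + y) = zdot z x + zdot z y.
Proof.
by rewrite /zdot -big_split/=; apply: eq_bigr => k _; rewrite mxE mulrDr.
Qed.

Lemma zdotNr z x : zdot z (- x) = - zdot z x.
Proof. by rewrite /zdot -sumrN; apply: eq_bigr => k _; rewrite mxE mulrN. Qed.

Lemma wave0r z : wave z (0 : 'rV[R]_n) = 1.
Proof.
by rewrite /wave /zdot big1 ?mulr0 ?cos0// => k _; rewrite mxE mulr0.
Qed.

Lemma waveM z w x : wave z x * wave w x = (wave (z + w) x + wave (z - w) x) / 2.
Proof.
rewrite /wave !zdotDl zdotNl !mulrDr mulrN cosD cosB.
by field.
Qed.

Lemma cos_congr_int (u v t : R) : u - v \is a Num.int ->
  cos (2 * pi * u + t) = cos (2 * pi * v + t).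
Proof.
move=> /intrP[k uv].
have -> : 2 * pi * u + t = 2 * pi * v + t + 2 * pi * k%:~R by rewrite -uv; ring.
exact: periodic_Dint (@cosD2pi R).
Qed.

Lemma cos2pi_eq1 (u : R) : cos (2 * pi * u) = 1 -> u \is a Num.int.
Proof.
pose y := u - (Num.floor u)%:~R.
have y0 : 0 <= y by rewrite subr_ge0 Num.Theory.floor_le_tmp.
have y1 : y < 1.
  by rewrite /y ltrBlDr addrC -[X in _ + X](_ : 1%:~R = 1)// -intrD floorD1_gt.
rewrite -[2 * pi * u]addr0 (@cos_congr_int u y); last first.
  by rewrite /y opprB addrC subrK intr_int.
rewrite addr0 => cy; suff y00 : y = 0.
  by move/eqP: y00; rewrite subr_eq0 => /eqP ->; exact: intr_int.
apply/eqP; move: y0; rewrite le_eqVlt eq_sym => /orP[//|y0].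
have : sin (pi * y) ^+ 2 = 0.
  move: cy; rewrite (_ : 2 * pi * y = (pi * y) *+ 2); last by rewrite mulr2n; ring.
  by rewrite cos_mulr2n; have := cos2Dsin2 (pi * y); nra.
have : 0 < sin (pi * y).
  by rewrite sin_gt0_pi// mulr_gt0 ?pi_gt0//= gtr_pMr ?pi_gt0.
by move=> s0 /eqP; rewrite sqrf_eq0 (gt_eqF s0).
Qed.

(* Averaging [S (t + d)] and [S (t - d)] multiplies the trigonometric sum by
   [cos d], so a shift-invariant sum vanishes unless [cos d = 1]. *)
Lemma sum_cos_eq0 (I : Type) (r : seq I) (phi : I -> R) (d : R) :
  (forall t, \sum_(i <- r) cos (phi i + (t + d)) = \sum_(i <- r) cos (phi i + t)) ->
  cos d != 1 -> forall t, \sum_(i <- r) cos (phi i + t) = 0.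
Proof.
move=> Sd d1 t; set S := \sum_(i <- r) _.
have S1 : \sum_(i <- r) cos (phi i + (t - d)) = S.
  by rewrite -(Sd (t - d)); apply: eq_bigr => i _; rewrite subrK.
have : \sum_(i <- r) cos (phi i + (t + d)) + \sum_(i <- r) cos (phi i + (t - d))
    = 2 * cos d * S.
  rewrite -big_split /= mulr_sumr; apply: eq_bigr => i _.
  by rewrite !addrA; move: (phi i + t) => X; rewrite cosD cosB; ring.
rewrite Sd S1 -/S.
move=> SS; have : (1 - cos d) * S = 0 by lra.
by move=> /eqP; rewrite mulf_eq0 subr_eq0 eq_sym (negbTE d1)/= => /eqP.
Qed.

Lemma wave_lattice z x y : lattice_eq x y -> wave z x = wave z y.
Proof.
move=> /(zdot_lattice z)[m mE]; rewrite /wave mE mulrDr.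
exact: periodic_Dint (@cosD2pi R).
Qed.

Definition gridpt N (j : {ffun 'I_n -> 'I_N}) : 'rV[R]_n :=
  \row_k ((j k)%:R / N%:R).

End waves.

Section grid_fourier.
Context {R : realType} {n p : nat}.
Local Notation N := p.+1.
Local Notation G := {ffun 'I_n -> 'I_N}.
Implicit Types (z w : 'rV[int]_n) (F : G -> R) (i j : G).

Let gp : G -> 'rV[R]_n := @gridpt R n N.

(** Addition on ['I_N] is modulo N, and the carry [(i k + j k) %/ N] is an integer. Modulo the
    lattice, [gridpt] is thus a group morphism from (Z/N)^n, and translations of the grid become
    reindexings of finite sums. *)
Lemma gridptD i j : lattice_eq (gp (i + j)) (gp i + gp j).
Proof.
apply/forallP => k; rewrite !mxE ffunE /=.
have -> : ((i k + j k) %% N)%N%:R / N%:R - ((i k)%:R / N%:R + (j k)%:R / N%:R)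
    = - ((i k + j k) %/ N)%N%:R :> R.
  have /(congr1 (fun u : nat => u%:R : R)) := divn_eq (i k + j k) N.
  rewrite !natrD natrM => e.
  have -> : ((i k + j k) %% N)%:R =
      ((i k)%:R + (j k)%:R) - ((i k + j k) %/ N)%:R * N%:R :> R.
    by rewrite e addrC addKr.
  by field.
by rewrite rpredN natr_int.
Qed.

Lemma gridpt0 : gp 0 = 0.
Proof. by apply/rowP => k; rewrite !mxE ffunE mul0r. Qed.

Lemma gridptB i j : lattice_eq (gp (i - j)) (gp i - gp j).
Proof.
have /forallP h := gridptD (i - j) j.
apply/forallP => k; have := h k; rewrite subrK.
have -> : gp i 0 k - (gp (i - j) + gp j) 0 k = - (gp (i - j) 0 k - (gp i - gp j) 0 k).
  by rewrite [(gp (i - j) + gp j) 0 k]mxE [(gp i - gp j) 0 k]mxE [(- gp j) 0 k]mxE; ring.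
by rewrite rpredN.
Qed.

Lemma wave_gridptB z i j : wave z (gp i - gp j) = wave z (gp (i - j)).
Proof. by symmetry; apply/wave_lattice/gridptB. Qed.

(** Shifting the grid by one step in direction [k] adds 2 pi z_k / N to every phase, modulo 2 pi.
    The cosine of this increment is 1 only if N divides z_k, so [sum_cos_eq0] applies. *)
Lemma sum_grid_cos z k t : ~~ (N %| `|z 0%R k|)%N ->
  \sum_(j : G) cos (2 * pi * zdot z (gp j) + t) = 0.
Proof.
move=> Nz; pose e : G := [ffun l => if l == k then inord 1 else 0].
(* The form [1 %% N] also covers N = 1, where [inord 1] is 0. *)
have ze : zdot z (gp e) = (z 0 k)%:~R * ((1 %% N)%N%:R / N%:R).
  rewrite /zdot (bigD1 k)//= big1 ?addr0.
    rewrite mxE ffunE eqxx; case: (p) => [|q]; last by rewrite inordK.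
    by rewrite (ord1 (inord 1)).
  by move=> l lk; rewrite mxE ffunE (negbTE lk) mul0r mulr0.
apply: (@sum_cos_eq0 R _ _ (fun j => 2 * pi * zdot z (gp j)) (2 * pi * zdot z (gp e))).
  move=> s; rewrite [RHS](reindex_inj (addIr e))/=; apply: eq_bigr => j _.
  have /(zdot_lattice z)[m ->] := gridptD j e.
  rewrite zdotDr [RHS](_ : _ = cos (2 * pi * zdot z (gp j) +
     (s + 2 * pi * zdot z (gp e)) + 2 * pi * m%:~R)); last by congr cos; ring.
  by rewrite (periodic_Dint _ _ (@cosD2pi R)).
apply/negP => /eqP /cos2pi_eq1; rewrite ze => /intrP[m mE].
move/negP : Nz; apply; case: (p) mE => [|q]; first by rewrite dvd1n.
rewrite modn_small// => mE.
have : (z 0 k)%:~R = (m * q.+2%:Z)%:~R :> R.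
  by rewrite intrM -mE -[q.+2%:Z%:~R]/(q.+2%:R); field.
by move/intr_inj => ->; rewrite abszM dvdn_mull.
Qed.

Definition avg F : R := N%:R ^- n * \sum_j F j.

Lemma avgD F F' : avg (F \+ F') = avg F + avg F'.
Proof. by rewrite /avg big_split/= mulrDr. Qed.

Lemma avgZ c F : avg (c \*o F) = c * avg F.
Proof. by rewrite /avg -mulr_sumr mulrCA. Qed.

Lemma avg_sum (I : Type) (r : seq I) (P : pred I) (F : I -> G -> R) :
  avg (fun j => \sum_(i <- r | P i) F i j) = \sum_(i <- r | P i) avg (F i).
Proof. by rewrite /avg exchange_big mulr_sumr. Qed.

Lemma avg_cst c : avg (fun=> c) = c.
Proof.
rewrite /avg sumr_const card_ffun !card_ord -[c *+ _]mulr_natr natrX.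
by rewrite mulrCA mulVf ?mulr1// expf_neq0.
Qed.

Lemma eq_avg F F' : F =1 F' -> avg F = avg F'.
Proof. by move=> FF'; congr (_ * _); apply: eq_bigr => j _. Qed.

Lemma ler_avg F F' : (forall j, F j <= F' j) -> avg F <= avg F'.
Proof.
by move=> FF'; rewrite ler_wpM2l ?invr_ge0 ?exprn_ge0// ler_sum.
Qed.

Lemma cvg_avg (F_ : (G -> R)^nat) F :
  (forall j, F_ k j @[k --> \oo] --> F j) ->
  avg (F_ k) @[k --> \oo] --> avg F.
Proof.
move=> FF; apply: cvgM; first exact: cvg_cst.
by apply: cvg_big => //; exact: add_continuous.
Qed.

(** Nonnegative Fourier coefficients; testing cosines suffices because the functions of interest are
    even. All integer frequencies are allowed, not one set of residues, so that shifted frequencies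
    need no reduction modulo N. *)
Definition posdef F := forall w, 0 <= avg (fun j => F j * wave w (gp j)).

Lemma posdef1 : posdef (fun=> 1).
Proof.
move=> w; under [X in avg X]eq_fun do rewrite mul1r.
have [/existsP[k Nz]|Nz] := boolP [exists k, ~~ (N %| `|w 0%R k|)%N].
    have := sum_grid_cos 0 Nz; rewrite /avg /wave.
  by under eq_bigr do rewrite addr0; move=> ->; rewrite mulr0.
apply: le_trans (_ : avg (fun=> 1) <= _); first by rewrite avg_cst.
apply: ler_avg => j; rewrite /wave -[2 * pi * _]addr0 (@cos_congr_int _ _ 0) ?mulr0 ?addr0 ?cos0//.
rewrite subr0 /zdot rpred_sum// => k _.
move: Nz; rewrite negb_exists => /forallP/(_ k); rewrite negbK.
move=> Nw; have /dvdzP[q ->] : (N%:Z %| w 0%R k)%Z by rewrite dvdzE.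
rewrite mxE intrM (_ : _ * _ = q%:~R * (j k)%:R).
  by rewrite rpredM ?intr_int ?natr_int.
by rewrite -[N%:Z%:~R]/(N%:R); field.
Qed.

Lemma posdef_sum (I : Type) (r : seq I) (P : pred I) (a : I -> R) (F : I -> G -> R) :
  (forall k, 0 <= a k) -> (forall k, posdef (F k)) ->
  posdef (fun j => \sum_(k <- r | P k) a k * F k j).
Proof.
move=> a0 Fp w; under eq_avg do rewrite mulr_suml.
rewrite avg_sum; apply: sumr_ge0 => k _.
by under eq_avg do rewrite -mulrA; rewrite avgZ mulr_ge0//; exact: Fp.
Qed.

(** By [waveM], the coefficient at [w] is the mean of the coefficients of [F] at [z + w] and
    [z - w]. *)
Lemma posdef_wave F z : posdef F -> posdef (fun j => F j * wave z (gp j)).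
Proof.
move=> Fp w; rewrite (@eq_avg _ (fun j => 2^-1 * (F j * wave (z + w) (gp j)
    + F j * wave (z - w) (gp j)))); last first.
  by move=> j; rewrite -mulrA waveM; ring.
by rewrite avgZ avgD mulr_ge0 ?invr_ge0// addr_ge0//; exact: Fp.
Qed.

Lemma eq_posdef F F' : F =1 F' -> posdef F -> posdef F'.
Proof. by move=> FF Fp w; have := Fp w; under eq_avg do rewrite FF. Qed.

(** Multiplication by the kernel preserves nonnegative coefficients, so its powers and the partial
    sums of the exponential series have them. The average is a finite sum, hence the pointwise limit
    suffices. *)
Lemma posdef_expR (r : seq 'rV[int]_n) (P : pred 'rV[int]_n) (a : 'rV[int]_n -> R) b :
  (forall z, 0 <= a z) -> 0 <= b ->
  posdef (fun j => expR (b * \sum_(z <- r | P z) a z * wave z (gp j))).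
Proof.
move=> a0 b0; set K := fun j => \sum_(z <- r | P z) a z * wave z (gp j).
have pK F : posdef F -> posdef (fun j => F j * K j).
  move=> Fp; apply: (@eq_posdef (fun j => \sum_(z <- r | P z) a z * (F j * wave z (gp j)))).
    by move=> j; rewrite mulr_sumr; apply: eq_bigr => z _; rewrite mulrCA.
  by apply: posdef_sum => // z; exact: posdef_wave.
have pX k : posdef (fun j => K j ^+ k).
  elim: k => [|k ih]; first exact: eq_posdef posdef1.
  by apply: eq_posdef (pK _ ih) => j; rewrite exprSr.
move=> w; apply: (@closed_cvg _ _ (\oo : set_system nat) _
  (fun N => avg (fun j => series (exp_coeff (b * K j)) N * wave w (gp j)))
  (fun x => 0 <= x) _ _ _ _); first exact: closed_ge.
- apply: nearW => k; rewrite /series/=.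
  apply: (@eq_posdef (fun j => \sum_(l <- index_iota 0 k) (b ^+ l / l`!%:R) * K j ^+ l) _ _ _ w).
    by move=> j; apply: eq_bigr => l _; rewrite /exp_coeff/= exprMn mulrAC.
  by apply: posdef_sum => // l; rewrite divr_ge0// exprn_ge0.
- apply: cvg_avg => j; apply: cvgM; last exact: cvg_cst.
  exact: is_cvg_series_exp_coeff.
Qed.

End grid_fourier.

(** * Frequency boxes and Fourier inversion *)

Section box.
Context {R : realType} {n : nat}.
Implicit Types (z w : 'rV[int]_n) (m : nat).

(** Frequencies are indexed by the same type as the points of the grid with 2m+1 points per side, so
    that a sum over frequencies can be read as a sum over the grid. *)
Definition box_pt m (i : {ffun 'I_n -> 'I_m.*2.+1}) : 'rV[int]_n :=
  \row_k ((i k)%:Z - m%:Z).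

Definition box_seq m : seq 'rV[int]_n := [seq box_pt i | i <- enum {ffun 'I_n -> 'I_m.*2.+1}].

Definition inbox m : pred 'rV[int]_n := fun z => [forall k, (`|z 0%R k| <= m)%N].

Lemma box_pt_inj m : injective (@box_pt m).
Proof.
move=> i i' /rowP ii'; apply/ffunP => k; apply/val_inj => /=.
by have := ii' k; rewrite !mxE => /addIr [].
Qed.

Lemma box_seq_uniq m : uniq (box_seq m).
Proof. by rewrite map_inj_uniq ?enum_uniq//; exact: box_pt_inj. Qed.

Lemma mem_box_seq m z : (z \in box_seq m) = inbox m z.
Proof.
apply/mapP/forallP => [[i _ ->] k|zm].
  by rewrite mxE; move: (i k) => [q /= qm]; lia.
exists [ffun k => inord `|(z 0 k + m%:Z)%R|%N]; first by rewrite mem_enum.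
apply/rowP => k; rewrite mxE ffunE; have := zm k.
by move: (z 0 k) => u um; rewrite inordK; lia.
Qed.

Lemma inboxN m z : inbox m (- z) = inbox m z.
Proof. by apply: eq_forallb => k; rewrite mxE abszN. Qed.

Lemma inboxW m m' z : (m <= m')%N -> inbox m z -> inbox m' z.
Proof. by move=> mm' /forallP zm; apply/forallP => k; exact: leq_trans (zm k) mm'. Qed.

Lemma box_seqN m : perm_eq [seq - z | z <- box_seq m] (box_seq m).
Proof.
apply: uniq_perm; [by rewrite map_inj_uniq ?box_seq_uniq//; exact: oppr_inj|exact: box_seq_uniq|].
move=> z; rewrite -[z in LHS]opprK mem_map; last exact: oppr_inj.
by rewrite !mem_box_seq inboxN.
Qed.

Section fourier_inversion.
Variable m : nat.
Local Notation N := m.*2.+1.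
Local Notation G := {ffun 'I_n -> 'I_N}.
Let gp : G -> 'rV[R]_n := @gridpt R n N.

(** Frequency and position can be exchanged in z . (j/N): up to a constant phase this is the sum
    over the grid of the wave of frequency [j]. Unless [j] is 0, one of its coordinates lies
    strictly between 0 and N. *)
Lemma sum_box_seq_wave w (j : G) :
  \sum_(z <- box_seq m) wave (z + w) (gp j) = if j == 0 then N%:R ^+ n else 0.
Proof.
rewrite big_map big_enum/=; case: eqP => [->|/eqP j0].
  rewrite /gp gridpt0; under eq_bigr do rewrite wave0r.
  by rewrite sumr_const card_ffun !card_ord natrX.
have /existsP[k jk] : [exists k, j k != 0].
  apply: contraR j0; rewrite negb_exists => /forallP j0.
  by apply/eqP/ffunP => k; rewrite ffunE; apply/eqP; have := j0 k; rewrite negbK.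
rewrite -[RHS](@sum_grid_cos R n m.*2 (\row_k (j k)%:Z) k
  (2 * pi * zdot (w - const_mx m%:Z) (gp j))); last first.
  by rewrite mxE absz_nat gtnNdvd ?ltn_ord// lt0n; move: jk; rewrite -val_eqE.
apply: eq_bigr => i _; rewrite /wave -mulrDr; congr (cos (_ * _)).
have -> : zdot (\row_k (j k)%:Z) (gridpt i) = zdot (\row_k (i k)%:Z) (gp j).
  by apply: eq_bigr => l _; rewrite !mxE; rewrite mulrCA.
rewrite -zdotDl; congr (zdot _ _); apply/rowP => l; rewrite !mxE.
by ring.
Qed.

Lemma sum_box_seq_avg (F : G -> R) w :
  \sum_(z <- box_seq m) avg (fun j => F j * wave (z + w) (gp j)) = F 0.
Proof.
rewrite -avg_sum; under eq_avg do rewrite -mulr_sumr sum_box_seq_wave.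
rewrite /avg (bigD1 (0 : G))//= eqxx big1 ?addr0.
  by rewrite mulrCA mulVf ?mulr1// expf_neq0// pnatr_eq0.
by move=> j /negbTE ->; rewrite mulr0.
Qed.

(** The coefficients of [F] are nonnegative and add up to [F 0], so replacing the weights by [A] and
    restoring the frequencies outside [Q] only increases the sum. *)
Lemma sum_shell_le (F : G -> R) (Q : pred 'rV[int]_n) (a : 'rV[int]_n -> R) A w :
  posdef F -> (forall z, 0 <= a z) -> 0 <= A ->
  (forall z, z \in box_seq m -> Q z -> a z <= A) ->
  \sum_(z <- box_seq m | Q z) a z * avg (fun j => F j * wave (z + w) (gp j)) <= A * F 0.
Proof.
move=> Fp a0 A0 aA; rewrite -(sum_box_seq_avg F w) mulr_sumr big_mkcond/=.
rewrite big_seq [leRHS]big_seq; apply: ler_sum => z zm.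
by case: ifPn => [Qz|_]; [rewrite ler_wpM2r// ?aA//; exact: Fp|rewrite mulr_ge0//; exact: Fp].
Qed.

Lemma avg_shell_le (F : G -> R) (Q : pred 'rV[int]_n) (a : 'rV[int]_n -> R) A :
  posdef F -> (forall z, 0 <= a z) -> 0 <= A ->
  (forall z, z \in box_seq m -> Q z -> a z <= A) ->
  avg (fun j => F j * \sum_(z <- box_seq m | Q z) a z * wave z (gp j)) <= A * F 0.
Proof.
move=> Fp a0 A0 aA; apply: le_trans (sum_shell_le 0 Fp a0 A0 aA).
rewrite (@eq_avg _ _ _ _ (fun j => \sum_(z <- box_seq m | Q z) a z * (F j * wave (z + 0) (gp j)))).
  by rewrite avg_sum; apply: ler_sum => z _; rewrite avgZ.
by move=> j; rewrite mulr_sumr; apply: eq_bigr => z _; rewrite addr0 mulrCA.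
Qed.

(** One factor of the square is expanded over [w]. Multiplying [F] by that wave replaces its
    coefficients by means of shifted ones, for which [sum_shell_le] still gives [A * F 0]; the
    weights [a w] remain. *)
Lemma avg_shell_sqr_le (F : G -> R) (Q : pred 'rV[int]_n) (a : 'rV[int]_n -> R) A :
  posdef F -> (forall z, 0 <= a z) -> 0 <= A ->
  (forall z, z \in box_seq m -> Q z -> a z <= A) ->
  avg (fun j => F j * (\sum_(z <- box_seq m | Q z) a z * wave z (gp j)) ^+ 2)
    <= A * (\sum_(z <- box_seq m | Q z) a z) * F 0.
Proof.
move=> Fp a0 A0 aA.
rewrite (@eq_avg _ _ _ _ (fun j => \sum_(w <- box_seq m | Q w) a w * (
   2^-1 * (\sum_(z <- box_seq m | Q z) a z * (F j * wave (z + w) (gp j)) +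
           \sum_(z <- box_seq m | Q z) a z * (F j * wave (z - w) (gp j)))))); last first.
  move=> j; set S := \sum_(z <- _ | _) _.
  rewrite (eq_bigr (fun w => F j * S * (a w * wave w (gp j)))); last first.
    move=> w _; rewrite -big_split/= [RHS]mulrCA; congr (_ * _).
    rewrite [F j * S]mulr_sumr mulr_suml mulr_sumr; apply: eq_bigr => z _.
    rewrite (_ : _ * wave w _ = a z * F j * (wave z (gp j) * wave w (gp j))).
      by rewrite waveM; ring.
    by ring.
  by rewrite -mulr_sumr -/S expr2 mulrA.
rewrite avg_sum -mulrA [_ * F 0]mulrC mulrA mulr_sumr; apply: ler_sum => w _.
rewrite avgZ mulrC ler_wpM2r// avgZ avgD !avg_sum.
have := sum_shell_le w Fp a0 A0 aA; have := sum_shell_le (- w) Fp a0 A0 aA.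
set S1 := \sum_(z <- _ | _) _; set S2 := \sum_(z <- _ | _) _ => S1A S2A.
rewrite (eq_bigr (fun z => a z * avg (fun j => F j * wave (z + w) (gp j)))); last by move=> z _; rewrite avgZ.
rewrite [X in _ + X](eq_bigr (fun z => a z * avg (fun j => F j * wave (z - w) (gp j)))); last by move=> z _; rewrite avgZ.
by rewrite -/S1 -/S2 mulrC ler_pdivrMr// mulr_natr mulr2n lerD.
Qed.

End fourier_inversion.
End box.

(** * Exponentials of kernels over dyadic shells *)

Section shells.
Context {R : realType} {n : nat}.

Lemma expRB_le (x y : R) : expR x - expR y <= (x - y) * expR x.
Proof.
have -> : y = x + (y - x) by ring.
rewrite expRD; have := expR_ge1Dx (y - x); have := expR_gt0 x; nra.
Qed.

Lemma expRB_norm_le (x y : R) :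
  `|expR x - expR y| <= `|x - y| * (expR x + expR y).
Proof.
have := expRB_le x y; have := expRB_le y x.
have := expR_gt0 x; have := expR_gt0 y; have := ler_norm (x - y).
have := ler_norm (y - x); rewrite distrC => u1 u2 ex ey h1 h2.
by rewrite ler_norml; apply/andP; split; nra.
Qed.

(** With radius 2^J - 1 the box of index 0 is empty, so its kernel vanishes and its exponential is
    1. *)
Definition dyadic_box J : pred 'rV[int]_n := fun z => (z != 0) && inbox (2 ^ J).-1 z.

Definition grid_kernel m (a : 'rV[int]_n -> R) (P : pred 'rV[int]_n)
    (j : {ffun 'I_n -> 'I_m.*2.+1}) : R :=
  \sum_(z <- box_seq m | P z) a z * wave z (gridpt j : 'rV[R]_n).
Arguments grid_kernel : clear implicits.

Lemma grid_kernel0 m a P : grid_kernel m a P 0 = \sum_(z <- box_seq m | P z) a z.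
Proof.
by rewrite /grid_kernel; apply: eq_bigr => z _; rewrite gridpt0 wave0r mulr1.
Qed.

Lemma size_box_seq m : size (@box_seq n m) = (m.*2.+1 ^ n)%N.
Proof. by rewrite size_map -cardE card_ffun !card_ord. Qed.

Lemma count_inbox_le m M : (count (@inbox n M) (box_seq m) <= M.*2.+1 ^ n)%N.
Proof.
rewrite -size_filter -size_box_seq; apply: uniq_leq_size; first by rewrite filter_uniq ?box_seq_uniq.
by move=> z; rewrite mem_filter !mem_box_seq => /andP[].
Qed.

Variables (b C : R).
Hypotheses (b0 : 0 <= b) (C0 : 0 <= C) (bn : 2 * b < n%:R).

(** s^2 = 2^(2b-n) is the decay rate of the shell terms; s itself is what is left once the absolute
    value of a shell is estimated by its square. *)
Let s : R := expR ((2 * b - n%:R) * ln 2 / 2).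

Let s_gt0 : 0 < s. Proof. exact: expR_gt0. Qed.

Let s_lt1 : s < 1.
Proof.
rewrite expR_lt1 pmulr_llt0 ?invr_gt0// pmulr_llt0; last by rewrite ln_gt0// ltr1n.
by rewrite subr_lt0.
Qed.

Let n0 : (0 < n)%N.
Proof. by rewrite -(ltr_nat R); apply: le_lt_trans bn; rewrite mulr_ge0. Qed.

Let s2n : s ^+ 2 * 2 ^+ n = expR (b * (2 * ln 2)).
Proof.
have -> : 2 ^+ n = expR (n%:R * ln 2) :> R by rewrite expRM_natl lnK ?posrE.
by rewrite -expRM_natl -expRD; congr expR; field.
Qed.

Section fixed_kernel.
Variables (m : nat) (a : 'rV[int]_n -> R).
Hypothesis a0 : forall z, 0 <= a z.
Hypothesis a_sum : forall J,
  \sum_(z <- box_seq m | dyadic_box J z) a z <= 2 * ln 2 * J%:R + C.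
Hypothesis a_max : forall J z, z \in box_seq m -> ~~ inbox (2 ^ J).-1 z ->
  a z <= C * 2 ^- n ^+ J.

Let F J j := expR (b * grid_kernel m a (dyadic_box J) j).

Let F_ge0 J j : 0 <= F J j. Proof. exact: expR_ge0. Qed.

Let F_pos J : posdef (F J). Proof. exact: posdef_expR. Qed.

(** The growth 2^(2bJ) is written as (s^2 2^n)^J so that the factor 2^(-nJ) of a shell leaves
    exactly s^(2J). *)
Let F0 J : F J 0 <= expR (b * C) * (s ^+ 2 * 2 ^+ n) ^+ J.
Proof.
rewrite /F grid_kernel0 s2n -expRM_natr -expRD ler_expR.
by apply: le_trans (ler_wpM2l b0 (a_sum J)) _; rewrite le_eqVlt; apply/orP; left; apply/eqP; ring.
Qed.

Let shell J z := dyadic_box J.+1 z && ~~ inbox (2 ^ J).-1 z.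
Let q J := grid_kernel m a (shell J).

Let pred2le J : ((2 ^ J).-1 <= (2 ^ J.+1).-1)%N.
Proof. by rewrite -!subn1 leq_sub2r// leq_pexp2l. Qed.

Let qE J j : grid_kernel m a (dyadic_box J.+1) j =
  grid_kernel m a (dyadic_box J) j + q J j.
Proof.
rewrite /grid_kernel (bigID (inbox (2 ^ J).-1))/=; congr (_ + _); apply: eq_bigl => z.
rewrite /dyadic_box -andbA; congr (_ && _); apply/andP/idP => [[]//|h].
by split=> //; apply: inboxW h.
Qed.

Let qB J j : grid_kernel m a (dyadic_box J.+1) j -
  grid_kernel m a (dyadic_box J) j = q J j.
Proof. by rewrite qE addrAC subrr add0r. Qed.

Let A J := C * 2 ^- n ^+ J.

Let A0 J : 0 <= A J. Proof. by rewrite mulr_ge0// exprn_ge0// invr_ge0 exprn_ge0. Qed.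

Let shellA J z : z \in box_seq m -> shell J z -> a z <= A J.
Proof. by move=> zm /andP[_]; exact: a_max. Qed.

(** A shell has at most (2 (2^(J+1) - 1) + 1)^n <= (4 * 2^J)^n frequencies, each of weight at most C
    2^(-nJ); its total weight is therefore bounded independently of J. *)
Let shell_sum J : \sum_(z <- box_seq m | shell J z) a z <= C * 4 ^+ n.
Proof.
apply: (@le_trans _ _ (\sum_(z <- box_seq m | shell J z) A J)).
  rewrite big_seq_cond [leRHS]big_seq_cond; apply: ler_sum => z /andP[zm zJ].
  exact: shellA.
rewrite big_const_seq iter_addr_0.
have h : (count (shell J) (box_seq m) <= (4 * 2 ^ J) ^ n)%N.
  apply: (@leq_trans (count (@inbox n (2 ^ J.+1).-1) (box_seq m))).
    by apply: sub_count => z /andP[/andP[]].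
  apply: leq_trans (count_inbox_le m (2 ^ J.+1).-1) _; rewrite leq_exp2r //.
  by rewrite expnS; have := expn_gt0 2 J; lia.
apply: (@le_trans _ _ (A J *+ (4 * 2 ^ J) ^ n)); first by apply: ler_wpMn2l.
rewrite -mulr_natr /A natrX natrM natrX exprMn -!exprM mulnC le_eqVlt; apply/orP; left; apply/eqP.
by rewrite exprVn -exprM; field; rewrite expf_neq0.
Qed.

(** [c1] bounds A_J F_{J+1} (0) / s^(2J). [c2] bounds the mean of every F_J: it is 1 plus the
    geometric series of the increments b c1 s^(2J). [c3] collects the two contributions to the L^1
    norm of an increment. *)
Let c1 := C * expR (b * C) * (s ^+ 2 * 2 ^+ n).
Let c2 := 1 + b * c1 / (1 - s ^+ 2).
Let c3 := b * (c2 + C * 4 ^+ n * c1).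

Let s2_lt1 : s ^+ 2 < 1. Proof. by rewrite exprn_ilt1// ltW. Qed.

Let c1_ge0 : 0 <= c1.
Proof. by rewrite !mulr_ge0// ?expR_ge0// exprn_ge0// ltW. Qed.

Let AF J : A J * F J.+1 0 <= c1 * (s ^+ 2) ^+ J.
Proof.
apply: le_trans (ler_wpM2l (A0 J) (F0 J.+1)) _.
rewrite le_eqVlt; apply/orP; left; apply/eqP; rewrite /A /c1 exprS [in LHS]exprMn exprVn.
have : (2 ^+ n) ^+ J != 0 :> R by rewrite !expf_neq0.
by move: (s ^+ 2) (2 ^+ n : R) (expR _) => ? ? ? ?; field.
Qed.

Let FS J : F J 0 <= F J.+1 0.
Proof.
rewrite ler_expR ler_wpM2l// !grid_kernel0 big_mkcond [leRHS]big_mkcond/=.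
apply: ler_sum => z _; rewrite /dyadic_box; case: (z != 0) => //=.
case: ifPn => [h|_]; last by case: ifP.
by rewrite (inboxW (pred2le J) h).
Qed.

Let AF' J : A J * F J 0 <= c1 * (s ^+ 2) ^+ J.
Proof. exact: le_trans (ler_wpM2l (A0 J) (FS J)) (AF J). Qed.

(** Convexity in the form [expRB_le] gives a bound linear in the shell, without absolute values;
    against F_{J+1} its average is a sum of nonnegative coefficients, to which [avg_shell_le]
    applies. *)
Let E_S J : avg (F J.+1) <= avg (F J) + b * c1 * (s ^+ 2) ^+ J.
Proof.
rewrite -mulrA; apply: le_trans (lerD (lexx _) (ler_wpM2l b0 (AF J))).
apply: le_trans (lerD (lexx _) (ler_wpM2l b0
  (avg_shell_le (@F_pos J.+1) a0 (A0 J) (@shellA J)))).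
rewrite -avgZ -avgD; apply: ler_avg => j /=.
rewrite -lerBlDl; apply: le_trans (expRB_le _ _) _.
by rewrite -mulrBr qB -/(F J.+1 j) -mulrA [q J j * _]mulrC.
Qed.

Let E_le J : avg (F J) <= c2.
Proof.
have s20 : 0 < 1 - s ^+ 2 by rewrite subr_gt0.
suff : avg (F J) <= 1 + b * c1 * (1 - (s ^+ 2) ^+ J) / (1 - s ^+ 2).
  move/le_trans; apply; rewrite lerD2l ler_wpM2r ?invr_ge0 ?(ltW s20)//.
  by apply: ler_piMr; [exact: mulr_ge0|rewrite gerBl !exprn_ge0// ltW].
elim: J => [|J ih].
  rewrite expr0 subrr mulr0 mul0r addr0 -[leRHS](@avg_cst R n m.*2 1); apply: ler_avg => j.
  rewrite /F /grid_kernel big1 ?mulr0 ?expR0// => z /andP[z0 /forallP zz].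
  case/negP : z0; apply/eqP/rowP => k; have := zz k.
  by rewrite expn0 leqn0 absz_eq0 mxE => /eqP.
apply: le_trans (E_S J) _; apply: le_trans (lerD ih (lexx _)) _.
rewrite le_eqVlt; apply/orP; left; apply/eqP.
by rewrite [_ ^+ J.+1]exprS; move: (lt0r_neq0 s20); move: (s ^+ 2) => ? ?; field.
Qed.

(** Weighted arithmetic-geometric mean: |q| <= (s^J + s^(-J) q^2) / 2. The first term is paid by the
    bounded mean of F, the second by [avg_shell_sqr_le], which gives s^(2J); the weight balances
    both at s^J. *)
Let D_S J : avg (fun j => `|F J.+1 j - F J j|) <= c3 * s ^+ J.
Proof.
have sJ : 0 < s ^+ J by rewrite exprn_gt0.
(* The difference of exponentials is bounded by |q| times the sum of both of them, so the same shell
   is needed against F_J and F_{J+1}. *)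
have qF J' : (forall j, 0 <= F J' j) -> avg (F J') <= c2 ->
    A J * F J' 0 <= c1 * (s ^+ 2) ^+ J -> posdef (F J') ->
    avg (fun j => `|q J j| * F J' j) <= (c2 + C * 4 ^+ n * c1) / 2 * s ^+ J.
  move=> FJ'0 E' AF'' pF.
  apply: (@le_trans _ _ (avg (fun j => s ^+ J / 2 * F J' j + (s ^+ J)^-1 / 2 * (F J' j * q J j ^+ 2)))).
    apply: ler_avg => j; rewrite [_ * (F J' j * _)]mulrCA [_ * F J' j]mulrC -mulrDr mulrC ler_wpM2l//.
    rewrite -[q J j ^+ 2]real_normK ?num_real// -(@ler_pM2l _ (2 * s ^+ J)) ?mulr_gt0//.
    have -> : 2 * s ^+ J * (s ^+ J / 2 + (s ^+ J)^-1 / 2 * `|q J j| ^+ 2) = (s ^+ J) ^+ 2 + `|q J j| ^+ 2.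
      by field; rewrite gt_eqF.
    by have := sqr_ge0 (s ^+ J - `|q J j|); nra.
  rewrite avgD !avgZ.
  have h := avg_shell_sqr_le pF a0 (A0 J) (@shellA J).
  have h2 : avg (fun j => F J' j * q J j ^+ 2) <= C * 4 ^+ n * c1 * (s ^+ 2) ^+ J.
    apply: le_trans h _; rewrite mulrAC mulrC -mulrA; apply: ler_pM => //.
    - by apply: sumr_ge0 => z _; exact: a0.
    - by rewrite mulr_ge0.
  have h3 := ler_wpM2l (ltW (divr_gt0 sJ (ltr0Sn _ 1))) E'.
  have := lerD h3 (ler_wpM2l _ h2); move/(_ ((s ^+ J)^-1 / 2)).
  move=> h4; apply: le_trans (h4 _) _; first by rewrite divr_ge0// invr_ge0 ltW.
  rewrite le_eqVlt; apply/orP; left; apply/eqP.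
  rewrite exprAC; move: (lt0r_neq0 sJ); move: (s ^+ J) => ? ?; field => //.
apply: (@le_trans _ _ (avg (fun j => b * (`|q J j| * F J.+1 j + `|q J j| * F J j)))).
  apply: ler_avg => j; apply: le_trans (expRB_norm_le _ _) _.
  by rewrite -mulrBr qB normrM (ger0_norm b0) -mulrA ler_wpM2l// mulrDr.
rewrite avgZ avgD /c3 -mulrA ler_wpM2l//.
have := lerD (qF J.+1 (F_ge0 J.+1) (E_le J.+1) (AF J) (@F_pos J.+1))
   (qF J (F_ge0 J) (E_le J) (AF' J) (@F_pos J)).
by move/le_trans; apply; rewrite -mulrDl -splitr.
Qed.

Let c3_ge0 : 0 <= c3.
Proof.
rewrite mulr_ge0// addr_ge0//; last by apply: mulr_ge0 => //; rewrite mulr_ge0// exprn_ge0.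
by rewrite /c2; apply: addr_ge0 => //; apply: divr_ge0; [exact: mulr_ge0|rewrite subr_ge0 ltW].
Qed.

Lemma avg_expR_kernel_le J :
  avg (fun j => `|expR (b * grid_kernel m a (fun z => z != 0) j) - F J j|)
    <= c3 / (1 - s) * s ^+ J.
Proof.
have s10 : 0 < 1 - s by rewrite subr_gt0.
have D d : avg (fun j => `|F (J + d) j - F J j|) <= c3 * s ^+ J * ((1 - s ^+ d) / (1 - s)).
  elim: d => [|d ih].
    rewrite addn0 expr0 subrr mul0r mulr0 -[leRHS](@avg_cst R n m.*2 0).
    by apply: ler_avg => j; rewrite subrr normr0.
  apply: (@le_trans _ _ (avg (fun j => `|F (J + d).+1 j - F (J + d) j| + `|F (J + d) j - F J j|))).
    by apply: ler_avg => j; rewrite addnS; apply: le_trans (ler_normD _ _); rewrite addrA subrK.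
  rewrite avgD; apply: le_trans (lerD (D_S _) ih) _.
  rewrite le_eqVlt; apply/orP; left; apply/eqP.
  by rewrite exprD exprS; move: (lt0r_neq0 s10) => ?; field.
(* Since m < 2^(J+m), the box of index J + m contains all frequencies of the grid: the telescoping
   is finite and leaves no tail. *)
have -> : avg (fun j => `|expR (b * grid_kernel m a (fun z => z != 0) j) - F J j|) =
          avg (fun j => `|F (J + m)%N j - F J j|).
  apply: eq_avg => j; congr (`|expR (b * _) - _|).
  rewrite /grid_kernel big_seq_cond [RHS]big_seq_cond; apply: eq_bigl => z.
  rewrite mem_box_seq; case zm : (inbox m z) => //=.
  rewrite /dyadic_box (inboxW _ zm) ?andbT// -ltnS prednK ?expn_gt0//.
  by rewrite (leq_trans (ltn_expl m (ltnSn 1)))// leq_pexp2l// leq_addl.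
apply: le_trans (D m) _.
rewrite [leRHS]mulrAC; apply: ler_wpM2l; first by rewrite mulr_ge0// exprn_ge0// ltW.
by rewrite ler_piMl ?invr_ge0 ?(ltW s10)// gerBl exprn_ge0// ltW.
Qed.

End fixed_kernel.
End shells.

(* The increment of [exp (b K_J)] at shell J is of order [2^-(nJ) * 2^(2bJ)], which
   is summable when [2 b < n]. *)
Lemma avg_expR_kernel_tail (R : realType) (n : nat) (b C : R) :
  0 <= b -> 0 <= C -> 2 * b < n%:R ->
  exists K s : R, [/\ 0 <= K, 0 < s < 1 &
    forall m (a : 'rV[int]_n -> R), (forall z, 0 <= a z) ->
    (forall J, \sum_(z <- box_seq m | dyadic_box J z) a z <= 2 * ln 2 * J%:R + C) ->
    (forall J z, z \in box_seq m -> ~~ inbox (2 ^ J).-1 z -> a z <= C * 2 ^- n ^+ J) ->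
    forall J, avg (fun j => `|expR (b * @grid_kernel R n m a (fun z => z != 0) j)
                  - expR (b * grid_kernel a (dyadic_box J) j)|) <= K * s ^+ J].
Proof.
move=> b0 C0 bn; set s : R := expR ((2 * b - n%:R) * ln 2 / 2).
have s1 : 0 < s < 1.
  rewrite expR_gt0 expR_lt1 pmulr_llt0 ?invr_gt0// pmulr_llt0; last by rewrite ln_gt0// ltr1n.
  by rewrite subr_lt0.
(* The constant is found by unification with [avg_expR_kernel_le]; its sign is checked afterwards on
   the unfolded expression. *)
eexists; exists s; split; [|exact: s1|]; last first.
  by move=> m a a0 h1 h2 J; exact: (avg_expR_kernel_le b0 C0 bn a0 h1 h2 J).
case/andP: s1 => s0 s1.
rewrite divr_ge0 ?subr_ge0 ?(ltW s1)// mulr_ge0// addr_ge0//.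
  rewrite addr_ge0// divr_ge0 ?subr_ge0 ?(ltW s1)// ?exprn_ile1 ?(ltW s0) ?(ltW s1)//.
  by rewrite !mulr_ge0// ?expR_ge0// exprn_ge0// ltW.
by rewrite !mulr_ge0// ?expR_ge0// ?exprn_ge0// ltW.
Qed.

(** * Lattice sums of eigenvalues *)

Section dilation.
Context {R : realType}.
Local Notation mu := (@lebesgue_measure R).
Implicit Types (c : R) (f : R -> \bar R).

Definition dilation c : measurableTypeR R -> measurableTypeR R := fun x => c * x.

Lemma measurable_dilation c : measurable_fun setT (dilation c).
Proof. exact: mulrl_measurable. Qed.

HB.instance Definition _ c :=
  isMeasurableFun.Build _ _ _ _ (dilation c) (@measurable_dilation c).

Let pushforward_dilation c : {measure set (measurableTypeR R) -> \bar R} :=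
  measure_function_pushforward__canonical__measure_function_Measure mu (measurable_dilation c).

(** Both measures agree on the intervals ]a, b], which determine Lebesgue measure. *)
Let lebesgue_dilation c (c0 : 0 < c) (A : set (measurableTypeR R)) : measurable A ->
  mscale (NngNum (ltW c0)) (pushforward_dilation c) A = mu A.
Proof.
move=> mA; apply/esym/lebesgue_measure_unique => //= _ [[a b]] _ <-.
rewrite /mscale /= /pushforward (_ : dilation c @^-1` _ = `]a / c, b / c]%classic); last first.
  by apply/seteqP; split => x /=; rewrite !in_itv/= /dilation ltr_pdivrMr// ler_pdivlMr// mulrC.
rewrite !lebesgue_measure_itv/= !lte_fin ltr_pM2r ?invr_gt0//; case: ifPn => _.
  by rewrite -!EFinB -EFinM -mulrBl mulrCA divff ?mulr1 ?gt_eqF.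
by rewrite mule0.
Qed.

Lemma integral_dilation c f : 0 < c -> measurable_fun [set: R] f ->
  (forall x, 0 <= f x)%E ->
  (\int[mu]_x f (c * x)%R = c^-1%:E * \int[mu]_x f x)%E.
Proof.
move=> c0 mf f0.
have -> : (\int[mu]_x f x = \int[mscale (NngNum (ltW c0)) (pushforward_dilation c)]_x f x)%E.
  by apply: eq_measure_integral => A mA _; exact/esym/lebesgue_dilation.
rewrite ge0_integral_mscale//= muleA -EFinM mulVf ?gt_eqF// mul1e.
by rewrite (@ge0_integral_pushforward _ _ _ _ _ _ (measurable_dilation c))//= preimage_setT.
Qed.

Lemma integral_dilation_gt0 c f : 0 < c -> measurable_fun [set: R] f ->
  (forall x, 0 <= f x)%E ->
  (\int[mu]_(x in `]0%R, +oo[) f (c * x)%R = c^-1%:E * \int[mu]_(x in `]0%R, +oo[) f x)%E.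
Proof.
move=> c0 mf f0; rewrite integral_mkcond [in RHS]integral_mkcond.
rewrite -(integral_dilation c0).
- apply: eq_integral => x _; rewrite !patchE; congr (if _ then _ else _).
  by apply/idP/idP; rewrite !inE/= !in_itv/= !andbT pmulr_rgt0.
- by apply/(measurable_restrictT _ _).1 => //; exact: measurable_funS mf.
- by move=> x; rewrite patchE; case: ifP.
Qed.

End dilation.

(** * The integral representation of lambda^(-n/2) *)

Section gamma_integral.
Context {R : realType}.
Local Notation mu := (@lebesgue_measure R).

(** For lam > 0 this is Gamma (n/2) * lam^(-n/2). Extended values allow sums and substitutions
    before finiteness is established. *)
Definition gamma_int (n : nat) (lam : R) : \bar R :=
  (\int[mu]_(t in `]0%R, +oo[) (t `^ (n%:R / 2 - 1) * expR (- (lam * t)))%:E)%E.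

Lemma measurable_gamma_fun (h lam : R) : measurable_fun [set: R]
  (fun t : R => (t `^ h * expR (- (lam * t)))%:E).
Proof.
apply/measurable_EFinP/measurable_funM; first exact: measurable_powR.
by apply: measurableT_comp => //; apply: measurableT_comp => //; exact: mulrl_measurable.
Qed.

Lemma powR_halfn (n : nat) (t : R) : 0 < t -> t `^ (n%:R / 2) = Num.sqrt t ^+ n.
Proof.
by move=> t0; rewrite mulrC powRrM powR12_sqrt ?ltW// powR_mulrn// sqrtr_ge0.
Qed.

Lemma powR_halfn1 (n : nat) (t : R) : 0 < t ->
  t `^ (n%:R / 2 - 1) = Num.sqrt t ^+ n / t.
Proof.
move=> t0; rewrite powRB; last by rewrite (gt_eqF t0) implybT.
by rewrite powR_halfn// powRr1// ltW.
Qed.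

Lemma powRN_halfn (n : nat) (t : R) : 0 < t ->
  t `^ (- (n%:R / 2)) = Num.sqrt t ^- n.
Proof. by move=> t0; rewrite powRN powR_halfn. Qed.

Lemma gamma_intE n lam : 0 < lam ->
  (gamma_int n lam = (Num.sqrt lam ^- n)%:E * gamma_int n 1)%E.
Proof.
move=> l0; rewrite /gamma_int.
transitivity (\int[mu]_(t in `]0%R, +oo[)
    ((Num.sqrt lam ^- n * lam)%:E * ((lam * t) `^ (n%:R / 2 - 1) * expR (- (1 * (lam * t))))%:E))%E.
  apply: eq_integral => t; rewrite inE/= in_itv/= andbT => t0.
  rewrite -EFinM mul1r !powR_halfn1 ?mulr_gt0// sqrtrM ?ltW// exprMn; congr EFin.
  have := gt_eqF l0; have := gt_eqF t0.
  have : Num.sqrt lam ^+ n != 0 by rewrite expf_neq0// gt_eqF// sqrtr_gt0.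
  by move: (expR _) (_ ^+ n) (_ ^+ n) => ? ? ? ? /negbT ? /negbT ?; field; rewrite ?andbT; do ?[apply/andP; split].
rewrite ge0_integralZl//=.
- rewrite (@integral_dilation_gt0 R lam (fun t => (t `^ (n%:R / 2 - 1) * expR (- (1 * t)))%:E))//.
  + by rewrite muleA -EFinM mulfK ?gt_eqF.
  + exact: measurable_gamma_fun.
  + by move=> x; rewrite lee_fin mulr_ge0// ?powR_ge0 ?expR_ge0.
- apply: measurable_funTS.
  by apply: (@measurableT_comp _ _ _ _ _ _ (fun t => (t `^ (n%:R / 2 - 1) * expR (- (1 * t)))%:E)); [exact: measurable_gamma_fun|exact: mulrl_measurable].
- by move=> t _; rewrite lee_fin mulr_ge0// ?powR_ge0 ?expR_ge0.
- by rewrite lee_fin mulr_ge0 ?(ltW l0)// invr_ge0 exprn_ge0// sqrtr_ge0.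
Qed.

Lemma integral_inv (e : R) : 0 < e < 1 ->
  (\int[mu]_(x in `[e, 1%R]) (x `^ (-1))%:E = (- ln e)%:E)%E.
Proof.
move=> /andP[e0 e1].
rewrite (@eq_integral _ _ _ mu `[e, 1%R]%classic (fun x => (x^-1)%:E)); last first.
  move=> x; rewrite inE/= in_itv/= => /andP[ex _].
  by rewrite powR_inv1// ltW// (lt_le_trans e0).
rewrite (@continuous_FTC2 _ _ (@ln R))//.
- by rewrite ln1 -EFinB sub0r.
- apply: continuous_in_subspaceT => x; rewrite inE/= in_itv/= => /andP[ex _].
  by apply: inv_continuous; rewrite gt_eqF// (lt_le_trans e0).
- split.
  + move=> x; rewrite in_itv/= => /andP[ex _].
    by have [] := is_derive1_ln (lt_trans e0 ex).
  + by apply: cvg_at_right_filter; exact: continuous_ln.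
  + by apply: cvg_at_left_filter; exact: continuous_ln.
- move=> x; rewrite in_itv/= => /andP[ex _]; rewrite derive1E.
  by have [] := is_derive1_ln (lt_trans e0 ex).
Qed.

Lemma integral_invsqrt (e : R) : 0 < e < 1 ->
  (\int[mu]_(x in `[e, 1%R]) (x `^ (- 2^-1))%:E <= 2%:E)%E.
Proof.
move=> /andP[e0 e1].
rewrite (@eq_integral _ _ _ mu `[e, 1%R]%classic (fun x => ((Num.sqrt x)^-1)%:E)); last first.
  move=> x; rewrite inE/= in_itv/= => /andP[ex _].
  by rewrite powRN powR12_sqrt// ltW// (lt_le_trans e0).
have d (x : R) : 0 < x -> is_derive x 1 (fun y : R => 2 * Num.sqrt y) (Num.sqrt x)^-1.
  move=> x0; have h := is_derive1_sqrt x0; apply: is_derive_eq.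
  by rewrite -[_ *: _]/(2 * _) invfM mulVKf.
rewrite (@continuous_FTC2 _ _ (fun x => 2 * Num.sqrt x))//.
- by rewrite sqrtr1 mulr1 -EFinB lee_fin gerBl mulr_ge0 ?sqrtr_ge0.
- apply: continuous_in_subspaceT => x; rewrite inE/= in_itv/= => /andP[ex _].
  apply: continuousV; first by rewrite gt_eqF// sqrtr_gt0 (lt_le_trans e0).
  exact: sqrt_continuous.
- split.
  + move=> x; rewrite in_itv/= => /andP[ex _].
    by have [] := d _ (lt_trans e0 ex).
  + by apply: cvg_at_right_filter; apply: cvgM; [exact: cvg_cst|exact: sqrt_continuous].
  + by apply: cvg_at_left_filter; apply: cvgM; [exact: cvg_cst|exact: sqrt_continuous].
- move=> x; rewrite in_itv/= => /andP[ex _]; rewrite derive1E.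
  by have [] := d _ (lt_trans e0 ex).
Qed.

(** Monotone convergence along [1/(i+2), 1]; starting at 1/2 keeps the left end strictly below 1. *)
Lemma integral_invsqrt0 :
  (\int[mu]_(x in `]0%R, 1%R]) (x `^ (- 2^-1))%:E <= 2%:E)%E.
Proof.
pose F (i : nat) : set R := `[i.+2%:R^-1, 1]%classic.
have m : measurable_fun [set: R] (fun x : R => (x `^ (- 2^-1))%:E).
  by apply/measurable_EFinP; exact: measurable_powR.
have -> : `]0%R, 1%R]%classic = \bigcup_i F i.
  apply/seteqP; split => [x|x [i _]]; rewrite /F /= !in_itv/=; last first.
    by move=> /andP[ix ->]; rewrite andbT (lt_le_trans _ ix)// invr_gt0.
  move=> /andP[x0 x1]; have [|k] := @ltr_add_invr R 0 x; first by [].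
  rewrite add0r => kx; exists k => //=; rewrite in_itv/= x1 andbT (le_trans _ (ltW kx))//.
  by rewrite lef_pV2 ?posrE// ler_nat.
have F0 i x : F i x -> (0 <= (x `^ (- 2^-1))%:E)%E by rewrite lee_fin powR_ge0.
have cv : (\int[mu]_(x in F i) (x `^ (- 2^-1))%:E)%E @[i --> \oo] -->
    (\int[mu]_(x in \bigcup_i F i) (x `^ (- 2^-1))%:E)%E.
  apply: ge0_nondecreasing_set_cvg_integral => //.
  - move=> i j ij; apply/subsetPset => x; rewrite /F /= !in_itv/= => /andP[ix ->].
    by rewrite andbT (le_trans _ ix)// lef_pV2 ?posrE// ler_nat ltnS.
  - by move=> i; exact: measurable_itv.
  - by move=> i; exact: measurable_funTS.
rewrite -(cvg_lim _ cv)//; apply: lime_le; first by apply/cvg_ex; eexists; exact: cv.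
apply: nearW => i; apply: integral_invsqrt.
by rewrite invr_gt0 ltr0n/= invf_lt1 ?ltr1n.
Qed.

Let gamma_fun_ge0 (h lam t : R) : (0 <= (t `^ h * expR (- (lam * t)))%:E)%E.
Proof. by rewrite lee_fin mulr_ge0 ?powR_ge0 ?expR_ge0. Qed.

Lemma gamma_int_ge0 n lam : (0 <= gamma_int n lam)%E.
Proof. by apply: integral_ge0 => t _; exact: gamma_fun_ge0. Qed.

(** Up to 1 the integrand is at most t^(-1/2), because n >= 1. Beyond 1, t^n <= n! 2^n exp (t/2)
    leaves a multiple of the exponential density of rate 1/2. *)
Lemma gamma_int_fin_num n : (0 < n)%N -> gamma_int n 1 \is a fin_num.
Proof.
move=> n0; rewrite ge0_fin_numE ?gamma_int_ge0// /gamma_int.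
have -> : `]0%R, +oo[%classic = `]0%R, 1%R] `|` `]1%R, +oo[ :> set R.
  by rewrite (@itv_bndbnd_setU _ R (BRight 0) (BRight 1) +oo%O)// bnd_simp.
have mg D : measurable_fun D (fun t : R => (t `^ (n%:R / 2 - 1) * expR (- (1 * t)))%:E).
  by apply: measurable_funTS; exact: measurable_gamma_fun.
rewrite ge0_integral_setU//=; last 2 first.
  exact: mg.
  rewrite disj_set2E; apply/eqP/seteqP; split => // x [] /=.
  by rewrite !in_itv/= andbT => /andP[_ /le_lt_trans h] /h; rewrite ltxx.
apply: lte_add_pinfty.
  apply: le_lt_trans (_ : 2%:E < +oo)%E; last exact: ltry.
  apply: le_trans integral_invsqrt0; apply: ge0_le_integral => //.
    exact: mg.
    by apply: measurable_funTS; apply/measurable_EFinP; exact: measurable_powR.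
  move=> t /=; rewrite in_itv/= => /andP[t0 t1]; rewrite lee_fin powR_halfn1//.
  rewrite powRN powR12_sqrt ?(ltW t0)//.
  rewrite mul1r (@le_trans _ _ (Num.sqrt t ^+ n / t))//.
    by rewrite ler_piMr ?divr_ge0 ?exprn_ge0 ?sqrtr_ge0 ?(ltW t0)// expR_le1 oppr_le0 ltW.
  have s0 : 0 < Num.sqrt t by rewrite sqrtr_gt0.
  have s1 : Num.sqrt t <= 1 by rewrite -sqrtr1 ler_wsqrtr.
  rewrite -{2}(sqr_sqrtr (ltW t0)) -[leRHS]mul1r.
  rewrite ler_pdivrMr ?exprn_gt0// mul1r expr2 mulrA mulVf ?gt_eqF// mul1r.
  case: n n0 {mg} => // k _; rewrite exprS ler_piMr ?(ltW s0)//.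
  by rewrite exprn_ile1// ltW.
(* The last factor 2 undoes the rate 1/2 in front of the exponential density. *)
pose C : R := n`!%:R * 2 ^+ n * 2.
apply: le_lt_trans (_ : C%:E < +oo)%E; last exact: ltry.
rewrite -[C%:E]mule1 -(@integral_exponential_pdf R 2^-1)// -ge0_integralZl//=; last 3 first.
- by apply/measurable_EFinP; exact: measurable_exponential_pdf.
- by move=> x _; rewrite lee_fin exponential_pdf_ge0.
- by rewrite lee_fin !mulr_ge0// exprn_ge0.
have mC D : measurable_fun D (fun x => C%:E * (exponential_pdf 2^-1 x)%:E)%E.
  apply: measurable_funTS; apply/measurable_EFinP/measurable_funM => //.
  exact: measurable_exponential_pdf.
have C0 x : (0 <= C%:E * (exponential_pdf 2^-1 x)%:E)%E.
  by rewrite -EFinM lee_fin mulr_ge0 ?exponential_pdf_ge0// !mulr_ge0// exprn_ge0.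
apply: (@le_trans _ _ (\int[mu]_(x in `]1%R, +oo[) (C%:E * (exponential_pdf 2^-1 x)%:E))%E); last first.
  by apply: ge0_subset_integral => //; exact: mC.
apply: ge0_le_integral => //; [exact: mg|exact: mC|move=> t; rewrite /= in_itv/= andbT => t1].
have t0 : 0 < t by exact: lt_trans t1.
rewrite exponential_pdfE ?(ltW t0)// -EFinM lee_fin powR_halfn1// mul1r.
have -> : C * (2^-1 * expR (- 2^-1 * t)) = n`!%:R * 2 ^+ n * expR (- 2^-1 * t) by rewrite /C; field.
have -> : expR (- t) = expR (- 2^-1 * t) * expR (- 2^-1 * t).
  by rewrite -expRD; congr expR; field.
rewrite mulrA ler_wpM2r ?expR_ge0//.
rewrite mulNr expRN -ler_pdivlMr ?invr_gt0 ?expR_gt0// invrK.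
apply: (@le_trans _ _ (t ^+ n)).
  rewrite ler_pdivrMr// (@le_trans _ _ (t ^+ n))// ?ler_peMr ?exprn_ge0 ?(ltW t0) ?(ltW t1)//.
  apply: lerXn2r; rewrite ?nnegrE ?sqrtr_ge0 ?(ltW t0)//.
  by rewrite -{2}(sqr_sqrtr (ltW t0)) expr2 ler_peMl ?sqrtr_ge0// -sqrtr1 ler_wsqrtr// ltW.
case: n n0 {mg C mC C0} => // k _.
have := @expR_ge1Dxn R (2^-1 * t) k; rewrite mulr_ge0 ?(ltW t0)// => /(_ isT) h.
rewrite -mulrA mulrC -ler_pdivrMr ?ltr0n ?fact_gt0//.
rewrite [leRHS]mulrC -ler_pdivrMr ?exprn_gt0//; apply: le_trans h.
rewrite exprMn exprVn ler_wpDl// le_eqVlt; apply/orP; left; apply/eqP.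
by ring.
Qed.

Lemma gamma_int_gt0 n : (0 < gamma_int n 1)%E.
Proof.
apply: (@lt_le_trans _ _ (\int[mu]_(t in `[1%R, 2%R]) (expR (- 2) / 2)%:E)%E).
  rewrite integral_cst//= lebesgue_measure_itv/= lte_fin ltr1n/= -EFinB -EFinM lte_fin.
  by rewrite mulr_gt0 ?divr_gt0 ?expR_gt0// subr_gt0 ltr1n.
apply: (@le_trans _ _ (\int[mu]_(t in `[1%R, 2%R]) (t `^ (n%:R / 2 - 1) * expR (- (1 * t)))%:E)%E).
  apply: ge0_le_integral => //.
  - by apply: measurable_funTS; exact: measurable_gamma_fun.
  - move=> t; rewrite /= in_itv/= => /andP[t1 t2]; rewrite lee_fin mul1r powR_halfn1 ?(lt_le_trans _ t1)//.
    rewrite mulrC; apply: ler_pM; rewrite ?invr_ge0 ?expR_ge0//; last by rewrite ler_expR lerN2.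
    have t0 : 0 < t by exact: lt_le_trans t1.
    apply: (@le_trans _ _ (t^-1)); first by rewrite lef_pV2 ?posrE.
    by rewrite ler_peMl ?invr_ge0 ?(ltW t0)// exprn_ege1// -sqrtr1 ler_wsqrtr.
apply: ge0_subset_integral => //.
- by apply: measurable_funTS; exact: measurable_gamma_fun.
- by move=> x; rewrite /= !in_itv/= andbT => /andP[/(lt_le_trans _) h _]; apply: h.
Qed.

(** [Euler_Gamma] is a real-valued integral, so finiteness must exclude the default value 0 that it
    would take at infinity. *)
Lemma gamma_int_Euler n : (0 < n)%N -> gamma_int n 1 = (Euler_Gamma (n%:R / 2 : R))%:E.
Proof.
move=> n0; have := gamma_int_fin_num n0; rewrite /gamma_int /Euler_Gamma /Rintegral => h.
rewrite -[LHS]fineK//; congr (EFin (fine _)); apply: eq_integral => t _.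
by rewrite mul1r.
Qed.

Lemma Euler_Gamma_gt0 n : (0 < n)%N -> 0 < Euler_Gamma (n%:R / 2 : R).
Proof. by move=> n0; rewrite -lte_fin -gamma_int_Euler// gamma_int_gt0. Qed.

Lemma lqg_const_gt0 n : (0 < n)%N -> 0 < lqg_const R n.
Proof.
move=> n0; rewrite /lqg_const divr_gt0// mulr_gt0 ?Euler_Gamma_gt0// powR_gt0//.
by rewrite mulr_gt0 ?pi_gt0.
Qed.

End gamma_integral.

(** * Theta sums *)

Section theta.
Context {R : realType}.
Local Notation mu := (@lebesgue_measure R).

Lemma sum_sym_ord (G : int -> R) M : (forall k, G (- k) = G k) ->
  \sum_(i < M.*2.+1) G (i%:Z - M%:Z) = G 0 + 2 * \sum_(k < M) G k.+1%:Z.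
Proof.
move=> GN; elim: M => [|M ih]; first by rewrite big_ord1 big_ord0 subrr mulr0 addr0.
rewrite doubleS big_ord_recl big_ord_recr/= sub0r GN.
have -> : (bump 0 M.*2.+1)%:Z - M.+1%:Z = M.+1%:Z by rewrite /bump; lia.
rewrite (eq_bigr (fun i : 'I_M.*2.+1 => G (i%:Z - M%:Z))); last first.
  by move=> i _; congr G; rewrite /bump; lia.
by rewrite ih big_ord_recr/=; ring.
Qed.

(** Comparison with the integral of a decreasing function, then a dilation by sqrt c and the
    Gaussian integral over the half-line. *)
Lemma sum_gauss_le (c : R) M : 0 < c ->
  \sum_(k < M) expR (- (c * k.+1%:R ^+ 2)) <= Num.sqrt pi / (2 * Num.sqrt c).
Proof.
move=> c0; pose g x := (expR (- (c * x ^+ 2)))%:E.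
have mg D : measurable_fun D g.
  apply: measurable_funTS; apply/measurable_EFinP; apply: measurableT_comp => //.
  apply: measurableT_comp => //; apply: measurable_funM => //; exact: measurable_funX.
have g0 x : (0 <= g x)%E by rewrite lee_fin expR_ge0.
suff h : ((\sum_(k < M) expR (- (c * k.+1%:R ^+ 2)))%:E <= \int[mu]_(x in `]0%R, M%:R]) g x)%E.
  rewrite -lee_fin (le_trans h)//.
  apply: le_trans (_ : \int[mu]_(x in `]0%R, +oo[) g x <= _)%E.
    apply: ge0_subset_integral => //; first exact: mg.
    by move=> x /=; rewrite !in_itv/= andbT => /andP[].
  have sc : 0 < Num.sqrt c by rewrite sqrtr_gt0.
  rewrite (_ : g = (fun x => (gauss_fun (Num.sqrt c * x))%:E)); last first.
    by apply/funext => x; rewrite /g /gauss_fun exprMn sqr_sqrtr ?ltW.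
  rewrite (@integral_dilation_gt0 R (Num.sqrt c) (fun x => (gauss_fun x)%:E))//.
  - apply: (@le_trans _ _ ((Num.sqrt c)^-1%:E * \int[mu]_(x in `[0%R, +oo[) (gauss_fun x)%:E)%E).
      apply: lee_pmul; rewrite ?lee_fin ?invr_ge0 ?sqrtr_ge0//.
        by apply: integral_ge0 => x _; rewrite lee_fin gauss_fun_ge0.
      apply: ge0_subset_integral => //.
      + by apply: measurable_funTS; apply/measurable_EFinP; exact: measurable_gauss_fun.
      + by move=> x _; rewrite lee_fin gauss_fun_ge0.
      + by move=> x /=; rewrite !in_itv/= !andbT => /ltW.
    rewrite integral0y_gauss -EFinM lee_fin le_eqVlt; apply/orP; left; apply/eqP.
    by field; rewrite gt_eqF.
  - by apply/measurable_EFinP; exact: measurable_gauss_fun.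
  - by move=> x; rewrite lee_fin gauss_fun_ge0.
elim: M => [|M ih]; first by rewrite big_ord0; apply: integral_ge0.
rewrite (@itv_bndbnd_setU _ R (BRight 0) (BRight M%:R) (BRight M.+1%:R)) ?bnd_simp ?ler_nat//.
rewrite ge0_integral_setU//=; last 2 first.
  exact: mg.
  rewrite disj_set2E; apply/eqP/seteqP; split => // x [] /=.
  by rewrite !in_itv/= => /andP[_ /le_lt_trans h] /andP[/h]; rewrite ltxx.
rewrite big_ord_recr/= EFinD leeD//.
apply: (@le_trans _ _ (\int[mu]_(x in `]M%:R, M.+1%:R]) (expR (- (c * M.+1%:R ^+ 2)))%:E)%E).
  rewrite integral_cst//= lebesgue_measure_itv/= lte_fin ltr_nat ltnSn -EFinB -natrB// subSnn.
  by rewrite mule1.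
apply: ge0_le_integral => //; [exact: mg|].
move=> x; rewrite /= in_itv/= => /andP[Mx xM]; rewrite lee_fin ler_expR lerN2 ler_wpM2l ?(ltW c0)//.
apply: lerXn2r; rewrite ?nnegrE//; apply: le_trans (ltW Mx); exact: ler0n.
Qed.

Lemma sum_box_seq_prod n M (g : int -> R) :
  \sum_(z <- box_seq M) \prod_(k < n) g (z 0 k) = (\sum_(i < M.*2.+1) g (i%:Z - M%:Z)) ^+ n.
Proof.
rewrite big_map big_enum/= -[in RHS](card_ord n) -prodr_const bigA_distr_bigA/=.
by apply: eq_bigr => i _; apply: eq_bigr => k _; rewrite mxE.
Qed.

Lemma eigenvalue_torusE n (z : 'rV[int]_n) :
  eigenvalue_torus R z = 4 * pi ^+ 2 * \sum_k (z 0 k)%:~R ^+ 2.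
Proof.
rewrite /eigenvalue_torus /znorm exprMn sqr_sqrtr ?sumr_ge0// => [|k _]; last exact: sqr_ge0.
by rewrite exprMn; congr (_ * _ * _); rewrite -natrX.
Qed.

(** The sum factorizes over coordinates, each factor being 1 plus twice a Gaussian sum. The constant
    (4 pi)^(-1/2) is that of the one-dimensional heat kernel; its n-th power matches the (4
    pi)^(n/2) in [lqg_const]. *)
Lemma theta_le n M (t : R) : 0 < t ->
  \sum_(z <- @box_seq n M) expR (- (eigenvalue_torus R z * t)) <=
  (1 + (Num.sqrt (4 * pi))^-1 / Num.sqrt t) ^+ n.
Proof.
move=> t0; pose c : R := 4 * pi ^+ 2 * t.
have pi0 : 0 < pi :> R by exact: pi_gt0.
have c0 : 0 < c by rewrite !mulr_gt0// exprn_gt0.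
rewrite (eq_bigr (fun z : 'rV_n => \prod_(k < n) expR (- (c * (z 0 k)%:~R ^+ 2)))); last first.
  move=> z _; rewrite eigenvalue_torusE -expR_sum; congr expR.
  by rewrite sumrN -mulr_sumr /c; congr (- _); ring.
rewrite (@sum_box_seq_prod n M (fun u => expR (- (c * u%:~R ^+ 2)))).
apply: lerXn2r; rewrite ?nnegrE.
- by apply: sumr_ge0 => i _; exact: expR_ge0.
- by rewrite addr_ge0// divr_ge0 ?invr_ge0 ?sqrtr_ge0.
rewrite (@sum_sym_ord (fun u => expR (- (c * u%:~R ^+ 2)))); last first.
  by move=> k; rewrite mulrNz sqrrN.
rewrite expr0n mulr0 oppr0 expR0 lerD2l.
apply: le_trans (ler_wpM2l _ (@sum_gauss_le c M c0)) _; first by [].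
rewrite le_eqVlt; apply/orP; left; apply/eqP.
have -> : Num.sqrt c = 2 * pi * Num.sqrt t.
  rewrite /c sqrtrM ?mulr_ge0 ?exprn_ge0 ?(ltW pi0)//; congr (_ * _).
  rewrite (_ : 4 * pi ^+ 2 = (2 * pi) ^+ 2); last by ring.
  by rewrite sqrtr_sqr ger0_norm// mulr_ge0// ltW.
have -> : Num.sqrt (4 * pi) = 2 * Num.sqrt pi :> R.
  rewrite sqrtrM//; congr (_ * _); rewrite (_ : 4 = 2 ^+ 2 :> R); last by ring.
  by rewrite sqrtr_sqr ger0_norm.
rewrite -{2}(sqr_sqrtr (ltW pi0)); field.
by rewrite !gt_eqF ?sqrtr_gt0.
Qed.

End theta.

Section lattice_sum.
Context {R : realType}.
Local Notation mu := (@lebesgue_measure R).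

(** Isolates the leading term of the theta bound: with u = sqrt t and v = (4 pi)^(-1/2), v^n
    produces the logarithm, while the remainder keeps a factor u and becomes the integrable
    t^(-1/2). *)
Lemma expD_le (n : nat) (u v : R) : 0 <= u <= 1 -> 0 <= v ->
  (u + v) ^+ n <= v ^+ n + u * (n%:R * (1 + v) ^+ n).
Proof.
move=> /andP[u0 u1] v0; elim: n => [|n ih]; first by rewrite !expr0 mul0r mulr0 addr0.
rewrite [leLHS]exprS; apply: le_trans (ler_wpM2l (addr_ge0 u0 v0) ih) _.
have h1 : v ^+ n <= (1 + v) ^+ n by apply: lerXn2r; rewrite ?nnegrE ?addr_ge0// lerDr.
have h2 : 1 <= (1 + v) ^+ n by rewrite exprn_ege1// lerDl.
have h3 : 0 <= v ^+ n by rewrite exprn_ge0.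
have n0 : 0 <= n%:R :> R by [].
rewrite -natr1 !exprS; move: (v ^+ n) ((1 + v) ^+ n) (n%:R : R) h1 h2 h3 n0 => A B N h1 h2 h3 n0.
rewrite (_ : (u + v) * (A + u * (N * B)) = v * A + u * (A + (u + v) * (N * B))); last by ring.
rewrite lerD2l ler_wpM2l// (_ : (N + 1) * ((1 + v) * B) = B + v * B + (1 + v) * (N * B)); last by ring.
apply: lerD; first by rewrite (le_trans h1)// lerDl mulr_ge0// (le_trans _ h2).
by rewrite ler_wpM2r ?mulr_ge0 ?(le_trans _ h2)// lerD2r.
Qed.

Lemma eigenvalue_torus_ge1 n (z : 'rV[int]_n) : z != 0 -> 1 <= eigenvalue_torus R z.
Proof.
move=> z0; have /existsP[k zk] : [exists k, z 0 k != 0].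
  apply: contraR z0; rewrite negb_exists => /forallP h.
  by apply/eqP/rowP => k; rewrite mxE; apply/eqP; have := h k; rewrite negbK.
rewrite eigenvalue_torusE (bigD1 k)//=.
have z1 : 1 <= (z 0 k)%:~R ^+ 2 :> R.
  by rewrite expr2 -intrM -[1]/(1%:~R) ler_int; have := zk; nia.
have := pi_ge2 R => p2; have p4 : 4 <= pi ^+ 2 :> R by nra.
rewrite mulrDr -[leLHS]addr0 lerD//; last first.
  by rewrite mulr_ge0 ?mulr_ge0 ?exprn_ge0// ?(le_trans _ p2)// sumr_ge0// => i _; exact: sqr_ge0.
by rewrite mulr_ege1// mulr_ege1// ?(le_trans _ p4)// ler1n.
Qed.

(* [Gamma (n/2) * lambda^(-n/2)] is the integral of [t^(n/2-1) * exp (- lambda t)], so the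
   sum becomes an integral of the theta function, whose range [(M+1)^-2, 1] produces the
   logarithm. *)
Lemma lattice_sum_le n : (0 < n)%N -> exists C : R, 0 <= C /\ forall M,
  \sum_(z <- @box_seq n M | z != 0) (lqg_const R n)^-1 * eigenvalue_torus R z `^ (- (n%:R / 2))
    <= ln M.+1%:R + C.
Proof.
move=> n0; pose b : R := (Num.sqrt (4 * pi))^-1.
have pi0 : 0 < pi :> R by exact: pi_gt0.
have b0 : 0 < b by rewrite invr_gt0 sqrtr_gt0 mulr_gt0.
pose G : R := Euler_Gamma (n%:R / 2).
have G0 : 0 < G by exact: Euler_Gamma_gt0.
pose C2 := n%:R * (1 + b) ^+ n; pose C3 := expR 1 * (1 + b) ^+ n.
have C20 : 0 <= C2 by rewrite mulr_ge0// exprn_ge0// addr_ge0// ltW.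
have C30 : 0 <= C3 by rewrite mulr_ge0 ?expR_ge0// exprn_ge0// addr_ge0// ltW.
(* The 2 in the denominator will halve the 2 ln K that comes from the range [K^-2, 1], leaving ln K
   with factor 1. *)
have cE : (lqg_const R n)^-1 = G / (2 * b ^+ n).
  rewrite /lqg_const invf_div powR_halfn ?mulr_gt0// -/G /b exprVn; field.
  by rewrite expf_neq0// gt_eqF// sqrtr_gt0 mulr_gt0.
have D0 : 0 <= (2 ^+ n * expR 1 * G + C2 * 2 + C3 * G) / (2 * b ^+ n).
  apply: divr_ge0; last by rewrite mulr_ge0// exprn_ge0// ltW.
  apply: addr_ge0; last by apply: mulr_ge0 => //; exact: ltW.
  apply: addr_ge0; last exact: mulr_ge0.
  apply: mulr_ge0; last exact: ltW.
  by rewrite mulr_ge0 ?expR_ge0// exprn_ge0.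
exists ((2 ^+ n * expR 1 * G + C2 * 2 + C3 * G) / (2 * b ^+ n)); split => //.
(* For M = 0 there is no nonzero frequency; the case is separate because the cut (M+1)^-2 has to lie
   below 1. *)
case=> [|M0].
  rewrite big1_seq; first by rewrite ln1 add0r.
  move=> z /andP[z0]; rewrite mem_box_seq => /forallP zz; case/negP : z0; apply/eqP/rowP => k.
  by have := zz k; rewrite leqn0 absz_eq0 mxE => /eqP.
set M := M0.+1; pose K : R := M.+1%:R.
have K1 : 1 < K by rewrite ltr1n.
have K0 : 0 < K by exact: lt_trans K1.
pose e := K ^- 2.
have e01 : 0 < e < 1 by rewrite invr_gt0 exprn_gt0// invf_lt1 ?exprn_gt0// exprn_egt1.
pose g (lam t : R) := (t `^ (n%:R / 2 - 1) * expR (- (lam * t)))%:E.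
have g0 lam t : (0 <= g lam t)%E by rewrite lee_fin mulr_ge0 ?powR_ge0 ?expR_ge0.
have mg lam D : measurable_fun D (g lam).
  by apply: measurable_funTS; exact: measurable_gamma_fun.
pose c0 := (2 * K) ^+ n * expR 1.
pose q (t : R) : \bar R := ((b ^+ n)%:E * (t `^ (-1))%:E + C2%:E * (t `^ (- 2^-1))%:E)%E.
have q0 t : (0 <= q t)%E by rewrite /q -!EFinM -EFinD lee_fin addr_ge0// mulr_ge0 ?powR_ge0// exprn_ge0// ltW.
have mq1 D : measurable_fun D (fun t : R => ((b ^+ n)%:E * (t `^ (-1))%:E)%E).
  by apply: measurable_funTS; apply/measurable_EFinP/measurable_funM => //; exact: measurable_powR.
have mq2 D : measurable_fun D (fun t : R => (C2%:E * (t `^ (-2^-1))%:E)%E).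
  by apply: measurable_funTS; apply/measurable_EFinP/measurable_funM => //; exact: measurable_powR.
have mq D : measurable_fun D q by apply: emeasurable_funD.
pose S (t : R) := \sum_(z <- @box_seq n M | z != 0) expR (- (eigenvalue_torus R z * t)).
have SE t : (0 < t) -> S t <= (1 + b / Num.sqrt t) ^+ n.
  move=> t0; apply: le_trans (theta_le n M t0); rewrite /S big_mkcond/=.
  by apply: ler_sum => z _; case: ifP => // _; exact: expR_ge0.
have lam1 (z : 'rV[int]_n) : z != 0 -> 1 <= eigenvalue_torus R z by exact: eigenvalue_torus_ge1.
have c00 : 0 <= c0 by rewrite mulr_ge0 ?expR_ge0// exprn_ge0// mulr_ge0// ltW.
(* Three ranges. Below K^-2, S is at most the number of frequencies and exp (1 - K^2 t) >= 1.
   Between K^-2 and 1, [theta_le] and [expD_le] apply. Beyond 1, lambda >= 1 gives lambda t >=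
   lambda + t - 1, hence a factor exp (1 - t) times the sum at time 1. *)
have key t : 0 < t -> ((t `^ (n%:R / 2 - 1) * S t)%:E <=
   c0%:E * g (K ^+ 2)%R t + (q \_ `[e, 1%R]) t + C3%:E * g 1%R t)%E.
  move=> t0; have p0 : 0 <= t `^ (n%:R / 2 - 1) by exact: powR_ge0.
  have A1 : (0 <= c0%:E * g (K ^+ 2)%R t)%E by rewrite mule_ge0.
  have A2 : (0 <= (q \_ `[e, 1%R]) t)%E by rewrite patchE; case: ifP.
  have A3 : (0 <= C3%:E * g 1%R t)%E by rewrite mule_ge0.
  have [te|et] := ltP t e.
    apply: (@le_trans _ _ (c0%:E * g (K ^+ 2)%R t)%E); last by rewrite -addeA leeDl// adde_ge0.
    rewrite -EFinM lee_fin mulrCA ler_wpM2l// /c0 -mulrA -expRD.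
    apply: (@le_trans _ _ ((2 * K) ^+ n)).
      apply: (@le_trans _ _ (size (@box_seq n M))%:R).
        rewrite /S -sum1_size natr_sum big_mkcond/=; apply: ler_sum => z _.
        by case: ifPn => // z0; rewrite expR_le1 oppr_le0 mulr_ge0 ?(ltW t0)// (le_trans _ (lam1 _ z0)).
      rewrite size_box_seq natrX; apply: lerXn2r; rewrite ?nnegrE ?mulr_ge0 ?(ltW K0)//.
      by rewrite /K -natrM ler_nat mul2n doubleS.
    rewrite ler_peMr ?exprn_ge0 ?mulr_ge0 ?(ltW K0)// -[leLHS]expR0 ler_expR subr_ge0.
    have : t * K ^+ 2 < 1 by rewrite -ltr_pdivlMr ?exprn_gt0// mul1r.
    by rewrite mulrC => /ltW.
  have [t1|t1] := leP t 1.
    apply: (@le_trans _ _ ((q \_ `[e, 1%R]) t)%E); last first.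
      by rewrite -addeA addeCA leeDl// adde_ge0.
    rewrite patchE mem_set ?/= ?in_itv/= ?et// /q -!EFinM -EFinD lee_fin.
    rewrite powR_halfn1// powR_inv1 ?(ltW t0)// powRN powR12_sqrt ?(ltW t0)//.
    have s0 : 0 < Num.sqrt t by rewrite sqrtr_gt0.
    have s1 : Num.sqrt t <= 1 by rewrite -sqrtr1 ler_wsqrtr.
    apply: (@le_trans _ _ (Num.sqrt t ^+ n / t * (1 + b / Num.sqrt t) ^+ n)).
      by rewrite ler_wpM2l ?SE// divr_ge0 ?exprn_ge0 ?(ltW s0) ?(ltW t0).
    rewrite mulrAC -exprMn mulrDr mulr1 mulrCA divff ?gt_eqF// mulr1.
    apply: le_trans (ler_wpM2r _ (@expD_le n (Num.sqrt t) b _ _)) _.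
    - by rewrite invr_ge0 ltW.
    - by rewrite (ltW s0).
    - exact: ltW.
    rewrite -/C2 -{2 3}(sqr_sqrtr (ltW t0)) le_eqVlt; apply/orP; left; apply/eqP.
    by field; rewrite gt_eqF.
  apply: (@le_trans _ _ (C3%:E * g 1%R t)%E); last by rewrite leeDr// adde_ge0.
  rewrite -EFinM lee_fin mulrCA ler_wpM2l// mul1r.
  apply: (@le_trans _ _ (\sum_(z <- @box_seq n M) expR 1 * expR (- (eigenvalue_torus R z * 1)) * expR (- t))).
    rewrite /S big_mkcond/=; apply: ler_sum => z _; case: ifPn => [z0|_]; last by rewrite !mulr_ge0 ?expR_ge0.
    by rewrite -!expRD ler_expR; have := lam1 _ z0; nra.
  rewrite -mulr_suml -mulr_sumr /C3 ler_wpM2r ?expR_ge0// ler_wpM2l ?expR_ge0//.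
  by apply: le_trans (theta_le n M ltr01) _; rewrite sqrtr1 divr1.
have sumE : (\sum_(z <- @box_seq n M | z != 0%R) gamma_int n (eigenvalue_torus R z) =
    \int[mu]_(t in `]0%R, +oo[) (t `^ (n%:R / 2 - 1) * S t)%:E)%E.
  rewrite -big_filter -ge0_integral_sum//=; last 2 first.
    by move=> z; exact: mg.
    by move=> z x _; exact: g0.
  by apply: eq_integral => t _; rewrite /S big_filter sumEFin mulr_sumr.
have m1 D : measurable_fun D (fun t : R => (c0%:E * g (K ^+ 2)%R t)%E).
  by apply: measurable_funeM; exact: mg.
have m2 : measurable_fun (`]0%R, +oo[%classic : set R) (q \_ `[e, 1%R]%classic).
  by apply: measurable_funTS; apply/(measurable_restrictT _ _).1 => //; exact: mq.
have m3 D : measurable_fun D (fun t : R => (C3%:E * g 1%R t)%E).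
  by apply: measurable_funeM; exact: mg.
(* The factor K^-n compensates the (2K)^n frequencies counted in [c0], so small times contribute a
   constant. *)
have K2 : gamma_int n (K ^+ 2) = (K ^- n * G)%:E.
  by rewrite gamma_intE ?exprn_gt0// sqrtr_sqr ger0_norm ?(ltW K0)// gamma_int_Euler// -EFinM.
have : (\sum_(z <- @box_seq n M | z != 0%R) gamma_int n (eigenvalue_torus R z) <=
   (c0 * (K ^- n * G) + (b ^+ n * (2 * ln K) + C2 * 2) + C3 * G)%:E)%E.
  rewrite sumE; apply: (@le_trans _ _ (\int[mu]_(t in `]0%R, +oo[)
     (c0%:E * g (K ^+ 2)%R t + (q \_ `[e, 1%R]) t + C3%:E * g 1%R t))%E).
    apply: ge0_le_integral => //.
    - by move=> t _; rewrite lee_fin mulr_ge0 ?powR_ge0// /S sumr_ge0// => z _; exact: expR_ge0.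
    - apply: measurable_funTS; apply/measurable_EFinP/measurable_funM; first exact: measurable_powR.
      rewrite (_ : S = fun t => \sum_(z <- [seq z <- @box_seq n M | z != 0]) expR (- (eigenvalue_torus R z * t))); last first.
        by apply/funext => t; rewrite big_filter.
      apply: measurable_sum => z; apply: measurableT_comp => //; apply: measurableT_comp => //.
    - by apply: emeasurable_funD; [apply: emeasurable_funD; [exact: m1|exact: m2]|exact: m3].
    - by move=> t /=; rewrite in_itv/= andbT; exact: key.
  have n1 t : (0 <= c0%:E * g (K ^+ 2)%R t)%E by rewrite mule_ge0.
  have n2 t : (0 <= (q \_ `[e, 1%R]) t)%E by rewrite patchE; case: ifP.
  have n3 t : (0 <= C3%:E * g 1%R t)%E by rewrite mule_ge0.
  rewrite ge0_integralD//; last 3 first.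
    by move=> t _; rewrite adde_ge0.
    by apply: emeasurable_funD; [exact: m1|exact: m2].
    exact: m3.
  rewrite ge0_integralD//; last exact: m1.
  rewrite !EFinD; apply: leeD; last first.
    rewrite ge0_integralZl//; last exact: mg.
    by rewrite -/(gamma_int n 1) gamma_int_Euler// -EFinM.
  apply: leeD; first by rewrite ge0_integralZl// -/(gamma_int n _) ?K2 ?EFinM//; exact: mg.
  rewrite -integral_mkcondr setIidr; last first.
    by move=> t /=; rewrite !in_itv/= andbT => /andP[/(lt_le_trans _) h _]; apply: h; case/andP: e01.
  rewrite /q ge0_integralD//; last 4 first.
    by move=> t _; rewrite -EFinM lee_fin mulr_ge0 ?powR_ge0// exprn_ge0// ltW.
    exact: mq1.
    by move=> t _; rewrite -EFinM lee_fin mulr_ge0 ?powR_ge0.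
    exact: mq2.
  have mp (r : R) D : measurable_fun D (fun t : R => (t `^ r)%:E).
    by apply: measurable_funTS; apply/measurable_EFinP; exact: measurable_powR.
  apply: leeD; rewrite ge0_integralZl//.
  - rewrite integral_inv// -EFinM lee_fin le_eqVlt; apply/orP; left; apply/eqP.
    by rewrite /e lnV ?posrE ?exprn_gt0// lnXn// opprK mulr_natl.
  - exact: mp.
  - by move=> t _; rewrite lee_fin powR_ge0.
  - by rewrite lee_fin exprn_ge0// ltW.
  - by rewrite [(C2 * 2)%:E]EFinM; apply: lee_wpmul2l => //; exact: integral_invsqrt.
  - exact: mp.
  - by move=> t _; rewrite lee_fin powR_ge0.
rewrite (eq_bigr (fun z => (G * eigenvalue_torus R z `^ (- (n%:R / 2)))%:E)); last first.
  move=> z z0; have l0 : 0 < eigenvalue_torus R z by rewrite (lt_le_trans _ (lam1 _ z0)).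
  by rewrite gamma_intE// gamma_int_Euler// powRN_halfn// -EFinM mulrC.
rewrite sumEFin lee_fin; move=> h; move: (h); rewrite -[X in X <= _ -> _]mulr_sumr => {}h.
rewrite -mulr_sumr cE mulrAC ler_pdivrMr ?mulr_gt0 ?exprn_gt0//.
apply: le_trans h _; rewrite le_eqVlt; apply/orP; left; apply/eqP.
have Kn0 : K ^+ n != 0 by rewrite expf_neq0// gt_eqF.
have bn0 : b ^+ n != 0 by rewrite expf_neq0// gt_eqF.
rewrite /c0 exprMn -/K; move: (K ^+ n) (b ^+ n) (2 ^+ n : R) (ln K) Kn0 bn0 => Kn bn w l Kn0 bn0.
by field; rewrite Kn0 bn0.
Qed.

End lattice_sum.

Lemma ler_sum_mem (R : numDomainType) (I : eqType) (r : seq I) (P : pred I) (F G : I -> R) :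
  (forall i, i \in r -> P i -> F i <= G i) ->
  \sum_(i <- r | P i) F i <= \sum_(i <- r | P i) G i.
Proof.
move=> FG; rewrite big_seq_cond [X in _ <= X]big_seq_cond.
by apply: ler_sum => i /andP[]; exact: FG.
Qed.

(** * Comparison of discrete and continuous eigenvalues *)

Section discrete_eigenvalues.
Context {R : realType}.

Lemma sin_mvt (x : R) : 0 < x -> exists2 c, 0 < c < x & sin x = x * cos c.
Proof.
move=> x0.
have cs : {within `[0, x], continuous (@sin R)}.
  by apply: continuous_subspaceT; exact: continuous_sin.
have [c] := @MVT R sin cos 0 x x0 (fun y _ => is_derive_sin y) cs.
by rewrite in_itv/= => cx; rewrite sin0 !subr0 mulrC => ->; exists c.
Qed.

Lemma sin_sqr_le (x : R) : sin x ^+ 2 <= x ^+ 2.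
Proof.
wlog x0 : x / 0 <= x => [h|].
  have [/h//|/ltW x0] := leP 0 x.
  by rewrite -sqrrN -sinN -[leRHS]sqrrN h// oppr_ge0.
move: x0; rewrite le_eqVlt => /orP[/eqP <-|/sin_mvt[c _ ->]]; first by rewrite sin0.
by rewrite exprMn ler_piMr ?sqr_ge0//; have := cos2Dsin2 c; have := sqr_ge0 (sin c); lra.
Qed.

(** By the mean value theorem sin (pi x) / (pi x) is a cosine at a smaller argument, close to 1 near
    0. The bound d <= 1/4 keeps pi d in the range where sin increases. *)
Lemma sin_ge_near0 (e : R) : e < 1 -> exists d, [/\ 0 < d, d <= 4^-1 &
  forall x, 0 <= x <= d -> e * (pi * x) <= sin (pi * x)].
Proof.
move=> e1; have : \forall x \near (0 : R), e < cos x.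
  by have /cvgr_gt := @continuous_cos R 0; apply; rewrite cos0.
move=> /nbhs_ballP[r /= r0 re].
have pi0 : 0 < pi :> R by exact: pi_gt0.
exists (Num.min 4^-1 (r / (2 * pi))); split.
- by rewrite lt_min invr_gt0 ltr0n/= divr_gt0// mulr_gt0.
- by rewrite ge_min lexx.
move=> x /andP[x0]; rewrite le_min => /andP[_ xr].
move: x0; rewrite le_eqVlt => /orP[/eqP <-|x0]; first by rewrite !mulr0 sin0.
have [c /andP[c0 cx] ->] := sin_mvt (mulr_gt0 pi0 x0).
rewrite [leRHS]mulrC ler_wpM2r ?mulr_ge0 ?ltW// re//= /ball/= sub0r normrN gtr0_norm//.
apply: lt_trans cx _; have : x * (2 * pi) <= r by rewrite -ler_pdivlMr ?mulr_gt0.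
have : 0 < pi * x by rewrite mulr_gt0.
by rewrite (_ : x * (2 * pi) = 2 * (pi * x)); [lra|ring].
Qed.

Lemma bernoulli_ineq (x : R) n : 0 <= x <= 1 -> 1 - n%:R * x <= (1 - x) ^+ n.
Proof.
move=> /andP[x0 x1]; elim: n => [|n ih]; first by rewrite mul0r subr0 expr0.
rewrite exprS; apply: le_trans (ler_wpM2l _ ih); last by rewrite subr_ge0.
have : 0 <= n%:R * x ^+ 2 by rewrite mulr_ge0// exprn_ge0.
by rewrite -natr1; nra.
Qed.

Variable n : nat.
Hypothesis n0 : (0 < n)%N.

Lemma eigenvalue_grid_le_torus N (z : 'rV[int]_n) : (0 < N)%N ->
  eigenvalue_grid R N z <= eigenvalue_torus R z.
Proof.
move=> N0; rewrite eigenvalue_torusE /eigenvalue_grid.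
rewrite !mulr_sumr; apply: ler_sum => k _.
have NN : 0 < N%:R :> R by rewrite ltr0n.
apply: le_trans (ler_wpM2l _ (sin_sqr_le _)) _; first by rewrite mulr_ge0// exprn_ge0.
rewrite le_eqVlt; apply/orP; left; apply/eqP.
by field; rewrite gt_eqF.
Qed.

(** Coordinates are split at d N. Below, the sine is at least [eta] times its argument; above, it is
    at least s = sin (pi d), as |z_k| < N / 2. One large coordinate alone gives a multiple of N^2;
    if there is none, the eigenvalues are compared coordinate by coordinate. *)
Lemma eigenvalue_grid_bounds : exists s : R, 0 < s /\ forall m (z : 'rV[int]_n),
  z \in box_seq m ->
  (forall K, ~~ inbox K z -> (s * K.+1%:R) ^+ 2 <= eigenvalue_grid R m.*2.+1 z) /\
  ((1 - (2 * n%:R)^-1) ^+ 2 * eigenvalue_torus R z <= eigenvalue_grid R m.*2.+1 z \/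
   (s * m.*2.+1%:R) ^+ 2 <= eigenvalue_grid R m.*2.+1 z).
Proof.
(* The loss is chosen so that the n-th power of [eta] is still at least 1/2. *)
set eta : R := 1 - (2 * n%:R)^-1.
have nR : 1 <= n%:R :> R by rewrite ler1n.
have eta1 : eta < 1 by rewrite gtrBl invr_gt0 mulr_gt0// ltr0n.
have eta2 : 2^-1 <= eta.
  rewrite lerBrDl -lerBrDr (_ : 1 - 2^-1 = 2^-1); last by field.
  by rewrite lef_pV2 ?posrE ?mulr_gt0 ?ltr0n// ler_peMr.
have [d [d0 d4 dsin]] := sin_ge_near0 eta1.
have pi0 : 0 < pi :> R by exact: pi_gt0.
pose s := sin (pi * d).
have s0 : 0 < s.
  rewrite sin_gt0_pi// mulr_gt0//= gtr_pMr//; apply: le_lt_trans d4 _.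
  by rewrite invf_lt1// ltr1n.
have s1 : s <= 1 by exact: sin_le1.
have sinE (u N : R) : 0 < N -> sin (pi * u / N) ^+ 2 = sin (pi * (`|u| / N)) ^+ 2.
  move=> N0; case: (ger0P u) => _; first by rewrite mulrA.
  by rewrite mulNr mulrN sinN sqrrN mulrA.
have small (u N : R) : 0 < N -> `|u| <= d * N ->
    eta ^+ 2 * (4 * pi ^+ 2 * u ^+ 2) <= 4 * N ^+ 2 * sin (pi * u / N) ^+ 2.
  move=> N0 ud; rewrite sinE//.
  have h : eta * (pi * (`|u| / N)) <= sin (pi * (`|u| / N)).
    by apply: dsin; rewrite divr_ge0 ?(ltW N0)//= ler_pdivrMr.
  have h0 : 0 <= eta * (pi * (`|u| / N)).
    apply: mulr_ge0; first by apply: le_trans eta2; rewrite invr_ge0.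
    by apply: mulr_ge0; [exact: ltW|rewrite divr_ge0// ltW].
  apply: (@le_trans _ _ (4 * N ^+ 2 * (eta * (pi * (`|u| / N))) ^+ 2)).
    rewrite -(real_normK (num_real u)) le_eqVlt; apply/orP; left; apply/eqP.
    by field; rewrite gt_eqF.
  rewrite ler_wpM2l ?mulr_ge0 ?exprn_ge0 ?(ltW N0)//.
  by apply: lerXn2r; rewrite ?nnegrE// (le_trans h0 h).
have large (u N : R) : 0 < N -> d * N < `|u| -> `|u| < N / 2 ->
    4 * N ^+ 2 * s ^+ 2 <= 4 * N ^+ 2 * sin (pi * u / N) ^+ 2.
  move=> N0 du uN; rewrite sinE// ler_wpM2l ?mulr_ge0 ?exprn_ge0 ?(ltW N0)//.
  have d1 : d < `|u| / N by rewrite ltr_pdivlMr.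
  have u2 : `|u| / N < 2^-1 by rewrite ltr_pdivrMr// mulrC.
  have ss : s < sin (pi * (`|u| / N)).
    rewrite /s ltr_sin ?ltr_pM2l// in_itv/=; apply/andP; split; nra.
  by apply: lerXn2r; rewrite ?nnegrE ?(ltW s0) ?(ltW ss)// (ltW (lt_trans s0 ss)).
exists s; split => // m z; rewrite mem_box_seq => /forallP zm.
set N : R := m.*2.+1%:R.
have N0 : 0 < N by rewrite ltr0n.
have zN k : `|(z 0 k)%:~R| < N / 2 :> R.
  rewrite ltr_pdivlMr// -intr_norm -[2]/(2%:~R) -intrM -[N]/(m.*2.+1%:~R) ltr_int.
  by have := zm k; lia.
have ge1 k : 4 * N ^+ 2 * sin (pi * (z 0 k)%:~R / N) ^+ 2 <= eigenvalue_grid R m.*2.+1 z.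
  rewrite /eigenvalue_grid -/N ler_wpM2l ?mulr_ge0 ?exprn_ge0 ?(ltW N0)//.
  by rewrite (bigD1 k)//= lerDl sumr_ge0// => i _; exact: sqr_ge0.
split.
  move=> K; rewrite negb_forall => /existsP[k]; rewrite -ltnNge => Kz.
  apply: le_trans (ge1 k).
  have Ku : K.+1%:R <= `|(z 0 k)%:~R| :> R.
    by rewrite -intr_norm -[K.+1%:R]/(K.+1%:~R) ler_int; lia.
  have K0 : 0 <= K.+1%:R :> R by [].
  have Ku2 : K.+1%:R ^+ 2 <= (z 0 k)%:~R ^+ 2 :> R.
    by rewrite -(real_normK (num_real (z 0 k)%:~R)); apply: lerXn2r; rewrite ?nnegrE.
  have [u1|u1] := leP `|(z 0 k)%:~R| (d * N).
    apply: le_trans (small _ _ N0 u1); rewrite exprMn mulrA.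
    apply: ler_pM => //; rewrite ?exprn_ge0 ?(ltW s0)//.
    have := pi_ge2 R => p2; apply: (@le_trans _ _ 1); first by rewrite exprn_ile1 ?(ltW s0).
    have e4 : 4^-1 <= eta ^+ 2 by nra.
    have p4 : 4 <= pi ^+ 2 :> R by nra.
    move: (eta ^+ 2) (pi ^+ 2 : R) e4 p4 => A B A4 B4; nra.
  apply: le_trans (large _ _ N0 u1 (zN k)); rewrite exprMn mulrC ler_wpM2r ?exprn_ge0 ?(ltW s0)//.
  apply: le_trans Ku2 _; rewrite -(real_normK (num_real (z 0 k)%:~R)).
  have := zN k; have : 0 <= `|(z 0 k)%:~R| :> R by [].
  by move: (`|_|) => u u0 uN; nra.
have [/forallP all_small|] := boolP [forall k, `|(z 0 k)%:~R| <= d * N].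
  left; rewrite eigenvalue_torusE /eigenvalue_grid -/N !mulr_sumr.
  by apply: ler_sum => k _; exact: small.
rewrite negb_forall => /existsP[k]; rewrite -ltNge => uk; right.
apply: le_trans (ge1 k); apply: le_trans (large _ _ N0 uk (zN k)).
by have := sqr_ge0 (s * N); rewrite exprMn; lra.
Qed.

(** The assumption on [lam] covers both families of eigenvalues at once. Where the two eigenvalues
    are comparable, the coefficient at most doubles and [lattice_sum_le] applies; elsewhere it is at
    most C2 N^(-n), for at most N^n frequencies. *)
Lemma lqg_coef_bounds : exists C : R, 0 <= C /\ forall m (lam : 'rV[int]_n -> R),
  (forall z, z \in box_seq m -> z != 0 -> eigenvalue_grid R m.*2.+1 z <= lam z) ->
  let a z := (lqg_const R n)^-1 * lam z `^ (- (n%:R / 2)) in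
  (forall J, \sum_(z <- box_seq m | dyadic_box J z) a z <= 2 * ln 2 * J%:R + C) /\
  (forall J z, z \in box_seq m -> ~~ inbox (2 ^ J).-1 z -> a z <= C * 2 ^- n ^+ J).
Proof.
have [s [s0 sP]] := eigenvalue_grid_bounds.
have [C1 [C10 C1P]] := @lattice_sum_le R n n0.
have c0 : 0 < lqg_const R n by exact: lqg_const_gt0.
have ci : 0 <= (lqg_const R n)^-1 by rewrite invr_ge0 ltW.
pose C2 := (lqg_const R n)^-1 * s ^- n.
have C20 : 0 <= C2 by rewrite mulr_ge0// invr_ge0 exprn_ge0// ltW.
exists (2 * C1 + C2); split; first by rewrite addr_ge0// mulr_ge0.
move=> m lam lamP a.
have N0 : 0 < m.*2.+1%:R :> R by rewrite ltr0n.
have pow_le (x y : R) : 0 < x -> x ^+ 2 <= y -> y `^ (- (n%:R / 2)) <= x ^- n.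
  move=> x0 xy; have y0 : 0 < y by rewrite (lt_le_trans _ xy)// exprn_gt0.
  rewrite powRN_halfn// lef_pV2 ?posrE ?exprn_gt0 ?sqrtr_gt0//.
  apply: lerXn2r; rewrite ?nnegrE ?sqrtr_ge0 ?(ltW x0)//.
  by rewrite -[leLHS](ger0_norm (ltW x0)) -sqrtr_sqr ler_wsqrtr.
have box0 (z : 'rV[int]_n) : z != 0 -> ~~ inbox 0 z.
  apply: contra => /forallP h; apply/eqP/rowP => k.
  by have := h k; rewrite leqn0 absz_eq0 mxE => /eqP.
have a_le z : z \in box_seq m -> z != 0 -> a z <=
    2 * ((lqg_const R n)^-1 * eigenvalue_torus R z `^ (- (n%:R / 2))) +
    C2 * (m.*2.+1%:R ^- n).
  move=> zm z0; have [_ [h|h]] := sP m z zm.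
    have nR : 1 <= n%:R :> R by rewrite ler1n.
    set eta := 1 - _ in h.
    have eta2 : 2^-1 <= eta ^+ n.
      apply: le_trans (_ : 1 - n%:R * (2 * n%:R)^-1 <= _).
        by rewrite le_eqVlt; apply/orP; left; apply/eqP; field; rewrite pnatr_eq0 -lt0n.
      apply: bernoulli_ineq; rewrite invr_ge0 mulr_ge0//= invf_le1 ?mulr_gt0 ?ltr0n//.
      by rewrite (le_trans nR)// ler_peMl// ler1n.
    have eta0 : 0 < eta.
      rewrite subr_gt0 invf_lt1 ?mulr_gt0 ?ltr0n// (lt_le_trans (ltr1n R 2))//.
      by rewrite ler_peMr.
    have l0 : 0 < eigenvalue_torus R z by rewrite (lt_le_trans _ (@eigenvalue_torus_ge1 R n z z0)).
    apply: ler_wpDr; first by rewrite mulr_ge0// invr_ge0 exprn_ge0 ?ltW.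
    rewrite mulrCA ler_wpM2l//.
    apply: le_trans (@pow_le (eta * Num.sqrt (eigenvalue_torus R z)) _ _ _) _.
    - by rewrite mulr_gt0// sqrtr_gt0.
    - by rewrite exprMn sqr_sqrtr ?(ltW l0)// (le_trans h)// lamP.
    rewrite powRN_halfn// exprMn invfM ler_wpM2r ?invr_ge0 ?exprn_ge0 ?sqrtr_ge0//.
    by rewrite -[leRHS]invrK lef_pV2 ?posrE ?exprn_gt0.
  apply: ler_wpDl; first by rewrite !mulr_ge0// powR_ge0.
  rewrite /C2 -mulrA ler_wpM2l// -invfM -exprMn; apply: pow_le; first by rewrite mulr_gt0.
  by rewrite (le_trans h)// lamP.
split=> J.
  set M := (2 ^ J).-1.
  apply: (@le_trans _ _ (\sum_(z <- box_seq m | dyadic_box J z) (2 * ((lqg_const R n)^-1 *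
     eigenvalue_torus R z `^ (- (n%:R / 2))) + C2 * (m.*2.+1%:R ^- n)))).
    apply: ler_sum_mem => z zm /andP[z0 _].
    exact: a_le.
  rewrite big_split/= -mulr_sumr.
  rewrite (_ : 2 * ln 2 * J%:R + (2 * C1 + C2) = 2 * (ln (M.+1%:R) + C1) + C2); last first.
    by rewrite /M prednK ?expn_gt0// natrX lnXn// -[ln 2 *+ J]mulr_natr; ring.
  apply: lerD.
    rewrite ler_wpM2l//; apply: le_trans (C1P M).
    rewrite -big_filter (perm_big [seq z <- box_seq M | (z != 0) && inbox m z]); last first.
      apply: uniq_perm; rewrite ?filter_uniq ?box_seq_uniq// => z.
      by rewrite !mem_filter !mem_box_seq /dyadic_box -/M -!andbA; congr (_ && _); rewrite andbC.
    rewrite big_filter big_mkcond [leRHS]big_mkcond/=; apply: ler_sum => z _.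
    have := mulr_ge0 ci (powR_ge0 (eigenvalue_torus R z) (- (n%:R / 2))).
    by case: (z != 0) => //=; case: ifP.
  rewrite big_const_seq iter_addr_0 -[C2 * _ *+ _]mulr_natr -mulrA ler_piMr//.
  rewrite ler_pdivrMl ?exprn_gt0// mulr1 -natrX ler_nat -size_box_seq.
  exact: count_size.
move=> z zm zJ; have z0 : z != 0.
  by apply: contraNneq zJ => ->; apply/forallP => k; rewrite mxE.
have [h _] := sP m z zm; have {}h := h _ zJ.
have K0 : 0 < (2 ^ J).-1.+1%:R :> R by rewrite ltr0n.
apply: (@le_trans _ _ (C2 * 2 ^- n ^+ J)); last first.
  by rewrite ler_wpM2r ?exprn_ge0 ?invr_ge0 ?exprn_ge0// lerDr mulr_ge0.
rewrite /a /C2 -mulrA ler_wpM2l//.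
apply: le_trans (pow_le _ _ _ (le_trans h (lamP _ zm z0))) _; first by rewrite mulr_gt0.
rewrite prednK ?expn_gt0// natrX exprMn invfM exprVn -!exprM [(J * n)%N]mulnC.
exact: lexx.
Qed.

End discrete_eigenvalues.

(** * Gaussian exponentials *)

Section weighted_pushforward.
Context d d' (T : measurableType d) (T' : measurableType d') (R : realType).
Local Open Scope ereal_scope.
Import HBNNSimple.

(* Covers at once densities (X the identity), laws, and factorization of
   expectations under independence (nu a multiple of the law of X). *)
Lemma integral_weighted_pushforward (m : {measure set T -> \bar R})
    (nu : {measure set T' -> \bar R}) (X : T -> T') (F : T -> R) (c : R) (h : T' -> \bar R) :
  measurable_fun setT X -> measurable_fun setT F -> (forall x, (0 <= F x)%R) -> (0 <= c)%R ->
  (forall B, measurable B -> \int[m]_(x in X @^-1` B) (F x)%:E = c%:E * nu B) ->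
  measurable_fun setT h -> (forall y, 0 <= h y) ->
  \int[m]_x ((F x)%:E * h (X x)) = c%:E * \int[nu]_y h y.
Proof.
move=> mX mF F0 c0 FB mh h0.
pose h_ := nnsfun_approx measurableT mh.
have hcv y : (h_ k y)%:E @[k --> \oo] --> h y by exact: cvg_nnsfun_approx.
have hnd y : {homo (fun k => (h_ k y)%:E) : a b / (a <= b)%N >-> a <= b}.
  by move=> a b ab; rewrite lee_fin; exact/lefP/nd_nnsfun_approx.
have mXB B : measurable B -> measurable (X @^-1` B).
  by move=> mB; rewrite -[X in measurable X]setTI; exact: mX.
have mhX k : measurable_fun setT (fun x => (h_ k (X x))%:E).
  by apply/measurable_EFinP; apply: measurableT_comp mX; exact: measurable_funP.
have -> : \int[nu]_y h y = limn (fun k => \int[nu]_y (h_ k y)%:E).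
  rewrite -monotone_convergence//.
  - by apply: eq_integral => y _; apply/esym/cvg_lim.
  - by move=> k; exact/measurable_EFinP/measurable_funP.
  - by move=> k y _; rewrite lee_fin.
have -> : \int[m]_x ((F x)%:E * h (X x)) = limn (fun k => \int[m]_x ((F x)%:E * (h_ k (X x))%:E)).
  rewrite -monotone_convergence//.
  - apply: eq_integral => x _; apply/esym/cvg_lim => //; exact: cvgeZl.
  - by move=> k; apply: emeasurable_funM => //; exact/measurable_EFinP.
  - by move=> k x _; rewrite -EFinM lee_fin mulr_ge0.
  - by move=> x _ a b ab; apply: lee_wpmul2l; [rewrite lee_fin|exact: hnd].
rewrite -limeMl//; last first.
  apply/cvg_ex; eexists; apply: ereal_nondecreasing_cvgn => a b ab.
  apply: ge0_le_integral => //.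
  - by move=> y _; rewrite lee_fin.
  - by exact/measurable_EFinP/measurable_funP.
  - by exact/measurable_EFinP/measurable_funP.
  - by move=> y _; exact: hnd.
congr (limn _); apply/funext => k.
have mr r : measurable (h_ k @^-1` [set r]) by exact: measurable_sfunP.
rewrite integralT_nnsfun sintegralE ge0_mule_fsumr; last first.
  move=> r; case: (leP 0%R r) => r0; first by rewrite mule_ge0// lee_fin.
  by rewrite preimage_nnfun0// measure0 mule0.
transitivity (\int[m]_x \sum_(r \in range (h_ k)) ((r * \1_(h_ k @^-1` [set r]) (X x))%:E * (F x)%:E)).
  apply: eq_integral => x _; rewrite [X in _ * X%:E]fimfunE -fsumEFin// muleC.
  rewrite ge0_mule_fsuml// => r.
  by rewrite lee_fin; exact: nnfun_muleindic_ge0.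
rewrite ge0_integral_fsum//; last 2 first.
- move=> r; apply: emeasurable_funM; last exact/measurable_EFinP.
  apply/measurable_EFinP/measurable_funM => //.
  by apply: measurableT_comp mX; exact: measurable_indic.
- by move=> r x _; rewrite mule_ge0 ?lee_fin//; exact: nnfun_muleindic_ge0.
apply: eq_fsbigr => r _; have [r0|r0] := leP 0%R r; last first.
  rewrite preimage_nnfun0// measure0 !mule0; apply: integral0_eq => x _.
  by rewrite indic0 mulr0 mul0e.
under eq_integral do rewrite EFinM -muleA.
rewrite ge0_integralZl//; last 2 first.
- apply: emeasurable_funM; last exact/measurable_EFinP.
  by apply/measurable_EFinP; apply: measurableT_comp mX; exact: measurable_indic.
- by move=> x _; rewrite -EFinM lee_fin mulr_ge0.
rewrite muleCA; congr (_ * _); rewrite -FB// [in RHS]integral_mkcond.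
apply: eq_integral => x _; rewrite patchE indicE muleC.
rewrite (_ : (X x \in _) = (x \in X @^-1` (h_ k @^-1` [set r]))); last by [].
by case: ifP; rewrite ?mule1 ?mule0.
Qed.

End weighted_pushforward.

Lemma ge0_integral_exp_density d (T : measurableType d) (R : realType)
    (m : {measure set T -> \bar R}) (g : {mfun T >-> R}) (f : T -> \bar R) :
  measurable_fun setT f -> (forall x, 0 <= f x)%E ->
  (\int[exp_density m g]_x f x = \int[m]_x ((expR (g x))%:E * f x))%E.
Proof.
move=> mf f0; rewrite -[LHS]mul1e -[1%E]/(1%:E).
rewrite -(@integral_weighted_pushforward _ _ _ _ _ m _ id (fun x => expR (g x)))//.
- by apply: measurableT_comp => //; exact: measurable_funP.
- by move=> B mB; rewrite mul1e.
Qed.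

(** Completing the square turns exp (c x) times the density centred at 0 into exp (c^2 / 2) times
    the one centred at c. *)
Lemma normal_prob01_mgf (R : realType) (c : R) :
  (\int[normal_prob 0 1]_x (expR (c * x))%:E = (expR (c ^+ 2 / 2))%:E)%E.
Proof.
rewrite -[LHS]mul1e.
rewrite -(@integral_weighted_pushforward _ _ _ _ _ lebesgue_measure _ id (normal_pdf 0 1))//; last 4 first.
- exact: measurable_normal_pdf.
- by move=> x; exact: normal_pdf_ge0.
- by move=> B mB; rewrite mul1e.
- by apply/measurable_EFinP; apply: measurableT_comp => //; exact: mulrl_measurable.
transitivity (\int[lebesgue_measure]_x ((expR (c ^+ 2 / 2))%:E * (normal_pdf c 1 x)%:E))%E.
  apply: eq_integral => x _; rewrite !normal_pdfE ?oner_neq0// /normal_fun -!EFinM.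
  congr EFin; rewrite -mulrA -expRD [RHS]mulrCA -expRD; congr (_ * expR _).
  by rewrite expr1n -[1 *+ 2]/(2 : R); field.
rewrite ge0_integralZl//=; last 2 first.
- by apply/measurable_EFinP; exact: measurable_normal_pdf.
- by move=> x _; rewrite lee_fin normal_pdf_ge0.
by rewrite integral_normal_pdf mule1.
Qed.

Section gaussian_exponentials.
Context d (Omega : measurableType d) (R : realType) (P : probability Omega R).
Context (I : choiceType) (D : set I) (X : I -> {RV P >-> R}).
Hypothesis iid : iid_std_normal D X.

Let event (t : {fset I}) (B : I -> set R) := \bigcap_(i in [set` t]) X i @^-1` B i.

Let measurable_event t B : (forall i, measurable (B i)) -> measurable (event t B).
Proof.
move=> mB; apply: fin_bigcap_measurable => // i _.
by rewrite -[X in measurable X]setTI; exact: measurable_funP.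
Qed.

Let measurable_lin (s : seq I) (c : I -> R) :
  measurable_fun setT (fun w => expR (\sum_(i <- s) c i * X i w)).
Proof.
apply: measurableT_comp => //; apply: measurable_sum => i.
by apply: measurable_funM => //; exact: measurable_funP.
Qed.

(** Independence is a statement about events. Keeping an event in the formula lets the variables
    leave the linear form one by one: [X i] becomes part of the event with an arbitrary set [A], and
    is then integrated against its normal law. *)
Lemma expectation_expR_lin_event (s : seq I) (c : I -> R) (t : {fset I}) (B : I -> set R) :
  uniq s -> [set` s] `<=` D -> [set` t] `<=` D -> (forall i, i \in s -> i \notin t) ->
  (forall i, measurable (B i)) ->
  (\int[P]_(w in event t B) (expR (\sum_(i <- s) c i * X i w))%:E =
   (expR (\sum_(i <- s) c i ^+ 2 / 2))%:E * \big[*%E/1]_(i <- t) P (X i @^-1` B i))%E.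
Proof.
have [ind nrm] := iid.
elim: s t B => [|i s ih] t B us sD tD st mB.
  rewrite big_nil expR0 mul1e; under eq_integral do rewrite big_nil expR0.
  by rewrite integral_cst ?mul1e; [exact: ind|exact: measurable_event].
move: us; rewrite cons_uniq => /andP[iNs us].
have it : i \notin t by apply: st; rewrite mem_head.
have Di : D i by apply: sD; rewrite /= mem_head.
pose E := event t B; have mE : measurable E by exact: measurable_event.
have finP C : measurable C -> P C \is a fin_num by move=> mC; exact: fin_num_measure.
have mXB j C : measurable C -> measurable (X j @^-1` C).
  by move=> mC; rewrite -[X in measurable X]setTI; exact: measurable_funP.
pose pr : \bar R := \big[*%E/1%E]_(j <- t) P (X j @^-1` B j).
have pr0 : (0 <= pr)%E.
  by rewrite /pr; elim/big_ind : _ => // x y x0 y0; rewrite mule_ge0.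
have prfin : pr \is a fin_num.
  rewrite /pr; elim/big_ind : _ => [//|x y|j _]; first exact: fin_numM.
  by apply: finP; exact: mXB.
pose F w := expR (\sum_(j <- s) c j * X j w) * \1_E w.
pose C := expR (\sum_(j <- s) c j ^+ 2 / 2) * fine pr.
(* The image under [X i] of the measure with density [F] is a multiple of the normal law: this is
   the induction hypothesis for the event enlarged by the condition that [X i] lies in [A]. *)
have FB (A : set R) : measurable A -> (\int[P]_(w in X i @^-1` A) (F w)%:E = C%:E * normal_prob 0 1 A)%E.
  move=> mA; pose B' j := if j == i then A else B j.
  have evE : event (i |` t)%fset B' = X i @^-1` A `&` E.
    apply/seteqP; split => [w h|w [h1 h2]].
      split; first by have := h i; rewrite /= !inE eqxx => /(_ isT); rewrite /B' eqxx.
      move=> j /= jt; have := h j; rewrite /= !inE jt orbT => /(_ isT).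
      by rewrite /B' ifN//; apply: contraNneq it => <-.
    move=> j; rewrite /= !inE => /orP[/eqP ->|jt]; first by rewrite /B' eqxx.
    by rewrite /B' ifN//; [exact: h2|apply: contraNneq it => <-].
  have := ih (i |` t)%fset B' us; rewrite evE => h.
  transitivity (\int[P]_(w in X i @^-1` A `&` E) (expR (\sum_(j <- s) c j * X j w))%:E)%E.
    rewrite setIC integral_mkcondl; apply: eq_integral => w _.
    by rewrite /F patchE indicE; case: ifP => _; rewrite ?mulr1 ?mulr0.
  rewrite h.
  - rewrite big_fsetU1//= /B' eqxx -(nrm i Di A mA).
    rewrite (@eq_big_seq _ _ _ _ (enum_fset t) _ (fun j => P (X j @^-1` B j))); last first.
      by move=> j jt /=; rewrite ifN//; apply: contraNneq it => <-.
    by rewrite /C EFinM fineK// -/pr -muleA [(pr * _)%E]muleC.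
  - by move=> j js; apply: sD; rewrite /= inE js orbT.
  - by move=> j; rewrite /= !inE => /orP[/eqP ->//|]; exact: tD.
  - move=> j js; rewrite !inE negb_or; apply/andP; split; last by rewrite st// inE js orbT.
    by apply: contraNneq iNs => <-.
  - by move=> j; rewrite /B'; case: ifP.
have C0 : 0 <= C by rewrite mulr_ge0 ?expR_ge0// fine_ge0.
have mF : measurable_fun setT F.
  by apply: measurable_funM; [exact: measurable_lin|exact: measurable_indic].
transitivity (\int[P]_w ((F w)%:E * (expR (c i * X i w))%:E))%E.
  rewrite integral_mkcond; apply: eq_integral => w _.
  rewrite /F patchE indicE big_cons expRD -EFinM; case: ifP => _; last by rewrite mulr0 mul0r.
  by rewrite mulr1 mulrC.
rewrite (@integral_weighted_pushforward _ _ _ _ _ P (normal_prob 0 1) (X i) F C (fun x => (expR (c i * x))%:E))//.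
- rewrite normal_prob01_mgf /C big_cons expRD !EFinM fineK// -/pr.
  by rewrite muleC muleA.
- by have mXi : measurable_fun setT (X i : Omega -> R) by []; exact: mXi.
- by move=> w; rewrite mulr_ge0 ?expR_ge0.
- by apply/measurable_EFinP; apply: measurableT_comp => //; exact: mulrl_measurable.
Qed.

Lemma expectation_expR_lin (s : seq I) (c : I -> R) :
  uniq s -> [set` s] `<=` D ->
  (\int[P]_w (expR (\sum_(i <- s) c i * X i w))%:E =
   (expR (\sum_(i <- s) c i ^+ 2 / 2))%:E)%E.
Proof.
move=> us sD; have := @expectation_expR_lin_event s c fset0 (fun=> setT) us sD.
rewrite /event /= big_seq_fset0 mule1 (_ : [set` (fset0 : {fset I})] = set0 :> set I); last first.
  by apply/seteqP; split => x //=.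
by rewrite bigcap_set0; apply.
Qed.

End gaussian_exponentials.

(** * Riemann sums on the torus *)

Section torus_continuity.
Context {R : realType} {n : nat}.
Variable g : torus R n -> R.
Hypothesis cg : continuous g.

Let G (x : 'rV[R]_n) := g (torus_proj x).

Let cG : continuous G.
Proof. by move=> x; apply: continuous_comp; [exact: torus_proj_continuous|exact: cg]. Qed.

Let cube : set 'rV[R]_n := [set v | forall k, `[0%R, 1%R]%classic (v ord0 k)].

Let cube_compact : compact cube.
Proof. by apply: (@rV_compact R n (fun=> `[0%R, 1%R]%classic)) => _; exact: segment_compact. Qed.

(** Compactness of the cube confines only [x]; [y] may leave the cube, so points near identified
    faces need no separate treatment. *)
Lemma torus_unif_continuous (e : R) : 0 < e -> exists2 d, 0 < d &
  forall x y : 'rV[R]_n, (forall k, 0 <= x 0 k <= 1) -> (forall k, `|y 0 k - x 0 k| < d) ->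
    `|g (torus_proj x) - g (torus_proj y)| < e.
Proof.
move=> e0; pose P (d : R) (x : 'rV[R]_n) :=
  forall y : 'rV[R]_n, (forall k, `|y 0 k - x 0 k| < d) -> `|G x - G y| < e.
have [] := (@compact_near_coveringP _ cube).1 cube_compact R (0^'+) P _ _.
  move=> x _; have : \forall x' \near x, `|G x - G x'| < e / 2.
    by move: (@cG x) => /cvgrPdist_lt; apply; rewrite divr_gt0.
  move=> /nbhs_ballP[r /= r0 rP].
  exists (ball x (r / 2), [set d | d < r / 2]) => /=.
    split; first by apply: nbhsx_ballx; rewrite divr_gt0.
    by apply: nbhs_right_lt; rewrite divr_gt0.
  move=> [x' d] /= [[_ xx'] dr] y yx'.
  rewrite [e]splitr (le_lt_trans (ler_distD (G x) _ _))// ltrD//.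
    rewrite distrC; apply: rP; split => // i k; apply: lt_le_trans (xx' i k) _.
    by rewrite ler_pdivrMr// ler_pMr// ler1n.
  apply: rP; split => // i k; rewrite ord1 [r]splitr.
  apply: le_lt_trans (ler_distD (x' 0 k) _ _) _; apply: ltrD; first by have := xx' 0 k.
  by rewrite distrC (lt_trans (yx' k)).
move=> d /= d0 dP; exists (d / 2); first by rewrite divr_gt0.
move=> x y x01 xy; apply: (dP (d / 2)) => //=.
- by rewrite sub0r normrN gtr0_norm ?divr_gt0// ltr_pdivrMr// ltr_pMr// ltr1n.
- by rewrite divr_gt0.
Qed.

Lemma torus_proj_cube (x : torus R n) : exists2 y : 'rV[R]_n,
  (forall k, 0 <= y 0 k < 1) & x = torus_proj y.
Proof.
exists (\row_k (repr x 0 k - (Num.floor (repr x 0 k))%:~R)).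
  move=> k; rewrite mxE subr_ge0 Num.Theory.floor_le_tmp/=.
  by rewrite ltrBlDr addrC -[X in _ + X](_ : 1%:~R = 1)// -intrD floorD1_gt.
rewrite -[LHS]reprK; apply/torus_projP/forallP => k.
by rewrite mxE opprB addrC subrK intr_int.
Qed.

Lemma torus_bounded : exists2 M, 0 <= M & forall x, `|g x| <= M.
Proof.
have := continuous_compact (continuous_subspaceT cG) cube_compact.
move=> /compact_bounded[M [_ MP]]; exists (`|M| + 1); first by rewrite addr_ge0.
move=> x; have [y y01 ->] := torus_proj_cube x.
apply: (MP (`|M| + 1)); first by rewrite (le_lt_trans (ler_norm M))// ltrDl.
by exists y => // k; rewrite /= in_itv/=; have /andP[-> /ltW ->] := y01 k.
Qed.

End torus_continuity.

Section riemann_sums.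
Context {R : realType} {n : nat}.
Local Notation MR := (measurableTypeR R).

Lemma lebesgue_cube_prod m (A : 'I_m -> set R) : (forall k, measurable (A k)) ->
  lebesgue_cube R m [set t | forall k, A k (tnth t k)] =
  (\prod_(k < m) uniform_prob (@ltr01 R) (A k))%E.
Proof.
elim: m A => [|m ih] A mA.
  by rewrite big_ord0 /= diracE mem_set//; case.
have mS : measurable [set t : m.-tuple MR | forall k, A (lift ord0 k) (tnth t k)].
  have -> : [set t : m.-tuple MR | forall k, A (lift ord0 k) (tnth t k)] =
     \bigcap_(k in [set: 'I_m]) ((@tnth m MR ^~ k) @^-1` A (lift ord0 k)).
    by apply/seteqP; split => t h k; [move=> _; exact: h|exact: (h k I)].
  apply: fin_bigcap_measurable => [|k _]; first exact: finite_finset.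
  by rewrite -[X in measurable X]setTI; apply: measurable_tnth => //; exact: mA.
rewrite big_ord_recl/= -ih//.
rewrite /distribution /pushforward (_ : _ @^-1` _ = A ord0 `*`
    [set t : m.-tuple MR | forall k, A (lift ord0 k) (tnth t k)]).
  by rewrite product_measure1E//; exact: mA.
apply/seteqP; split => [[x t] h|[x t] [h1 h2] k] /=.
  split => [|k] /=; first by have := h ord0; rewrite /= tnth0.
  by have := h (lift ord0 k); rewrite /= tnthS.
case: (unliftP ord0 k) => [k' ->|->]; first by rewrite tnthS; exact: h2.
by rewrite tnth0.
Qed.

Variable p : nat.
Local Notation N := p.+1.
Local Notation Gr := {ffun 'I_n -> 'I_N}.

Definition grid_cell (j : Gr) : set (n.-tuple MR) :=
  [set t | forall k, `[(j k)%:R / N%:R, (j k).+1%:R / N%:R[%classic (tnth t k : R)].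

Lemma measurable_grid_cell j : measurable (grid_cell j).
Proof.
have -> : grid_cell j = \bigcap_(k in [set: 'I_n]) ((@tnth n MR ^~ k) @^-1`
    `[(j k)%:R / N%:R, (j k).+1%:R / N%:R[%classic).
  by apply/seteqP; split => t h k; [move=> _; exact: h|exact: (h k I)].
apply: fin_bigcap_measurable => [|k _]; first exact: finite_finset.
by rewrite -[X in measurable X]setTI; apply: measurable_tnth => //; exact: measurable_itv.
Qed.

Lemma uniform_prob_itvco (a b : R) : 0 <= a -> a <= b -> b <= 1 ->
  uniform_prob (@ltr01 R) `[a, b[%classic = (b - a)%:E.
Proof.
move=> a0 ab b1; rewrite /uniform_prob.
rewrite (@eq_integral _ _ _ _ _ (cst 1%E)); last first.
  move=> x; rewrite inE/= in_itv/= => /andP[ax xb].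
  by rewrite /uniform_pdf (le_trans a0 ax)/= (ltW (lt_le_trans xb b1)) subr0 invr1.
rewrite integral_cst//= mul1e lebesgue_measure_itv/= lte_fin.
move: ab; rewrite le_eqVlt => /orP[/eqP ->|->]; last by rewrite EFinB.
by rewrite ltxx subrr.
Qed.

Lemma lebesgue_grid_cell j : lebesgue_cube R n (grid_cell j) = (N%:R ^- n)%:E.
Proof.
rewrite (@lebesgue_cube_prod n (fun k => `[(j k)%:R / N%:R, (j k).+1%:R / N%:R[%classic)); last by move=> k; exact: measurable_itv.
rewrite (eq_bigr (fun=> (N%:R^-1)%:E)); last first.
  move=> k _; rewrite uniform_prob_itvco.
  - by congr EFin; rewrite -mulrBl -natrB// subSnn mul1r.
  - by rewrite divr_ge0.
  - by rewrite ler_pM2r ?invr_gt0// ler_nat.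
  - by rewrite ler_pdivrMr// mul1r ler_nat; exact: ltn_ord.
by rewrite prodEFin prodr_const card_ord exprVn.
Qed.

Let D : set (n.-tuple MR) := [set t | forall k, `[0%R, 1%R[%classic (tnth t k : R)].

Let measurable_D : measurable D.
Proof.
have -> : D = \bigcap_(k in [set: 'I_n]) ((@tnth n MR ^~ k) @^-1` `[0%R, 1%R[%classic).
  by apply/seteqP; split => t h k; [move=> _; exact: h|exact: (h k I)].
apply: fin_bigcap_measurable => [|k _]; first exact: finite_finset.
by rewrite -[X in measurable X]setTI; apply: measurable_tnth => //; exact: measurable_itv.
Qed.

(** The half-open cells miss the upper faces of the cube, which are negligible. *)
Let ae_D : {ae lebesgue_cube R n, forall t, D t}.
Proof.
apply/negligibleP; first exact: measurableC.
rewrite (_ : [set x | D x] = D); last by apply/seteqP; split.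
have PD : lebesgue_cube R n D = 1%E.
  rewrite (@lebesgue_cube_prod n (fun=> `[0, 1[%classic)); last by move=> k; exact: measurable_itv.
  by rewrite big1 // => k _; rewrite uniform_prob_itvco ?subr0.
by have := probability_setC (lebesgue_cube R n) measurable_D; rewrite PD subee.
Qed.

Let cell_of t : D t -> exists j, grid_cell j t.
Proof.
move=> Dt; have N0 : 0 < N%:R :> R by [].
have h k : exists i : 'I_N, `[i%:R / N%:R, i.+1%:R / N%:R[%classic (tnth t k : R).
  have := Dt k; rewrite /= in_itv/= => /andP[t0 t1].
  have tn0 : 0 <= tnth t k * N%:R by rewrite mulr_ge0.
  have /andP[l u] := truncn_itv tn0.
  have lN : (Num.truncn (tnth t k * N%:R) < N)%N.
    rewrite -(ltr_nat R); apply: le_lt_trans l _.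
    by rewrite gtr_pMl.
  by exists (Ordinal lN); rewrite /= in_itv/= ler_pdivrMr// l ltr_pdivlMr.
exists [ffun k => projT1 (cid (h k))] => k.
by rewrite ffunE; case: cid.
Qed.

Let cell_uniq t i j : grid_cell i t -> grid_cell j t -> i = j.
Proof.
move=> it jt; apply/ffunP => k; apply/val_inj/eqP; rewrite eqn_leq/=.
have lt_of (u v : nat) (w : R) : u%:R / N%:R <= w -> w < v%:R / N%:R -> (u < v)%N.
  by move=> h1 /(le_lt_trans h1); rewrite ltr_pM2r ?invr_gt0 ?ltr0n// ltr_nat.
have := it k; have := jt k; rewrite /= !in_itv/= => /andP[a1 a2] /andP[b1 b2].
by rewrite -ltnS (lt_of _ _ _ b1 a2) -ltnS (lt_of _ _ _ a1 b2).
Qed.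

(** [g] is compared with the step function [st] that takes on each cell the value at its corner; as
    every cell has measure N^-n, the integral of [st] is exactly the grid average. *)
Lemma riemann_sum_le (g : torus R n -> R) (e : R) : continuous g -> 0 <= e ->
  (forall j t, grid_cell j t ->
     `|g (torus_proj (\row_k tnth t k)) - g (torus_proj (gridpt j))| <= e) ->
  `|\int[lebesgue_torus R n]_x g x - avg (fun j : Gr => g (torus_proj (gridpt j)))| <= e.
Proof.
move=> cg e0 ge; have [M M0 gM] := torus_bounded cg.
have mg := torus_continuous_measurable cg.
pose P := lebesgue_cube R n.
pose h (t : n.-tuple MR) : R := g (cube_torus t).
have mh : measurable_fun setT h.
  by apply: measurableT_comp mg _; exact: measurable_cube_torus.
have bint (u : n.-tuple MR -> R) K : measurable_fun setT u -> (forall t, `|u t| <= K) ->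
    P.-integrable setT (EFin \o u).
  move=> mu uK; apply: measurable_bounded_integrable => //.
    by rewrite [X in (X < _)%E](_ : _ = 1%E) ?ltry//; exact: probability_setT.
  exists K; split; first exact: num_real.
  by move=> x Kx t _; exact: (le_trans (uK t) (ltW Kx)).
have ih : P.-integrable setT (EFin \o h) by apply: (bint _ M) => // t; exact: gM.
have -> : \int[lebesgue_torus R n]_x g x = \int[P]_t h t.
  rewrite /Rintegral /lebesgue_torus integral_pushforward//.
  - exact/measurable_EFinP.
pose st (t : n.-tuple MR) : R := \sum_(j : Gr) g (torus_proj (gridpt j)) * \1_(grid_cell j) t.
have ii j : P.-integrable setT (fun t => (g (torus_proj (gridpt j)) * \1_(grid_cell j) t)%:E).
  apply: (bint _ M).
    by apply: measurable_funM => //; apply: measurable_indic; exact: measurable_grid_cell.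
  move=> t; rewrite normrM indicE; case: (_ \in _); rewrite ?normr1 ?mulr1// normr0 mulr0//.
have stE : \int[P]_t st t = avg (fun j : Gr => g (torus_proj (gridpt j))).
  rewrite /Rintegral /st; under eq_integral do rewrite -sumEFin.
  rewrite integral_sum// (eq_bigr (fun j => (N%:R ^- n * g (torus_proj (gridpt j)))%:E)).
    by rewrite sumEFin /= /avg mulr_sumr.
  move=> j _; under eq_integral do rewrite EFinM.
  rewrite integralZl//=.
    rewrite integral_indic//; last exact: measurable_grid_cell.
    by rewrite setIT [X in (_ * X)%E](_ : _ = (N%:R ^- n)%:E) -?EFinM 1?mulrC//; exact: lebesgue_grid_cell.
  apply: (bint _ 1); first by apply: measurable_indic; exact: measurable_grid_cell.
  by move=> t; rewrite indicE; case: (_ \in _); rewrite ?normr1 ?normr0.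
have ist : P.-integrable setT (EFin \o st).
  rewrite (_ : _ \o _ = fun t => \sum_(j : Gr) (g (torus_proj (gridpt j)) * \1_(grid_cell j) t)%:E)%E; last first.
    by apply/funext => t /=; rewrite sumEFin.
  by apply: integrable_sum.
rewrite -stE -RintegralB//.
have ihs : P.-integrable setT (EFin \o (fun t => h t - st t)).
  exact: (integrableB measurableT ih ist).
rewrite -lee_fin; apply: (@le_trans _ _ (`|\int[P]_t (h t - st t)%:E|)%E).
  by rewrite -fine_abse ?fineK// ?abse_fin_num// integrable_fin_num.
have mhs : measurable_fun setT (fun t => (h t - st t)%:E) by case/integrableP : ihs.
apply: le_trans (le_abse_integral _ _ mhs) _ => //.
apply: (@le_trans _ _ (\int[P]_t e%:E)%E); last first.
  rewrite integral_cst// [X in (_ * X)%E](_ : _ = 1%E) ?mule1//; exact: probability_setT.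
apply: ae_ge0_le_integral => //.
- exact: measurableT_comp.
- have [A [mA PA sub]] := ae_D; exists A; split => // t nt; apply: sub => Dt; apply: nt => _.
  rewrite lee_fin; have [j jt] := cell_of Dt.
  rewrite /st (bigD1 j)//= big1 ?addr0 => [|i ij].
    by rewrite indicE mem_set// mulr1; exact: ge.
  rewrite indicE memNset ?mulr0// => it; move/eqP : ij; apply; exact: cell_uniq it jt.
Qed.

End riemann_sums.

Lemma riemann_torus {R : realType} {n : nat} (g : torus R n -> R) : continuous g ->
  avg (fun j : {ffun 'I_n -> 'I_p.+1} => g (torus_proj (gridpt j))) @[p --> \oo] -->
  \int[lebesgue_torus R n]_x g x.
Proof.
move=> cg; apply/cvgrPdist_le => e e0.
have [d d0 dP] := torus_unif_continuous cg e0.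
near=> p; apply: riemann_sum_le => //; first exact: ltW.
move=> j t jt; rewrite distrC; apply/ltW/dP => k; rewrite !mxE.
  rewrite divr_ge0//= ler_pdivrMr ?ltr0n// mul1r ler_nat ltnW//; exact: ltn_ord.
have := jt k; rewrite /= in_itv/= => /andP[a b].
rewrite ger0_norm ?subr_ge0// ltrBlDl (lt_le_trans b)//.
rewrite -natr1 mulrDl lerD2l mul1r ltW//.
by near: p; exact: near_infty_natSinv_lt (PosNum d0).
Unshelve. all: by end_near. Qed.

(** * Second moments on the grid *)

Section lqg_exponent_grid.
Context {R : realType} {n : nat}.
Variables (H : set 'rV[int]_n) (gamma : R).
Hypothesis (H_half : half_lattice H).
Implicit Types (z : 'rV[int]_n) (x y : 'rV[R]_n) (lam b c : 'rV[int]_n -> R) (q : 'rV[int]_n -> R).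

Lemma zboxE m : zbox R m.*2.+1 = [set z : 'rV[int]_n | inbox m z].
Proof.
apply/seteqP; split => z /=.
  move=> zm; apply/forallP => k; have := zm k; rewrite -intr_norm ltr_pdivlMr//.
  by rewrite -[2]/(2%:~R) -intrM -[m.*2.+1%:R]/(m.*2.+1%:~R) ltr_int; lia.
move=> /forallP zm k; have := zm k; rewrite -intr_norm ltr_pdivlMr//.
by rewrite -[2]/(2%:~R) -intrM -[m.*2.+1%:R]/(m.*2.+1%:~R) ltr_int; lia.
Qed.

(** Turning cutoffs into indicators on a common box makes fields with different cutoffs sums over
    the same index set. *)
Lemma fsbig_zbox m k (F : 'rV[int]_n -> R) : (m <= k)%N ->
  \sum_(z \in zbox R m.*2.+1 `\ 0) F z =
  \sum_(z <- box_seq k | z != 0) F z * (inbox m z)%:R.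
Proof.
move=> mk; have fz : finite_set (zbox R m.*2.+1 `\ 0 : set 'rV[int]_n).
  by apply: finite_setD; exact: finite_zbox.
rewrite (fsbig_finite _ _ fz)/=.
rewrite (perm_big [seq z <- box_seq k | (z != 0) && inbox m z]); last first.
  apply: uniq_perm; rewrite ?filter_uniq ?box_seq_uniq ?fset_uniq// => z.
  rewrite in_fset_set// mem_filter mem_box_seq zboxE.
  apply/idP/idP => [/set_mem[/= zm /eqP z0]|/andP[/andP[/eqP z0 zm] _]].
    by rewrite z0 zm (inboxW mk zm).
  by apply: mem_set; split.
rewrite big_filter big_mkcondr/=; apply: eq_bigr => z _.
by case: ifP; rewrite ?mulr1 ?mulr0.
Qed.

(** Exactly one of [z] and [- z] lies in [H], so the pair contributes cos cos + sin sin, a function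
    of x - y, which a single product is not. *)
Lemma fourier_basis_pair z x y : z != 0 ->
  fourier_basis H z x * fourier_basis H z y +
  fourier_basis H (- z) x * fourier_basis H (- z) y = 2 * wave z (x - y).
Proof.
move=> z0; have [HU HI] := H_half.
have zN0 : - z != 0 by rewrite oppr_eq0.
have HN : (- z \in H) = ~~ (z \in H).
  apply/idP/idP => [zNH|zH].
    apply/negP => zH; suff : set0 z by [].
    rewrite -HI; split; first exact: set_mem.
    by exists (- z); [exact: set_mem|rewrite opprK].
  have : (H `|` [set - w | w in H]) z by rewrite HU => /= z00; rewrite z00 eqxx in z0.
  case=> [zH'|[w wH wz]]; first by rewrite mem_set in zH.
  by rewrite -wz opprK mem_set.
have s2 : Num.sqrt 2 * Num.sqrt 2 = 2 :> R by rewrite -expr2 sqr_sqrtr.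
rewrite /fourier_basis (negbTE z0) (negbTE zN0) HN /wave !zdotNl !mulrN.
rewrite (_ : 2 * pi * zdot z (x - y) = 2 * pi * zdot z x - 2 * pi * zdot z y).
  rewrite cosB; move: (2 * pi * zdot z x) (2 * pi * zdot z y) => u v.
  by case: (z \in H) => /=; rewrite ?sinN ?cosN; ring: s2.
by rewrite zdotDr zdotNr mulrBr.
Qed.

Lemma fourier_basis_bound z x : `|fourier_basis H z x| <= Num.sqrt 2.
Proof.
have s1 : 1 <= Num.sqrt 2 :> R by rewrite -[leLHS]sqrtr1 ler_wsqrtr// ler1n.
have s0 : 0 <= Num.sqrt 2 :> R by exact: sqrtr_ge0.
rewrite /fourier_basis; case: eqP => _; first by rewrite normr1.
by case: ifP => _; rewrite normrM (ger0_norm s0) ler_piMr// ler_norml ?cos_geN1 ?cos_le1 ?sin_geN1 ?sin_le1.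
Qed.

Lemma sum_fourier_basis k c x y : (forall z, c (- z) = c z) ->
  \sum_(z <- box_seq k | z != 0) c z * (fourier_basis H z x * fourier_basis H z y) =
  \sum_(z <- box_seq k | z != 0) c z * wave z (x - y).
Proof.
move=> cN; set S := LHS.
have SN : S = \sum_(z <- box_seq k | z != 0) c z * (fourier_basis H (- z) x * fourier_basis H (- z) y).
  rewrite /S -(perm_big _ (box_seqN k)) big_map.
  by apply: eq_big => [z|z _]; rewrite ?oppr_eq0 ?cN.
have : S + S = 2 * \sum_(z <- box_seq k | z != 0) c z * wave z (x - y).
  rewrite {2}SN -big_split/= mulr_sumr; apply: eq_bigr => z z0.
  by rewrite -mulrDr fourier_basis_pair// mulrCA.
by move=> h; lra.
Qed.

(** [k] only fixes the enumeration; the cutoff is part of the amplitude [b]. For even [b] the second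
    sum is the variance of the first, independent of [x]. *)
Definition field_exponent b k q x : R :=
  gamma * (\sum_(z <- box_seq k | z != 0) b z * q z * fourier_basis H z x)
    - gamma ^+ 2 / 2 * \sum_(z <- box_seq k | z != 0) b z ^+ 2.

Definition amplitude lam m z : R :=
  (Num.sqrt (lqg_const R n))^-1 * lam z `^ (- (n%:R / 4)) * (inbox m z)%:R.

Hypothesis n_gt0 : (0 < n)%N.

Lemma amplitude_sqr lam m z : amplitude lam m z ^+ 2 =
  (lqg_const R n)^-1 * lam z `^ (- (n%:R / 2)) * (inbox m z)%:R.
Proof.
have c0 := @lqg_const_gt0 R n n_gt0.
rewrite /amplitude !exprMn exprVn sqr_sqrtr ?(ltW c0)//; congr (_ * _ * _); last first.
  by case: inbox; rewrite ?expr1n ?expr0n.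
rewrite expr2 -powRD; first by congr powR; field.
by apply/implyP => /eqP h; have : 0 < n%:R :> R by [rewrite ltr0n|]; lra.
Qed.

Lemma amplitudeN lam m : (forall z, lam (- z) = lam z) ->
  forall z, amplitude lam m (- z) = amplitude lam m z.
Proof. by move=> lamN z; rewrite /amplitude lamN inboxN. Qed.

Lemma lqg_exponent_proj lam m k q x : (m <= k)%N ->
  lqg_exponent H gamma lam m.*2.+1 q (torus_proj x) =
  field_exponent (amplitude lam m) k q x.
Proof.
move=> mk; rewrite /lqg_exponent /field_exponent /log_field /log_cov !(fsbig_zbox _ mk).
congr (_ * _ - _ * _); rewrite mulr_sumr; apply: eq_bigr => z _.
  rewrite /amplitude (fourier_basis_lattice H z (lattice_eq_repr x)).
  by move: (inbox m z)%:R => I; ring.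
rewrite amplitude_sqr subrr /zdot big1 => [|i _]; last by rewrite mxE mulr0.
by rewrite mulr0 cos0 mulr1 mulrA.
Qed.

End lqg_exponent_grid.

Section second_moment.
Context d (Omega : measurableType d) (R : realType) (P : probability Omega R).
Context (n : nat) (H : set 'rV[int]_n) (gamma : R) (xi : 'rV[int]_n -> {RV P >-> R}).
Hypothesis H_half : half_lattice H.
Hypothesis xi_iid : iid_std_normal (~` [set 0]) xi.
Implicit Types (z : 'rV[int]_n) (x y : 'rV[R]_n) (b : 'rV[int]_n -> R).

Definition field_density b k x (w : Omega) : R :=
  expR (field_exponent H gamma b k (fun z => xi z w) x).

Lemma measurable_field_density b k x : measurable_fun setT (field_density b k x).
Proof.
apply: measurableT_comp => //; apply: measurable_funB => //; apply: measurable_funM => //.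
rewrite [X in measurable_fun _ X](_ : _ = fun w =>
  \sum_(z <- [seq z <- box_seq k | z != 0]) b z * xi z w * fourier_basis H z x); last first.
  by apply/funext => w; rewrite big_filter.
by apply: measurable_sum => z; apply: measurable_funM => //; apply: measurable_funM.
Qed.

Lemma field_density_ge0 b k x w : 0 <= field_density b k x w.
Proof. exact: expR_ge0. Qed.

(** Half the variance of the sum of the two Gaussian fields splits into two diagonal parts, which
    after symmetrization in z cancel the normalizations [A] and [B], and the covariance, which
    survives. *)
Lemma expectation_field_densityM b b' k x y :
  (forall z, b (- z) = b z) -> (forall z, b' (- z) = b' z) ->
  (\int[P]_w (field_density b k x w * field_density b' k y w)%:E =
  (expR (gamma ^+ 2 * \sum_(z <- box_seq k | z != 0%R) (b z * b' z) * wave z (x - y)))%:E)%E.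
Proof.
move=> bN b'N; pose s := [seq z <- @box_seq n k | z != 0].
pose c z := gamma * (b z * fourier_basis H z x + b' z * fourier_basis H z y).
pose A := gamma ^+ 2 / 2 * \sum_(z <- box_seq k | z != 0) b z ^+ 2.
pose B := gamma ^+ 2 / 2 * \sum_(z <- box_seq k | z != 0) b' z ^+ 2.
transitivity (\int[P]_w ((expR (- (A + B)))%:E * (expR (\sum_(z <- s) c z * xi z w))%:E))%E.
  apply: eq_integral => w _; rewrite -EFinM -!expRD; congr (EFin (expR _)).
  rewrite /field_exponent -/A -/B /s big_filter.
  have -> : \sum_(z <- box_seq k | z != 0) c z * xi z w =
     gamma * (\sum_(z <- box_seq k | z != 0) b z * xi z w * fourier_basis H z x) +
     gamma * (\sum_(z <- box_seq k | z != 0) b' z * xi z w * fourier_basis H z y).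
    by rewrite !mulr_sumr -big_split/=; apply: eq_bigr => z _; rewrite /c; ring.
  by ring.
rewrite ge0_integralZl//=; last first.
  apply/measurable_EFinP; apply: measurableT_comp => //; apply: measurable_sum => z.
  by apply: measurable_funM.
rewrite (expectation_expR_lin xi_iid); last 2 first.
- by rewrite filter_uniq// box_seq_uniq.
- by move=> z /=; rewrite mem_filter => /andP[/eqP z0 _].
rewrite -EFinM -expRD; congr (EFin (expR _)).
have E x' y' b1 b2 : (forall z, b1 (- z) = b1 z) -> (forall z, b2 (- z) = b2 z) ->
    \sum_(z <- box_seq k | z != 0) (b1 z * b2 z) * (fourier_basis H z x' * fourier_basis H z y') =
    \sum_(z <- box_seq k | z != 0) (b1 z * b2 z) * wave z (x' - y').
  by move=> h1 h2; apply: sum_fourier_basis => // z; rewrite h1 h2.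
have E0 b1 x' : (forall z, b1 (- z) = b1 z) ->
    \sum_(z <- box_seq k | z != 0) (b1 z * b1 z) * (fourier_basis H z x' * fourier_basis H z x') =
    \sum_(z <- box_seq k | z != 0) b1 z ^+ 2.
  by move=> h1; rewrite E//; apply: eq_bigr => z _; rewrite subrr wave0r mulr1 expr2.
rewrite /A /B -(E0 b x bN) -(E0 b' y b'N) -(E x y b b' bN b'N).
have -> : \sum_(z <- s) c z ^+ 2 / 2 = \sum_(z <- box_seq k | z != 0)
  (gamma ^+ 2 / 2 * (b z * b z * (fourier_basis H z x * fourier_basis H z x)) +
  (gamma ^+ 2 / 2 * (b' z * b' z * (fourier_basis H z y * fourier_basis H z y)) +
   gamma ^+ 2 * (b z * b' z * (fourier_basis H z x * fourier_basis H z y)))).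
  by rewrite /s big_filter; apply: eq_bigr => z _; rewrite /c; field.
by rewrite !big_split/= -!mulr_sumr; ring.
Qed.

End second_moment.

Section moments.
Context d (T : measurableType d) (R : realType) (P : {measure set T -> \bar R}).

Lemma integral_sqr_lincomb (Q : finType) (u : Q -> R) (X : Q -> T -> R) (E : Q -> Q -> R) :
  (forall q, measurable_fun setT (X q)) -> (forall q w, 0 <= X q w) ->
  (forall q q', \int[P]_w (X q w * X q' w)%:E = (E q q')%:E)%E ->
  (\int[P]_w ((\sum_q u q * X q w) ^+ 2)%:E =
   (\sum_q \sum_q' u q * u q' * E q q')%:E)%E.
Proof.
move=> mX X0 XE.
have iX q q' : P.-integrable setT (fun w => (X q w * X q' w)%:E).
  apply/integrableP; split; first by apply/measurable_EFinP; exact: measurable_funM.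
  by under eq_integral do rewrite gee0_abs ?lee_fin ?mulr_ge0//; rewrite XE ltry.
transitivity (\int[P]_w \sum_(p : Q * Q) ((u p.1 * u p.2)%:E * (X p.1 w * X p.2 w)%:E))%E.
  apply: eq_integral => w _.
  rewrite (eq_bigr (fun p => (u p.1 * u p.2 * (X p.1 w * X p.2 w))%:E)) => [|p _]; last by rewrite -EFinM.
  rewrite sumEFin -(pair_bigA _ (fun q q' => u q * u q' * (X q w * X q' w)))/=.
  rewrite expr2 mulr_suml; congr EFin; apply: eq_bigr => q _.
  by rewrite mulr_sumr; apply: eq_bigr => q' _; ring.
rewrite integral_sum//; last by move=> p; exact: integrableZl.
rewrite (eq_bigr (fun p => (u p.1 * u p.2 * E p.1 p.2)%:E)); last first.
  by move=> p _; rewrite integralZl// XE.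
by rewrite sumEFin -(pair_bigA _ (fun q q' => u q * u q' * E q q')).
Qed.

(** Integrates |x| <= t/2 + x^2/(2t); optimizing over t would give the Cauchy-Schwarz bound. *)
Lemma integral_abs_le_sqr (X : T -> R) (B t : R) : P setT = 1%E -> measurable_fun setT X ->
  0 < t -> (\int[P]_w (X w ^+ 2)%:E <= B%:E)%E ->
  (\int[P]_w `|X w|%:E <= ((t + B / t) / 2)%:E)%E.
Proof.
move=> P1 mX t0 XB.
have mX2 : measurable_fun setT (fun w => (X w ^+ 2)%:E).
  by apply/measurable_EFinP; exact: measurable_funX.
apply: (@le_trans _ _ (\int[P]_w ((t / 2)%:E + (2 * t)^-1%:E * (X w ^+ 2)%:E))%E).
  apply: ge0_le_integral => //.
  - by apply/measurable_EFinP; apply: measurableT_comp.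
  - by apply: emeasurable_funD => //; exact: measurable_funeM.
  - move=> w _; rewrite -EFinM -EFinD lee_fin.
    rewrite -[X w ^+ 2]real_normK ?num_real// -(@ler_pM2l _ (2 * t)) ?mulr_gt0//.
    have -> : 2 * t * (t / 2 + (2 * t)^-1 * `|X w| ^+ 2) = t ^+ 2 + `|X w| ^+ 2.
      by field; rewrite gt_eqF.
    by have := sqr_ge0 (t - `|X w|); nra.
have i0 : 0 <= (2 * t)^-1 by rewrite invr_ge0 mulr_ge0// ltW.
rewrite ge0_integralD//; last 3 first.
- by move=> w _; rewrite lee_fin divr_ge0// ltW.
- by move=> w _; rewrite -EFinM lee_fin mulr_ge0// sqr_ge0.
- exact: measurable_funeM.
rewrite integral_cst// P1 mule1 ge0_integralZl//; last first.
  by move=> w _; rewrite lee_fin sqr_ge0.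
apply: (@le_trans _ _ ((t / 2)%:E + (2 * t)^-1%:E * B%:E)%E).
  by rewrite leeD2l//; exact: lee_wpmul2l.
rewrite -EFinM -EFinD lee_fin le_eqVlt; apply/orP; left; apply/eqP.
by field; rewrite gt_eqF.
Qed.

End moments.

Section grid_second_moment.
Context d (Omega : measurableType d) (R : realType) (P : probability Omega R).
Context (n : nat) (H : set 'rV[int]_n) (gamma : R) (xi : 'rV[int]_n -> {RV P >-> R}).
Hypothesis H_half : half_lattice H.
Hypothesis xi_iid : iid_std_normal (~` [set 0]) xi.
Implicit Types (z : 'rV[int]_n) (b : 'rV[int]_n -> R).

Definition grid_lqg b k (v : {ffun 'I_n -> 'I_k.*2.+1} -> R) (w : Omega) : R :=
  avg (fun j => v j * field_density H gamma xi b k (gridpt j) w).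

Lemma measurable_grid_lqg b k v : measurable_fun setT (@grid_lqg b k v).
Proof.
apply: measurable_funM => //; apply: measurable_sum => j.
by apply: measurable_funM => //; exact: measurable_field_density.
Qed.

(** The condition b b' = b'^2 says that b' is b restricted to some frequencies. Three of the four
    covariances of the difference are then the low-frequency one, and their combination is [T]. It
    depends on i - j only, so the double average reduces to a single one. *)
Lemma expectation_grid_lqg_sqr b b' k (v : {ffun 'I_n -> 'I_k.*2.+1} -> R) M :
  (forall z, b (- z) = b z) -> (forall z, b' (- z) = b' z) ->
  (forall z, b z * b' z = b' z ^+ 2) -> (forall j, `|v j| <= M) ->
  (\int[P]_w ((grid_lqg b v w - grid_lqg b' v w) ^+ 2)%:E <=
   (M ^+ 2 * avg (fun j => `|expR (gamma ^+ 2 * @grid_kernel R n k (fun z => b z ^+ 2) (fun z => z != 0%R) j) -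
      expR (gamma ^+ 2 * grid_kernel (fun z => b' z ^+ 2) (fun z => z != 0%R) j)|))%:E)%E.
Proof.
move=> bN b'N bb' vM.
pose G := {ffun 'I_n -> 'I_k.*2.+1}.
pose N : R := k.*2.+1%:R ^- n.
pose bs (e : bool) := if e then b' else b.
have bsN e z : bs e (- z) = bs e z by case: e; [exact: b'N|exact: bN].
(* The difference becomes one linear combination over points and booleans, the boolean carrying the
   sign. *)
pose u (q : G * bool) := N * v q.1 * (-1) ^+ q.2.
pose X (q : G * bool) := field_density H gamma xi (bs q.2) k (gridpt q.1).
pose E (q q' : G * bool) := expR (gamma ^+ 2 * \sum_(z <- box_seq k | z != 0)
   (bs q.2 z * bs q'.2 z) * wave z (gridpt q.1 - gridpt q'.1)).
pose T j := expR (gamma ^+ 2 * @grid_kernel R n k (fun z => b z ^+ 2) (fun z => z != 0%R) j) -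
      expR (gamma ^+ 2 * grid_kernel (fun z => b' z ^+ 2) (fun z => z != 0%R) j).
have XW w : grid_lqg b v w - grid_lqg b' v w = \sum_q u q * X q w.
  rewrite -(pair_bigA _ (fun i e => u (i, e) * X (i, e) w))/=.
  rewrite /grid_lqg /avg -mulrBr -sumrB mulr_sumr; apply: eq_bigr => j _.
  rewrite big_bool /u /X /= expr1 expr0 /N; ring.
under eq_integral do rewrite XW.
rewrite (@integral_sqr_lincomb _ _ _ P _ u X E); last 3 first.
- by move=> q; exact: measurable_field_density.
- by move=> q w; exact: field_density_ge0.
- by move=> q q'; apply: expectation_field_densityM => // z; exact: bsN.
rewrite lee_fin.
have EE (i j : G) : E (i, false) (j, false) - E (i, false) (j, true) -
   E (i, true) (j, false) + E (i, true) (j, true) = T (i - j).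
  have EG e e' c : (forall z, bs e z * bs e' z = c z) ->
      E (i, e) (j, e') = expR (gamma ^+ 2 * grid_kernel c (fun z => z != 0%R) (i - j)).
    move=> cE; rewrite /E /grid_kernel; congr (expR (_ * _)); apply: eq_bigr => z _ /=.
    by rewrite cE wave_gridptB.
  rewrite /T (EG _ _ (fun z => b z ^+ 2)); last by move=> z; rewrite expr2.
  rewrite !(EG _ _ (fun z => b' z ^+ 2)) ?addrNK// => z /=;
    by [exact: bb'|rewrite mulrC; exact: bb'|rewrite expr2].
have -> : \sum_q \sum_q' u q * u q' * E q q' =
    \sum_(i : G) \sum_(j : G) N ^+ 2 * (v i * v j * T (i - j)).
  rewrite -(pair_bigA _ (fun i e => \sum_q' u (i, e) * u q' * E (i, e) q'))/=.
  apply: eq_bigr => i _; rewrite big_bool/=.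
  rewrite -!(pair_bigA _ (fun j e' => u (i, _) * u (j, e') * E (i, _) (j, e')))/=.
  rewrite -big_split/=; apply: eq_bigr => j _; rewrite !big_bool -EE /u /= expr1 expr0.
  by ring.
apply: (@le_trans _ _ (\sum_(i : G) \sum_(j : G) N ^+ 2 * (M ^+ 2 * `|T (i - j)|))).
  apply: ler_sum => i _; apply: ler_sum => j _; rewrite ler_wpM2l ?sqr_ge0//.
  rewrite (le_trans (ler_norm _))// !normrM expr2 ler_wpM2r//.
  by apply: ler_pM.
rewrite exchange_big/= /avg -/N mulrCA !mulr_sumr.
rewrite (eq_bigr (fun=> N ^+ 2 * (M ^+ 2 * \sum_j `|T j|))); last first.
  move=> j _; rewrite -!mulr_sumr; congr (_ * (_ * _)).
  by rewrite [RHS](reindex_inj (addIr (- j))).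
rewrite sumr_const card_ffun !card_ord -[X in X <= _]mulr_natr natrX le_eqVlt; apply/orP; left; apply/eqP.
rewrite -!mulr_sumr /T /N; set S := \sum_j _.
have : k.*2.+1%:R ^+ n != 0 :> R by rewrite expf_neq0// pnatr_eq0.
by move: (_ ^+ n) => K K0; field.
Qed.

End grid_second_moment.

Lemma eigenvalue_gridN (R : realType) n N (z : 'rV[int]_n) :
  eigenvalue_grid R N (- z) = eigenvalue_grid R N z.
Proof.
congr (_ * _); apply: eq_bigr => k _.
by rewrite mxE mulrNz mulrN mulNr sinN sqrrN.
Qed.

Lemma eigenvalue_torusN (R : realType) n (z : 'rV[int]_n) :
  eigenvalue_torus R (- z) = eigenvalue_torus R z.
Proof.
rewrite !eigenvalue_torusE; congr (_ * _); apply: eq_bigr => k _.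
by rewrite mxE mulrNz sqrrN.
Qed.

Section grid_lqg_tail.
Context d (Omega : measurableType d) (R : realType) (P : probability Omega R).
Context (n : nat) (H : set 'rV[int]_n) (gamma : R) (xi : 'rV[int]_n -> {RV P >-> R}).
Hypothesis H_half : half_lattice H.
Hypothesis xi_iid : iid_std_normal (~` [set 0]) xi.
Hypothesis n_gt0 : (0 < n)%N.
Hypothesis gamma_n : 2 * gamma ^+ 2 < n%:R.
Implicit Types (z : 'rV[int]_n) (b lam : 'rV[int]_n -> R).

(** Grid size [k] and cutoff [m] are decoupled: m = k gives the discrete measure, while fixed m with
    k tending to infinity gives Riemann sums for the continuous one. With second moment O (s^J), the
    choice t = s^(J/2) in [integral_abs_le_sqr] bounds the first moment by O (s^(J/2)). *)
Lemma grid_lqg_tail : exists C s : R, [/\ 0 <= C, 0 < s < 1 &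
  forall k m lam J (v : {ffun 'I_n -> 'I_k.*2.+1} -> R) M,
  (forall z, lam (- z) = lam z) ->
  (forall z, z \in box_seq k -> z != 0 -> eigenvalue_grid R k.*2.+1 z <= lam z) ->
  ((2 ^ J).-1 <= m)%N -> (forall j, `|v j| <= M) ->
  (\int[P]_w `|grid_lqg H gamma xi (amplitude lam m) v w -
               grid_lqg H gamma xi (amplitude lam (2 ^ J).-1) v w|%:E
   <= (C * (1 + M ^+ 2) * s ^+ J)%:E)%E].
Proof.
have [C0 [C00 CP]] := lqg_coef_bounds n_gt0 (R := R).
have [K [s [K0 /andP[s0 s1] KP]]] := avg_expR_kernel_tail (sqr_ge0 gamma) C00 gamma_n.
have c0 := @lqg_const_gt0 R n n_gt0.
exists (1 + K), (Num.sqrt s); split; first by rewrite addr_ge0.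
  by rewrite sqrtr_gt0 s0/= -sqrtr1 ltr_sqrt.
move=> k m lam J v M lamN lamP Jm vM.
set b := amplitude lam m; set b' := amplitude lam (2 ^ J).-1.
have bN z : b (- z) = b z by exact: amplitudeN.
have b'N z : b' (- z) = b' z by exact: amplitudeN.
have bb' z : b z * b' z = b' z ^+ 2.
  rewrite /b /b' /amplitude; case zJ : (inbox (2 ^ J).-1 z); last by rewrite !mulr0 expr0n.
  by rewrite (inboxW Jm zJ) !mulr1 expr2.
have [h1 h2] := CP k lam lamP.
have a0 z : 0 <= (lqg_const R n)^-1 * lam z `^ (- (n%:R / 2)).
  by rewrite mulr_ge0 ?invr_ge0 ?(ltW c0)// powR_ge0.
have ale z : b z ^+ 2 <= (lqg_const R n)^-1 * lam z `^ (- (n%:R / 2)).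
  by rewrite amplitude_sqr//; case: inbox; rewrite ?mulr1// mulr0.
have g1 J' : \sum_(z <- box_seq k | dyadic_box J' z) b z ^+ 2 <= 2 * ln 2 * J'%:R + C0.
  by apply: le_trans (h1 J'); apply: ler_sum => z _; exact: ale.
have g2 J' z : z \in box_seq k -> ~~ inbox (2 ^ J').-1 z -> b z ^+ 2 <= C0 * 2 ^- n ^+ J'.
  by move=> zk zJ; apply: le_trans (h2 J' z zk zJ); exact: ale.
have KJ := KP k (fun z => b z ^+ 2) (fun z => sqr_ge0 _) g1 g2 J.
have KE j : grid_kernel (fun z => b z ^+ 2) (@dyadic_box n J) j =
    @grid_kernel R n k (fun z => b' z ^+ 2) (fun z => z != 0%R) j.
  rewrite /grid_kernel big_mkcondr/=; apply: eq_bigr => z _.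
  rewrite /b /b' !amplitude_sqr//; case: ifPn => [zJ|_]; last by rewrite mulr0 mul0r.
  by rewrite (inboxW Jm zJ).
have h := expectation_grid_lqg_sqr gamma H_half xi_iid bN b'N bb' vM.
have sJ0 : 0 < Num.sqrt s ^+ J by rewrite exprn_gt0// sqrtr_gt0.
have mX : measurable_fun setT (fun w => grid_lqg H gamma xi b v w - grid_lqg H gamma xi b' v w).
  by apply: measurable_funB; exact: measurable_grid_lqg.
have h' : (\int[P]_w ((grid_lqg H gamma xi b v w - grid_lqg H gamma xi b' v w) ^+ 2)%:E <=
    (M ^+ 2 * (K * s ^+ J))%:E)%E.
  apply: le_trans h _; rewrite lee_fin ler_wpM2l ?sqr_ge0//.
  by apply: le_trans KJ; rewrite le_eqVlt; apply/orP; left; apply/eqP/eq_avg => j; rewrite KE.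
have h3 := integral_abs_le_sqr (probability_setT P) mX sJ0 h'.
apply: le_trans h3 _; rewrite lee_fin.
have -> : s ^+ J = Num.sqrt s ^+ J * Num.sqrt s ^+ J.
  by rewrite -exprMn -expr2 sqr_sqrtr// ltW.
have -> : (Num.sqrt s ^+ J + M ^+ 2 * (K * (Num.sqrt s ^+ J * Num.sqrt s ^+ J)) / Num.sqrt s ^+ J) / 2 =
   ((1 + M ^+ 2 * K) / 2) * Num.sqrt s ^+ J by field; rewrite gt_eqF.
rewrite ler_wpM2r ?(ltW sJ0)// ler_pdivrMr//.
have := sqr_ge0 M; nra.
Qed.

End grid_lqg_tail.

(** * Integrals against densities and a form of Fatou's lemma *)

Section integral_limits.
Context d (T : measurableType d) (R : realType).

Lemma integral_exp_density (m : {measure set T -> \bar R}) (g : {mfun T >-> R}) (f : T -> R) :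
  measurable_fun setT f ->
  (\int[exp_density m g]_x (f x)%:E = \int[m]_x (f x * expR (g x))%:E)%E.
Proof.
move=> mf; rewrite [LHS]integralE [RHS]integralE.
have mEf : measurable_fun setT (EFin \o f) by exact/measurable_EFinP.
rewrite !ge0_integral_exp_density//; [|exact: measurable_funeneg|exact: measurable_funepos].
congr (_ - _)%E; apply: eq_integral => x _.
  by rewrite !funeposE -EFin_max -EFinM -EFin_max mulrC maxr_pMl ?expR_ge0// mul0r.
by rewrite !funenegE -!EFinN -!EFin_max -EFinM mulrC maxr_pMl ?expR_ge0// mul0r mulNr.
Qed.

(** The bound is asked from [k0] on because a cutoff m is compared with 2^J - 1 only once it reaches
    that value. *)
Lemma fatou_le (P : {measure set T -> \bar R}) (u_ : (T -> \bar R)^nat) (u : T -> \bar R)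
    (B : \bar R) (k0 : nat) :
  (forall k, measurable_fun setT (u_ k)) -> measurable_fun setT u ->
  (forall k w, 0 <= u_ k w)%E -> (forall w, 0 <= u w)%E ->
  {ae P, forall w, u_ k w @[k --> \oo] --> u w} ->
  (forall k, (k0 <= k)%N -> \int[P]_w u_ k w <= B)%E ->
  (\int[P]_w u w <= B)%E.
Proof.
move=> mu_ mu u_0 u0 cu uB.
have mli : measurable_fun setT (fun w => limn_einf (u_ ^~ w)).
  apply: (emeasurable_fun_cvg (fun k w => einfs (u_ ^~ w) k)) => [k|w _].
    exact: measurable_fun_einfs.
  by rewrite limn_einf_lim; exact: is_cvg_einfs.
have li0 w : (0 <= limn_einf (u_ ^~ w))%E.
  rewrite limn_einf_lim; apply: lime_ge; first exact: is_cvg_einfs.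
  by apply: nearW => k; apply: le_ereal_inf_tmp => _ [j _ <-].
rewrite (@ge0_ae_eq_integral _ _ _ P setT u (fun w => limn_einf (u_ ^~ w)))//; last first.
  case: cu => A [mA PA sub]; exists A; split => // w nw; apply: sub => cw; apply: nw => _.
  by rewrite (cvg_limn_einf_sup cw).1.
apply: le_trans (fatou P measurableT mu_ (fun k w _ => u_0 k w)) _.
rewrite limn_einf_lim; apply: lime_le; first exact: is_cvg_einfs.
near=> k; apply: (@le_trans _ _ (\int[P]_w u_ k w)%E).
  by apply: ereal_inf_lbound; exists k => //=.
by apply: uB; near: k; exact: nbhs_infty_ge.
Unshelve. all: by end_near. Qed.

End integral_limits.

(** * Convergence of the low frequencies *)

Section grid_integral.
Context {R : realType} {n : nat}.

Lemma ge0_integral_grid_measure p (h : torus R n -> \bar R) :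
  measurable_fun setT h -> (forall x, 0 <= h x)%E ->
  (\int[grid_measure R n p.+1]_x h x =
   (p.+1%:R ^- n)%:E * \sum_(j : {ffun 'I_n -> 'I_p.+1}) h (torus_proj (gridpt j)))%E.
Proof.
move=> mh h0; pose G := {ffun 'I_n -> 'I_p.+1}.
pose j0 : G := [ffun=> ord0].
pose m_ (i : nat) : {measure set (torus R n) -> \bar R} :=
  \d_(grid_point R (nth j0 (enum G) i)).
have c0 : 0 <= p.+1%:R ^- n :> R by rewrite invr_ge0 exprn_ge0.
have sumE (F : G -> \bar R) : (\sum_(j : G) F j = \sum_(i < size (enum G)) F (nth j0 (enum G) i))%E.
  by rewrite -big_enum/= (big_nth j0) big_mkord.
transitivity (\int[mscale (NngNum c0) (msum m_ (size (enum G)))]_x h x)%E.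
  apply: eq_measure_integral => A mA _.
  by rewrite /= /mscale /= /msum /grid_measure sumE.
rewrite ge0_integral_mscale// ge0_integral_measure_sum//= sumE; congr (_ * _)%E.
by apply: eq_bigr => i _; rewrite integral_dirac// diracT mul1e.
Qed.

Lemma integral_grid_measure p (h : torus R n -> R) : measurable_fun setT h ->
  (\int[grid_measure R n p.+1]_x (h x)%:E =
   (avg (fun j : {ffun 'I_n -> 'I_p.+1} => h (torus_proj (gridpt j))))%:E)%E.
Proof.
move=> mh; rewrite integralE.
have mEh : measurable_fun setT (EFin \o h) by exact/measurable_EFinP.
rewrite !ge0_integral_grid_measure//; [|exact: measurable_funeneg|exact: measurable_funepos].
under eq_bigr do rewrite funeposE -EFin_max.
under [X in (_ - _ * X)%E]eq_bigr do rewrite funenegE -EFinN -EFin_max.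
rewrite !sumEFin -!EFinM -EFinB -mulrBr /avg -sumrB; congr (EFin (_ * _)).
apply: eq_bigr => j _; move: (h _) => u.
by case: (leP 0 u) => u0; rewrite ?oppr_le0 ?u0 /Num.max; case: ltP => //; case: ltP; lra.
Qed.

End grid_integral.

Section continuum.
Context {R : realType} {n : nat}.
Variables (H : set 'rV[int]_n) (gamma : R).
Hypothesis n_gt0 : (0 < n)%N.

Lemma lqg_exponent_continuous lam m (q : 'rV[int]_n -> R) :
  continuous (lqg_exponent H gamma lam m.*2.+1 q : torus R n -> R).
Proof.
apply/quotient_continuous => x0.
rewrite (_ : _ \o _ = field_exponent H gamma (amplitude lam m) m q); last first.
  by apply/funext => x; exact: lqg_exponent_proj.
have cs : continuous (fun x : 'rV[R]_n =>
    \sum_(z <- box_seq m | z != 0) amplitude lam m z * q z * fourier_basis H z x).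
  apply: (@continuous_big R _ +%R 0 (fun z => z != 0) _ 'rV[R]_n _
    (fun z x => amplitude lam m z * q z * fourier_basis H z x)) => [x|z _ x].
    by apply: cvgD; [exact: cvg_fst|exact: cvg_snd].
  exact: (continuousM (@cst_continuous _ _ (amplitude lam m z * q z) x) (@fourier_basis_continuous R n H z x)).
exact: (continuousB (continuousM (@cst_continuous _ _ gamma x0) (@cs x0)) (@cst_continuous _ _ (gamma ^+ 2 / 2 * \sum_(z <- box_seq m | z != 0) amplitude lam m z ^+ 2) x0)).
Qed.

Variable f : torus R n -> R.
Hypothesis f_cont : continuous f.

Definition lqg_integral m (q : 'rV[int]_n -> R) : R :=
  \int[lebesgue_torus R n]_x
    (f x * expR (lqg_exponent H gamma (@eigenvalue_torus R n) m.*2.+1 q x)).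

Lemma lqg_density_continuous lam m (q : 'rV[int]_n -> R) :
  continuous (fun x : torus R n => f x * expR (lqg_exponent H gamma lam m.*2.+1 q x)).
Proof.
have ce : continuous (fun x : torus R n => expR (lqg_exponent H gamma lam m.*2.+1 q x)).
  move=> x; apply: (@continuous_comp _ _ _ (lqg_exponent H gamma lam m.*2.+1 q) (@expR R)).
    exact: lqg_exponent_continuous.
  exact: continuous_expR.
by move=> x; exact: (continuousM (@f_cont x) (@ce x)).
Qed.

Lemma integral_lqg_sharp m (q : 'rV[int]_n -> R) :
  (\int[lqg_sharp H gamma m.*2.+1 q]_x (f x)%:E = (lqg_integral m q)%:E)%E.
Proof.
rewrite integral_exp_density; last exact: torus_continuous_measurable.
rewrite /lqg_integral /Rintegral fineK//.
have cg := @lqg_density_continuous (@eigenvalue_torus R n) m q.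
have [M M0 gM] := torus_bounded cg.
apply: integrable_fin_num => //; apply: measurable_bounded_integrable => //.
- by rewrite [X in (X < _)%E](_ : _ = 1%E) ?ltry//; exact: probability_setT.
- exact: torus_continuous_measurable.
exists M; split; first exact: num_real.
by move=> K MK x _; exact: le_trans (gM x) (ltW MK).
Qed.

Lemma integral_lqg_grid k (q : 'rV[int]_n -> R) :
  \int[lqg_grid H gamma k.*2.+1 q]_x f x =
  avg (fun j : {ffun 'I_n -> 'I_k.*2.+1} => f (torus_proj (gridpt j)) *
    expR (field_exponent H gamma (amplitude (eigenvalue_grid R k.*2.+1) k) k q (gridpt j))).
Proof.
rewrite /Rintegral integral_exp_density; last exact: torus_continuous_measurable.
rewrite integral_grid_measure; last first.
  apply: torus_continuous_measurable; exact: lqg_density_continuous.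
by apply: eq_avg => j /=; rewrite (@lqg_exponent_proj _ _ _ _ n_gt0 _ _ k).
Qed.

(** For k >= m the frequencies no longer change with the grid: these are Riemann sums of a fixed
    continuous function along odd numbers of points. *)
Lemma lqg_integral_cvg m (q : 'rV[int]_n -> R) :
  avg (fun j : {ffun 'I_n -> 'I_k.*2.+1} => f (torus_proj (gridpt j)) *
    expR (field_exponent H gamma (amplitude (@eigenvalue_torus R n) m) k q (gridpt j)))
  @[k --> \oo] --> lqg_integral m q.
Proof.
have h := riemann_torus (@lqg_density_continuous (@eigenvalue_torus R n) m q).
have dbl : k.*2 @[k --> \oo] --> \oo.
  apply/cvgnyPge => A; near=> k; rewrite (@leq_trans k)//; last by rewrite -addnn leq_addr.
  by near: k; exact: nbhs_infty_ge.
have {}h := cvg_comp _ _ dbl h.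
apply: cvg_trans h; apply: near_eq_cvg; near=> k.
apply: eq_avg => j; rewrite /= (@lqg_exponent_proj _ _ _ _ n_gt0 _ _ k)//.
by near: k; exact: nbhs_infty_ge.
Unshelve. all: by end_near. Qed.

End continuum.

(** * Convergence and bounds of the amplitudes *)

Section amplitudes.
Context {R : realType} {n : nat}.
Hypothesis n_gt0 : (0 < n)%N.
Implicit Types (z : 'rV[int]_n).

(** For x > 0, sin x = x cos c with 0 < c < x, and cos(c)^2 = 1 - sin(c)^2 >= 1 - x^2. *)
Lemma sin_sqr_ge (x : R) : x ^+ 2 - x ^+ 4 <= sin x ^+ 2.
Proof.
wlog x0 : x / 0 <= x => [h|].
  have [/h//|/ltW x0] := leP 0 x.
  by have := h (- x); rewrite oppr_ge0 x0 sinN !sqrrN (_ : (- x) ^+ 4 = x ^+ 4); [apply|ring].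
move: x0; rewrite le_eqVlt => /orP[/eqP <-|x0]; first by rewrite sin0 !expr0n subrr.
have [c /andP[c0 cx] ->] := sin_mvt x0.
have cc := sin_sqr_le c; have := cos2Dsin2 c => e.
have cx2 : c ^+ 2 <= x ^+ 2 by apply: lerXn2r; rewrite ?nnegrE ltW// (lt_trans c0).
have e2 : 1 - x ^+ 2 <= cos c ^+ 2 by lra.
rewrite exprMn (_ : x ^+ 2 - x ^+ 4 = x ^+ 2 * (1 - x ^+ 2)); last by ring.
by rewrite ler_wpM2l// sqr_ge0.
Qed.

Lemma eigenvalue_grid_cvg z :
  eigenvalue_grid R k.*2.+1 z @[k --> \oo] --> eigenvalue_torus R z.
Proof.
rewrite eigenvalue_torusE /eigenvalue_grid.
under eq_fun do rewrite mulr_sumr.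
rewrite mulr_sumr; apply: cvg_big => [|i _]; first exact: add_continuous.
set u : R := pi * (z 0 i)%:~R.
have -> : 4 * pi ^+ 2 * (z 0 i)%:~R ^+ 2 = 4 * u ^+ 2 :> R by rewrite /u; ring.
have Npos k : 0 < k.*2.+1%:R :> R by rewrite ltr0n.
have inv0 : (k.*2.+1%:R : R)^-1 @[k --> \oo] --> (0 : R).
  apply/cvgrPdist_le => e e0; near=> k; rewrite sub0r normrN ger0_norm ?invr_ge0//.
  apply: (@le_trans _ _ (k.+1%:R^-1)).
    by rewrite lef_pV2 ?posrE// ler_nat ltnS -addnn leq_addr.
  by apply: ltW; near: k; exact: near_infty_natSinv_lt (PosNum e0).
apply: (@squeeze_cvgr _ _ _ _ (fun k => 4 * u ^+ 2 - 4 * u ^+ 4 * (k.*2.+1%:R^-1 * k.*2.+1%:R^-1)) (fun=> 4 * u ^+ 2)).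
- apply: nearW => k; have N0 := Npos k.
  have h1 := sin_sqr_ge (u / k.*2.+1%:R); have h2 := sin_sqr_le (u / k.*2.+1%:R).
  have c0 : 0 <= 4 * k.*2.+1%:R ^+ 2 :> R by rewrite mulr_ge0// exprn_ge0.
  apply/andP; split.
    apply: le_trans (ler_wpM2l c0 h1); rewrite le_eqVlt; apply/orP; left; apply/eqP.
    by field; rewrite gt_eqF.
  apply: le_trans (ler_wpM2l c0 h2) _; rewrite le_eqVlt; apply/orP; left; apply/eqP.
  by field; rewrite gt_eqF.
- rewrite -[X in _ --> X]subr0; apply: cvgB; first exact: cvg_cst.
  rewrite -[X in _ --> X](mulr0 (4 * u ^+ 4)); apply: cvgM; first exact: cvg_cst.
  by rewrite -[X in _ --> X](mulr0 (0 : R)); exact: (cvgM inv0 inv0).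
- exact: cvg_cst.
Unshelve. all: by end_near. Qed.

Lemma powR_continuous (r x : R) : 0 < x -> {for x, continuous ((@powR R)^~ r)}.
Proof.
move=> x0; apply/differentiable_continuous/derivable1_diffP.
by have [] := is_derive1_powR r x0.
Qed.

Lemma amplitude_cvg m z : z != 0 ->
  amplitude (eigenvalue_grid R k.*2.+1) m z @[k --> \oo] --> amplitude (@eigenvalue_torus R n) m z.
Proof.
move=> z0; apply: cvgM; last exact: cvg_cst.
apply: cvgM; first exact: cvg_cst.
have l0 : 0 < eigenvalue_torus R z by rewrite (lt_le_trans _ (@eigenvalue_torus_ge1 R n z z0)).
exact: (cvg_comp _ _ (@eigenvalue_grid_cvg z) (@powR_continuous (- (n%:R / 4)) _ l0)).
Qed.

Lemma amplitude_ge0 lam m z : 0 <= @amplitude R n lam m z.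
Proof. by rewrite !mulr_ge0 ?invr_ge0 ?sqrtr_ge0 ?powR_ge0. Qed.

(** Uniformity in the grid size serves dominated convergence. The case K = 0 of
    [eigenvalue_grid_bounds] gives the eigenvalue of every nonzero frequency of the grid the lower
    bound s^2. *)
Lemma amplitude_bounded : exists2 B, 0 <= B & forall m k z, (m <= k)%N -> z != 0 ->
  @amplitude R n (eigenvalue_grid R k.*2.+1) m z <= B.
Proof.
have [s [s0 sP]] := @eigenvalue_grid_bounds R n n_gt0.
exists ((Num.sqrt (lqg_const R n))^-1 * (s ^+ 2) `^ (- (n%:R / 4))).
  by rewrite mulr_ge0 ?invr_ge0 ?sqrtr_ge0 ?powR_ge0.
move=> m k z mk z0; rewrite /amplitude; case zm : (inbox m z); last first.
  by rewrite mulr0 mulr_ge0 ?invr_ge0 ?sqrtr_ge0 ?powR_ge0.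
rewrite mulr1 ler_wpM2l ?invr_ge0 ?sqrtr_ge0//.
have zk : z \in box_seq k by rewrite mem_box_seq (inboxW mk).
have [h _] := sP k z zk.
have := h 0%N; rewrite mulr1 => {}h.
have zN0 : ~~ inbox 0 z.
  apply: contra z0 => /forallP h0; apply/eqP/rowP => i.
  by have := h0 i; rewrite leqn0 absz_eq0 mxE => /eqP.
have s20 : 0 < s ^+ 2 by rewrite exprn_gt0.
rewrite !powRN lef_pV2 ?posrE ?powR_gt0//; last by rewrite (lt_le_trans s20)// h.
by apply: ge0_ler_powR; rewrite ?nnegrE ?(ltW s20) ?h ?(le_trans (ltW s20) (h _))// divr_ge0.
Qed.

Lemma field_exponent_box H gamma lam m k q (x : 'rV[R]_n) : (m <= k)%N ->
  field_exponent H gamma (amplitude lam m) k q x = field_exponent H gamma (amplitude lam m) m q x.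
Proof.
by move=> mk; rewrite -!(lqg_exponent_proj H gamma n_gt0).
Qed.

End amplitudes.

(** * Integrable majorants *)

Section exponential_abs.
Context d (Omega : measurableType d) (R : realType) (P : probability Omega R).
Context (I : choiceType) (D : set I) (X : I -> {RV P >-> R}).
Hypothesis iid : iid_std_normal D X.

Let mE (S s : seq I) (c : I -> R) (B : R) : measurable_fun setT
  (fun w => (expR (\sum_(i <- S) c i * X i w + B * \sum_(i <- s) `|X i w|))%:E).
Proof.
apply/measurable_EFinP; apply: measurableT_comp => //; apply: measurable_funD.
  by apply: measurable_sum => i; apply: measurable_funM.
apply: measurable_funM => //; apply: measurable_sum => i.
by apply: measurableT_comp.
Qed.

(** exp (B |x|) <= exp (B x) + exp (- B x). The linear form is carried along so that each absolute
    value can be absorbed into it, with either sign, before the induction hypothesis is used. *)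
Lemma expR_abs_lty (S s : seq I) (c : I -> R) (B : R) : 0 <= B ->
  uniq S -> [set` S] `<=` D -> {subset s <= S} ->
  (\int[P]_w (expR (\sum_(i <- S) c i * X i w + B * \sum_(i <- s) `|X i w|))%:E < +oo)%E.
Proof.
move=> B0 uS SD; elim: s c => [|i s ih] c sS.
  under eq_integral do rewrite big_nil mulr0 addr0.
  by rewrite (expectation_expR_lin iid)// ltry.
have iS : i \in S by apply: sS; rewrite mem_head.
have sS' : {subset s <= S} by move=> j js; apply: sS; rewrite inE js orbT.
pose c' (e : R) j := if j == i then c j + e else c j.
have cE e w : \sum_(j <- S) c' e j * X j w = \sum_(j <- S) c j * X j w + e * X i w.
  rewrite (bigD1_seq i)//= [in RHS](bigD1_seq i)//= /c' eqxx mulrDl.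
  rewrite (eq_bigr (fun j => c j * X j w)); first by ring.
  by move=> j /negbTE ->.
apply: (@le_lt_trans _ _ (\int[P]_w
  ((expR (\sum_(j <- S) c' B j * X j w + B * \sum_(j <- s) `|X j w|))%:E +
   (expR (\sum_(j <- S) c' (- B) j * X j w + B * \sum_(j <- s) `|X j w|))%:E))%E).
  apply: ge0_le_integral => //.
  - by apply: emeasurable_funD; exact: mE.
  - move=> w _; rewrite -EFinD lee_fin !cE big_cons mulrDr.
    move: (\sum_(j <- S) _) (B * \sum_(j <- s) _) => u t.
    have [x0|x0] := ger0P (X i w).
      by apply: ler_wpDr; [exact: expR_ge0|rewrite ler_expR; lra].
    by apply: ler_wpDl; [exact: expR_ge0|rewrite ler_expR; lra].
rewrite ge0_integralD//.
by apply: lte_add_pinfty; exact: ih.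
Qed.

Lemma integrable_expR_abs (S : seq I) (B : R) : 0 <= B -> uniq S -> [set` S] `<=` D ->
  P.-integrable setT (fun w => (expR (B * \sum_(i <- S) `|X i w|))%:E).
Proof.
move=> B0 uS SD; have h := @expR_abs_lty S S (fun=> 0) B B0 uS SD (fun _ => id).
have E w : expR (B * \sum_(i <- S) `|X i w|) =
   expR (\sum_(i <- S) 0 * X i w + B * \sum_(i <- S) `|X i w|).
  by rewrite [X in X + _]big1 ?add0r// => i _; rewrite mul0r.
apply/integrableP; split.
  by under eq_fun do rewrite E; exact: (mE S S (fun=> 0) B).
under eq_integral do rewrite gee0_abs ?lee_fin ?expR_ge0// E.
exact: h.
Qed.

End exponential_abs.

Section field_exponent_estimates.
Context {R : realType} {n : nat} (H : set 'rV[int]_n) (gamma : R).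
Implicit Types (b q : 'rV[int]_n -> R).

Lemma field_exponent_le b m q (x : 'rV[R]_n) B : (forall z, z != 0 -> `|b z| <= B) ->
  field_exponent H gamma b m q x <=
  `|gamma| * B * Num.sqrt 2 * \sum_(z <- [seq z <- box_seq m | z != 0]) `|q z|.
Proof.
move=> bB; rewrite /field_exponent; apply: (@le_trans _ _
  (gamma * (\sum_(z <- box_seq m | z != 0) b z * q z * fourier_basis H z x))).
  by rewrite gerBl mulr_ge0 ?divr_ge0 ?sqr_ge0// sumr_ge0// => z _; exact: sqr_ge0.
rewrite (le_trans (ler_norm _))// normrM -!mulrA ler_wpM2l// big_filter !mulr_sumr.
apply: le_trans (ler_norm_sum _ _ _) _; apply: ler_sum => z z0.
rewrite !normrM -mulrA; apply: ler_pM; rewrite ?mulr_ge0 ?bB//.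
by rewrite mulrC ler_wpM2r// fourier_basis_bound.
Qed.

Lemma field_exponent_dist b b' m q (x : 'rV[R]_n) :
  `|field_exponent H gamma b m q x - field_exponent H gamma b' m q x| <=
  \sum_(z <- box_seq m | z != 0) (`|gamma| * (`|b z - b' z| * (`|q z| * Num.sqrt 2)) +
     gamma ^+ 2 / 2 * `|b z ^+ 2 - b' z ^+ 2|).
Proof.
rewrite /field_exponent !mulr_sumr -!sumrB; apply: le_trans (ler_norm_sum _ _ _) _.
apply: ler_sum => z _.
rewrite (_ : _ - _ = gamma * ((b z - b' z) * (q z * fourier_basis H z x)) -
   gamma ^+ 2 / 2 * (b z ^+ 2 - b' z ^+ 2)); last by ring.
apply: le_trans (ler_normB _ _) _; apply: lerD.
  rewrite normrM ler_wpM2l// normrM ler_wpM2l// normrM ler_wpM2l//.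
  exact: fourier_basis_bound.
by rewrite normrM [ `|gamma ^+ 2 / 2|]ger0_norm// divr_ge0 ?sqr_ge0.
Qed.

End field_exponent_estimates.

Section low_frequency.
Context d (Omega : measurableType d) (R : realType) (P : probability Omega R).
Context (n : nat) (H : set 'rV[int]_n) (gamma : R) (xi : 'rV[int]_n -> {RV P >-> R}).
Hypothesis xi_iid : iid_std_normal (~` [set 0]) xi.
Hypothesis n_gt0 : (0 < n)%N.
Variables (f : torus R n -> R) (M : R).
Hypothesis f_cont : continuous f.
Hypothesis fM : forall x, `|f x| <= M.

Let v k (j : {ffun 'I_n -> 'I_k.*2.+1}) : R := f (torus_proj (gridpt j)).
Let M0 : 0 <= M. Proof. exact: le_trans (normr_ge0 (f (torus_proj 0))) (fM _). Qed.

Lemma norm_grid_lqg_le b k (w : Omega) B :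
  (forall j : {ffun 'I_n -> 'I_k.*2.+1}, field_exponent H gamma b k (fun z => xi z w) (gridpt j) <= B) ->
  `|grid_lqg H gamma xi b (@v k) w| <= M * expR B.
Proof.
move=> bB; rewrite /grid_lqg /avg normrM ger0_norm ?invr_ge0 ?exprn_ge0//.
rewrite -/(avg (fun=> M * expR B)) -[leRHS](@avg_cst R n k.*2 (M * expR B)) /avg ler_wpM2l ?invr_ge0 ?exprn_ge0//.
apply: le_trans (ler_norm_sum _ _ _) _; apply: ler_sum => j _.
rewrite normrM; apply: ler_pM => //; first exact: fM.
by rewrite ger0_norm ?expR_ge0// ler_expR.
Qed.

Lemma integrable_grid_lqg lam m k : (m <= k)%N ->
  P.-integrable setT (EFin \o grid_lqg H gamma xi (amplitude lam m) (@v k)).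
Proof.
move=> mk; pose S := [seq z <- @box_seq n m | z != 0].
pose B := \sum_(z <- box_seq m | z != 0) `|@amplitude R n lam m z|.
have B0 : 0 <= B by exact: sumr_ge0.
have aB z : z != 0 -> `|@amplitude R n lam m z| <= B.
  move=> z0; case zm : (inbox m z); last by rewrite /amplitude zm mulr0 normr0.
  by rewrite /B -big_filter (bigD1_seq z) ?filter_uniq ?box_seq_uniq ?mem_filter ?mem_box_seq ?z0//= lerDl sumr_ge0.
have cB : 0 <= `|gamma| * B * Num.sqrt 2 by rewrite !mulr_ge0// sqrtr_ge0.
have iE : P.-integrable setT
    (fun w => M%:E * (expR (`|gamma| * B * Num.sqrt 2 * \sum_(z <- S) `|xi z w|))%:E)%E.
  apply: integrableZl => //; apply: (integrable_expR_abs xi_iid) => //.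
    by rewrite filter_uniq// box_seq_uniq.
  by move=> z /=; rewrite mem_filter => /andP[/eqP z0 _].
apply: le_integrable iE => //.
  by apply/measurable_EFinP; exact: measurable_grid_lqg.
move=> w _; rewrite -EFinM !abse_EFin lee_fin.
apply: le_trans (ler_norm _); apply: norm_grid_lqg_le => j.
by rewrite (field_exponent_box n_gt0 H gamma)//; exact: field_exponent_le.
Qed.

Let Y m w := lqg_integral H gamma f m (fun z => xi z w).

(** The outcome is fixed and only finitely many frequencies occur. Replacing discrete amplitudes by
    continuous ones changes the exponent by at most [dl k], uniformly over the grid; what remains is
    a Riemann sum. *)
Lemma low_frequency_cvg m (w : Omega) :
  grid_lqg H gamma xi (amplitude (eigenvalue_grid R k.*2.+1) m) (@v k) w @[k --> \oo] --> Y m w.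
Proof.
pose G k := grid_lqg H gamma xi (amplitude (@eigenvalue_torus R n) m) (@v k) w.
have GY : G k @[k --> \oo] --> Y m w by exact: (@lqg_integral_cvg R n H gamma n_gt0 f f_cont m).
pose q z := xi z w.
have [B1 B10 B1P] := @amplitude_bounded R n n_gt0.
pose B2 := \sum_(z <- box_seq m | z != 0) `|@amplitude R n (@eigenvalue_torus R n) m z|.
have B20 : 0 <= B2 by exact: sumr_ge0.
have aB2 z : z != 0 -> `|@amplitude R n (@eigenvalue_torus R n) m z| <= B2.
  move=> z0; case zm : (inbox m z); last by rewrite /amplitude zm mulr0 normr0.
  by rewrite /B2 -big_filter (bigD1_seq z) ?filter_uniq ?box_seq_uniq ?mem_filter ?mem_box_seq ?z0//= lerDl sumr_ge0.
pose S := [seq z <- @box_seq n m | z != 0].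
pose K B := expR (`|gamma| * B * Num.sqrt 2 * \sum_(z <- S) `|q z|).
pose dl k := \sum_(z <- box_seq m | z != 0) (`|gamma| * (`|@amplitude R n (eigenvalue_grid R k.*2.+1) m z - amplitude (@eigenvalue_torus R n) m z| * (`|q z| * Num.sqrt 2)) +
     gamma ^+ 2 / 2 * `|@amplitude R n (eigenvalue_grid R k.*2.+1) m z ^+ 2 - amplitude (@eigenvalue_torus R n) m z ^+ 2|).
have dl0 : dl k @[k --> \oo] --> (0 : R).
  have s0 : \sum_(z <- @box_seq n m | z != 0) (`|gamma| * (`|0 : R| * (`|q z| * Num.sqrt 2)) + gamma ^+ 2 / 2 * `|0 : R|) = 0 :> R.
    by rewrite big1// => z _; rewrite normr0 mul0r !mulr0 addr0.
  rewrite -[X in _ --> X]s0 /dl.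
  apply: cvg_big => [|z z0]; first exact: add_continuous.
  have az := @amplitude_cvg R n m z z0.
  apply: cvgD; (apply: cvgM; first exact: cvg_cst).
    apply: cvgM; last exact: cvg_cst; apply: cvg_norm.
    by rewrite -(subrr (amplitude (@eigenvalue_torus R n) m z)); apply: cvgB => //; exact: cvg_cst.
  apply: cvg_norm; rewrite -(subrr (amplitude (@eigenvalue_torus R n) m z ^+ 2)).
  by apply: cvgB; [rewrite !expr2; exact: (cvgM az az)|exact: cvg_cst].
have dist k : (m <= k)%N ->
    `|grid_lqg H gamma xi (amplitude (eigenvalue_grid R k.*2.+1) m) (@v k) w - G k| <= M * (dl k * (K B1 + K B2)).
  move=> mk; rewrite /G /grid_lqg /avg -mulrBr -sumrB normrM ger0_norm ?invr_ge0 ?exprn_ge0//.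
  rewrite -[leRHS](@avg_cst R n k.*2) /avg ler_wpM2l ?invr_ge0 ?exprn_ge0//.
  apply: le_trans (ler_norm_sum _ _ _) _; apply: ler_sum => j _.
  rewrite -mulrBr normrM; apply: ler_pM => //; first exact: fM.
  rewrite /field_density !(field_exponent_box n_gt0 H gamma)//.
  apply: le_trans (expRB_norm_le _ _) _; apply: ler_pM => //.
  - exact: field_exponent_dist.
  - apply: lerD; rewrite ler_expR; apply: field_exponent_le => // z z0.
    by rewrite ger0_norm ?amplitude_ge0// B1P.
rewrite -[X in _ --> X]add0r.
under eq_fun => k do rewrite -[grid_lqg _ _ _ _ _ _](subrK (G k)).
apply: cvgD => //; apply/norm_cvg0P.
apply: (@squeeze_cvgr _ _ _ _ (fun=> 0) (fun k => M * (dl k * (K B1 + K B2)))).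
- near=> k; rewrite normr_ge0/=; apply: dist; near: k; exact: nbhs_infty_ge.
- exact: cvg_cst.
- rewrite -[X in _ --> X](mulr0 M) -[X in M * X](mul0r (K B1 + K B2)).
  by apply: cvgM; [exact: cvg_cst|apply: cvgM => //; exact: cvg_cst].
Unshelve. all: by end_near. Qed.

(** Measurability in the outcome is inherited from the grid averages, finite sums whose pointwise
    limit is the integral. *)
Lemma measurable_lqg_integral m : measurable_fun setT (Y m).
Proof.
apply: (measurable_fun_cvg (h := fun k w => grid_lqg H gamma xi (amplitude (eigenvalue_grid R k.*2.+1) m) (@v k) w)) => [k|w _].
  exact: measurable_grid_lqg.
exact: low_frequency_cvg.
Qed.

Lemma low_frequency_L1 m :
  (\int[P]_w `|grid_lqg H gamma xi (amplitude (eigenvalue_grid R k.*2.+1) m) (@v k) w - Y m w|%:E)%E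
    @[k --> \oo] --> 0%E.
Proof.
pose S := [seq z <- @box_seq n m | z != 0].
have [B B0 BP] := @amplitude_bounded R n n_gt0.
have cB : 0 <= `|gamma| * B * Num.sqrt 2 by rewrite !mulr_ge0// sqrtr_ge0.
pose F k w := grid_lqg H gamma xi (amplitude (eigenvalue_grid R k.*2.+1) m) (@v k) w.
(* The majorant holds once the grid resolves all frequencies of the cutoff, that is for k >= m;
   hence the shift. *)
rewrite -(cvg_shiftn m).
have iE : P.-integrable setT
    (fun w => M%:E * (expR (`|gamma| * B * Num.sqrt 2 * \sum_(z <- S) `|xi z w|))%:E)%E.
  apply: integrableZl => //; apply: (integrable_expR_abs xi_iid) => //.
    by rewrite filter_uniq// box_seq_uniq.
  by move=> z /=; rewrite mem_filter => /andP[/eqP z0 _].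
have mF k : measurable_fun setT (fun w => (F (k + m)%N w)%:E).
  by apply/measurable_EFinP; exact: measurable_grid_lqg.
have mY : measurable_fun setT (fun w => (Y m w)%:E).
  by apply/measurable_EFinP; exact: measurable_lqg_integral.
have FY : {ae P, forall w, setT w -> (F (k + m)%N w)%:E @[k --> \oo] --> (Y m w)%:E}.
  apply: aeW => w _; apply: cvg_EFin; first by apply: nearW.
  by rewrite (cvg_shiftn m (fun k => F k w)); exact: low_frequency_cvg.
have Fb : {ae P, forall w k, setT w -> (`|(F (k + m)%N w)%:E| <=
    M%:E * (expR (`|gamma| * B * Num.sqrt 2 * \sum_(z <- S) `|xi z w|))%:E)%E}.
  apply: aeW => w k _; rewrite abse_EFin -EFinM lee_fin.
  apply: norm_grid_lqg_le => j; rewrite (field_exponent_box n_gt0 H gamma) ?leq_addl//.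
  apply: field_exponent_le => z z0.
  by rewrite ger0_norm ?amplitude_ge0// BP// leq_addl.
have [_ h _] := dominated_convergence measurableT mF mY FY iE Fb.
exact: h.
Qed.

End low_frequency.

(** * Convergence of the measures *)

Section L1_convergence.
Context d (T : measurableType d) (R : realType) (P : probability T R).

Lemma measurable_normB (X Y : T -> R) : measurable_fun setT X -> measurable_fun setT Y ->
  measurable_fun setT (fun w => `|X w - Y w|%:E).
Proof.
move=> mX mY; apply/measurable_EFinP; apply: measurableT_comp => //.
exact: measurable_funB.
Qed.

Lemma cvg_in_L1_probability (X_ : nat -> T -> R) (X : T -> R) :
  cvg_in_L1 P X_ X -> cvg_in_probability P X_ X.
Proof.
move=> [iX_ iX XX] e e0.
have mX_ k : measurable_fun setT (X_ k) by exact/measurable_EFinP/(measurable_int _ (iX_ k)).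
have mX : measurable_fun setT X by exact/measurable_EFinP/(measurable_int _ iX).
apply: (@squeeze_cvge _ _ _ _ (fun=> 0%E) _
  (fun k => e^-1%:E * \int[P]_w `|X_ k w - X w|%:E)%E); last 2 first.
- exact: cvg_cst.
- by rewrite -(mule0 e^-1%:E); exact: cvgeZl.
apply: nearW => k; rewrite measure_ge0/=.
have mg : measurable_fun setT (EFin \o (fun w => X_ k w - X w)).
  by apply/measurable_EFinP; exact: measurable_funB.
have h := @le_integral_comp_abse _ _ _ P setT measurableT (EFin \o (fun w => X_ k w - X w))
  e id (@measurable_id _ _ setT) (fun r r0 => r0) (fun x y _ _ xy => xy) mg e0.
rewrite -[leLHS]mul1e -(mulVf (lt0r_neq0 e0)) EFinM -muleA lee_wpmul2l ?lee_fin ?invr_ge0 ?(ltW e0)//.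
by rewrite setTI in h; exact: h.
Qed.

Lemma L1_dist_le (X Y Z : T -> R) : measurable_fun setT X -> measurable_fun setT Y ->
  measurable_fun setT Z -> (\int[P]_w `|X w - Z w|%:E <=
    \int[P]_w `|X w - Y w|%:E + \int[P]_w `|Y w - Z w|%:E)%E.
Proof.
move=> mX mY mZ.
rewrite -ge0_integralD//; [|exact: measurable_normB|exact: measurable_normB].
apply: ge0_le_integral => //.
- exact: measurable_normB.
- by apply: emeasurable_funD; exact: measurable_normB.
- by move=> w _; rewrite -EFinD lee_fin ler_distD.
Qed.

Lemma ge0_cvge0P (u : nat -> \bar R) : (forall k, 0 <= u k)%E ->
  u k @[k --> \oo] --> 0%E <-> forall e : R, 0 < e -> \forall k \near \oo, (u k <= e%:E)%E.
Proof.
move=> u0; split=> [/fine_cvgP[ufin /cvgrPdist_lt uc] e e0|h].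
  have ue := uc _ e0; near=> k.
  rewrite -[u k]fineK ?lee_fin; last by near: k.
  have : `|0 - fine (u k)| < e by near: k.
  by rewrite sub0r normrN => /ltW; exact: le_trans (ler_norm _).
have ufin : \forall k \near \oo, u k \is a fin_num.
  near=> k; rewrite ge0_fin_numE//; apply: (@le_lt_trans _ _ 1%:E); last by rewrite ltry.
  by near: k; exact: h.
apply/fine_cvgP; split => //; apply/cvgrPdist_le => e e0; near=> k.
rewrite sub0r normrN /= ger0_norm ?fine_ge0// -lee_fin fineK; first by near: k; exact: h.
by near: k.
Unshelve. all: by end_near. Qed.

(** Three distances, along X_k, A_{j,k}, Y_j, X. The error [e j] is uniform in k and occurs twice; r
    / 4 for each distance stays below r. *)
Lemma cvg_L1_approx (X_ : nat -> T -> R) (A : nat -> nat -> T -> R) (X : T -> R)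
    (Y : nat -> T -> R) (e : nat -> R) :
  (forall k, measurable_fun setT (X_ k)) -> measurable_fun setT X ->
  (forall j k, measurable_fun setT (A j k)) -> (forall j, measurable_fun setT (Y j)) ->
  e j @[j --> \oo] --> 0 ->
  (forall j, \forall k \near \oo, \int[P]_w `|X_ k w - A j k w|%:E <= (e j)%:E)%E ->
  (forall j, (\int[P]_w `|A j k w - Y j w|%:E)%E @[k --> \oo] --> 0%E) ->
  (forall j, \int[P]_w `|X w - Y j w|%:E <= (e j)%:E)%E ->
  (\int[P]_w `|X_ k w - X w|%:E)%E @[k --> \oo] --> 0%E.
Proof.
move=> mX_ mX mA mY e0 XA AY XY; apply/ge0_cvge0P => [k|r r0]; first exact: integral_ge0.
have r3 : 0 < r / 4 by rewrite divr_gt0.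
have [j ej] : exists j, e j < r / 4.
  have /cvgrPdist_lt/(_ _ r3) [j _ /(_ j (leqnn _))/=] := e0.
  by rewrite sub0r normrN => h; exists j; exact: le_lt_trans (ler_norm _) h.
have /ge0_cvge0P AYj := AY j.
have {}AYj : \forall k \near \oo, (\int[P]_w `|A j k w - Y j w|%:E <= (r / 4)%:E)%E.
  by apply: AYj => // k; exact: integral_ge0.
near=> k; apply: le_trans (L1_dist_le (mX_ k) (mA j k) mX) _.
apply: (@le_trans _ _ ((e j)%:E + ((r / 4)%:E + (e j)%:E))%E); last first.
  by rewrite -!EFinD lee_fin; lra.
apply: leeD; first by near: k; exact: XA.
apply: le_trans (L1_dist_le (mA j k) (mY j) mX) _; apply: leeD; first by near: k.
by under eq_integral do rewrite distrC; exact: XY.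
Unshelve. all: by end_near. Qed.

(** The limit is an extended real, its finiteness not being known in advance; Fatou's lemma for the
    absolute values makes it integrable, hence almost surely finite. *)
Lemma fatou_integrable (Y : nat -> T -> R) (Z : T -> \bar R) (B : R) :
  (forall m, measurable_fun setT (Y m)) -> measurable_fun setT Z ->
  {ae P, forall w, (Y m w)%:E @[m --> \oo] --> Z w} ->
  (forall m, \int[P]_w `|Y m w|%:E <= B%:E)%E ->
  P.-integrable setT Z.
Proof.
move=> mY mZ YZ YB; apply/integrableP; split => //.
apply: (@le_lt_trans _ _ B%:E); last by rewrite ltry.
apply: (@fatou_le _ _ _ P (fun m w => `|Y m w|%:E) _ _ 0) => //.
- by move=> m; apply/measurable_EFinP; apply: measurableT_comp.
- exact: measurableT_comp.
- case: YZ => N [mN N0 sub]; exists N; split => // w nw; apply: sub => cw; apply: nw.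
  exact: cvg_abse cw.
Qed.

End L1_convergence.

Section convergence.
Context d (Omega : measurableType d) (R : realType) (P : probability Omega R).
Context (n : nat) (H : set 'rV[int]_n) (gamma : R) (xi : 'rV[int]_n -> {RV P >-> R}).
Hypothesis H_half : half_lattice H.
Hypothesis xi_iid : iid_std_normal (~` [set 0]) xi.
Hypothesis n_gt0 : (0 < n)%N.
Hypothesis gamma_n : 2 * gamma ^+ 2 < n%:R.
Variables (f : torus R n -> R) (M : R).
Hypothesis f_cont : continuous f.
Hypothesis fM : forall x, `|f x| <= M.

Let v k (j : {ffun 'I_n -> 'I_k.*2.+1}) : R := f (torus_proj (gridpt j)).
Let Y m w := lqg_integral H gamma f m (fun z => xi z w).
Let X_ k w := grid_lqg H gamma xi (amplitude (eigenvalue_grid R k.*2.+1) k) (@v k) w.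
Let M0 : 0 <= M. Proof. exact: le_trans (normr_ge0 (f (torus_proj 0))) (fM _). Qed.

Let mY m : measurable_fun setT (Y m).
Proof. exact: (measurable_lqg_integral H gamma xi n_gt0 f_cont fM). Qed.

Let YP m w : grid_lqg H gamma xi (amplitude (@eigenvalue_torus R n) m) (@v k) w @[k --> \oo] --> Y m w.
Proof. exact: (lqg_integral_cvg n_gt0 f_cont). Qed.

(** With cutoff 0 the amplitudes vanish at all nonzero frequencies and the density is 1. This is the
    base value for the uniform L^1 bound. *)
Lemma lqg_integral0_le w : `|Y 0 w| <= M.
Proof.
have h : `|grid_lqg H gamma xi (amplitude (@eigenvalue_torus R n) 0) (@v k) w|
    @[k --> \oo] --> `|Y 0 w| by apply: cvg_norm; exact: YP.
rewrite -(cvg_lim _ h)//.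
apply: limr_le; first by apply/cvg_ex; eexists; exact: h.
apply: nearW => k; rewrite -[leRHS]mulr1 -expR0; apply: norm_grid_lqg_le => // j.
rewrite (field_exponent_box n_gt0)//.
apply: le_trans (@field_exponent_le R n H gamma _ 0 _ _ 0 _) _; last by rewrite mulr0 !mul0r.
move=> z z0; rewrite /amplitude; case zm : (inbox 0 z); last by rewrite mulr0 normr0.
case/eqP: z0; apply/rowP => i; move/forallP: zm => /(_ i).
by rewrite leqn0 absz_eq0 mxE => /eqP.
Qed.

(** The second bound is obtained by Fatou's lemma in the grid size from the grid bound for lambda_z,
    which dominates the discrete eigenvalue on every grid. *)
Lemma lqg_integral_tail : exists C s : R, [/\ 0 <= C, 0 < s < 1,
  (forall J k, ((2 ^ J).-1 <= k)%N ->
    \int[P]_w `|X_ k w - grid_lqg H gamma xi (amplitude (eigenvalue_grid R k.*2.+1) (2 ^ J).-1) (@v k) w|%:E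
    <= (C * s ^+ J)%:E)%E &
  (forall J m, ((2 ^ J).-1 <= m)%N ->
    \int[P]_w `|Y m w - Y (2 ^ J).-1 w|%:E <= (C * s ^+ J)%:E)%E].
Proof.
have [C [s [C0 s01 CP]]] := grid_lqg_tail H_half xi_iid n_gt0 gamma_n.
exists (C * (1 + M ^+ 2)), s; split => //.
- by rewrite mulr_ge0// addr_ge0// sqr_ge0.
- move=> J k Jk; apply: CP => // [z|j]; last exact: fM.
  exact: eigenvalue_gridN.
move=> J m Jm.
apply: (@fatou_le _ _ _ P (fun k w => `|grid_lqg H gamma xi (amplitude (@eigenvalue_torus R n) m) (@v k) w -
   grid_lqg H gamma xi (amplitude (@eigenvalue_torus R n) (2 ^ J).-1) (@v k) w|%:E) _ _ 0) => //.
- by move=> k; apply: measurable_normB; exact: measurable_grid_lqg.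
- by apply: measurable_normB; exact: mY.
- apply: aeW => w; apply: cvg_EFin; first exact: nearW.
  by apply: cvg_norm; apply: cvgB; exact: YP.
- move=> k _; apply: CP => // [z|z _ _|j]; last exact: fM.
    exact: eigenvalue_torusN.
  exact: eigenvalue_grid_le_torus.
Qed.

Variable mu : R.-ker Omega ~> torus R n.
Hypothesis mu_lqg : is_lqg H gamma xi mu.

Let Z w : \bar R := (\int[mu w]_x (f x)%:E)%E.

Let mZ : measurable_fun setT Z.
Proof.
have mf : measurable_fun setT (EFin \o f).
  by apply/measurable_EFinP; exact: torus_continuous_measurable.
rewrite /Z; under eq_fun do rewrite integralE.
apply: emeasurable_funB; apply: measurable_fun_integral_kernel => //.
- by move=> U mU; exact: measurable_kernel.
- exact: measurable_funepos.
- by move=> U mU; exact: measurable_kernel.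
- exact: measurable_funeneg.
Qed.

Let YZ : {ae P, forall w, (Y m w)%:E @[m --> \oo] --> Z w}.
Proof.
case: mu_lqg => N [mN N0 sub]; exists N; split => // w nw; apply: sub => cw; apply: nw.
have := cw f f_cont; under eq_fun do rewrite (integral_lqg_sharp _ _ n_gt0 f_cont).
exact.
Qed.

Let iZ : P.-integrable setT Z.
Proof.
have [C [s [C0 s01 _ CY]]] := lqg_integral_tail.
apply: (@fatou_integrable _ _ _ P Y Z (C + M)) => // m.
(* The distance to Y_0 is the case J = 0 of the tail bound, as 2^0 - 1 = 0. *)
apply: (@le_trans _ _ (\int[P]_w `|Y m w - Y 0 w|%:E + \int[P]_w `|Y 0 w|%:E)%E).
  rewrite -ge0_integralD//; [|exact: measurable_normB|by apply/measurable_EFinP; apply: measurableT_comp].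
  apply: ge0_le_integral => //.
  - by apply/measurable_EFinP; apply: measurableT_comp.
  - apply: emeasurable_funD; first exact: measurable_normB.
    by apply/measurable_EFinP; apply: measurableT_comp.
  - by move=> w _; rewrite -EFinD lee_fin -{1}(subrK (Y 0 w) (Y m w)) ler_normD.
rewrite EFinD; apply: leeD.
  by have := CY 0 m (leq0n _); rewrite mulr1.
apply: (@le_trans _ _ (\int[P]_w M%:E)%E); last by rewrite integral_cst//= probability_setT mule1.
apply: ge0_le_integral => //.
- by apply/measurable_EFinP; apply: measurableT_comp.
- by move=> w _; rewrite lee_fin lqg_integral0_le.
Qed.

Lemma lqg_cvg_L1 (k_ : nat -> nat) : k_ l @[l --> \oo] --> \oo ->
  cvg_in_L1 P (fun l => X_ (k_ l)) (fun w => fine (Z w)).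
Proof.
move=> koo; pose X w := fine (Z w).
have mX : measurable_fun setT X by exact: measurableT_comp.
have finZ : {ae P, forall w, Z w \is a fin_num}.
  have := integrable_ae measurableT iZ; apply: filterS => w; exact.
have YX : {ae P, forall w, Y m w @[m --> \oo] --> X w}.
  move: finZ YZ; apply: filterS2 => w Zfin; rewrite -{1}(fineK Zfin) => /fine_cvg; exact.
have mXk k : measurable_fun setT (X_ k) by exact: measurable_grid_lqg.
have [C [s [C0 /andP[s0 s1] CX CY]]] := lqg_integral_tail.
split.
- by move=> l; exact: (integrable_grid_lqg H gamma xi_iid n_gt0 fM).
- apply: le_integrable iZ => //; first by apply/measurable_EFinP.
  by move=> w _ /=; rewrite /X; case: (Z w) => //= *; rewrite normr0 leey.
apply: (@cvg_L1_approx _ _ _ P (fun l => X_ (k_ l))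
  (fun J l => grid_lqg H gamma xi (amplitude (eigenvalue_grid R (k_ l).*2.+1) (2 ^ J).-1) (@v (k_ l)))
  X (fun J => Y (2 ^ J).-1) (fun J => C * s ^+ J)).
- by move=> l; exact: mXk.
- exact: mX.
- by move=> J l; exact: measurable_grid_lqg.
- by move=> J; exact: mY.
- rewrite -(mulr0 C); apply: cvgM; first exact: cvg_cst.
  by apply: cvg_expr; rewrite ger0_norm// ltW.
- by move=> J; near=> l; apply: CX; near: l; move/cvgnyPge: koo; exact.
- move=> J; have h := low_frequency_L1 H gamma xi_iid n_gt0 f_cont fM (2 ^ J).-1.
  exact: (cvg_comp _ _ koo h).
(* The tail bound between the cutoffs m and 2^J - 1 passes to the limit measure as m tends to
   infinity. *)
- move=> J; apply: (@fatou_le _ _ _ P (fun m w => `|Y m w - Y (2 ^ J).-1 w|%:E) _ _ (2 ^ J).-1) => //.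
  + by move=> m; exact: measurable_normB.
  + exact: measurable_normB.
  + apply: filterS YX => w Yw; apply: cvg_EFin; first exact: nearW.
    by apply: cvg_norm; apply: cvgB => //; exact: cvg_cst.
  + by move=> m; exact: CY.
Unshelve. all: by end_near. Qed.

End convergence.

Theorem theorem0p5 (R : realType) (n : nat) (n_ge1 : (1 <= n)%N)
    (gamma : R) (gamma_lt : `|gamma| < Num.sqrt (n%:R / expR 1))
    (a : nat) (a_ge2 : (2 <= a)%N) (a_odd : odd a)
    (d : measure_display) (Omega : measurableType d) (P : probability Omega R)
    (H : set 'rV[int]_n) (H_half : half_lattice H)
    (xi : 'rV[int]_n -> {RV P >-> R})
    (xi_iid : iid_std_normal (~` [set 0]) xi)
    (mu : R.-ker Omega ~> torus R n) (mu_lqg : is_lqg H gamma xi mu)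
    (f : torus R n -> R) (f_cont : continuous f) :
  cvg_in_probability P
    (fun l w => \int[lqg_grid H gamma (a ^ l) (fun z => xi z w)]_x f x)
    (fun w => \int[mu w]_x f x) /\
  cvg_in_L1 P
    (fun l w => \int[lqg_grid H gamma (a ^ l) (fun z => xi z w)]_x f x)
    (fun w => \int[mu w]_x f x).
Proof.
suff h : cvg_in_L1 P
    (fun l w => \int[lqg_grid H gamma (a ^ l) (fun z => xi z w)]_x f x)
    (fun w => \int[mu w]_x f x).
  by split => //; exact: cvg_in_L1_probability.
(* From exp 1 >= 1 + 1: gamma^2 < n / e <= n / 2. *)
have gamma_n : 2 * gamma ^+ 2 < n%:R.
  have e2 : 2 <= expR 1 :> R by have := expR_ge1Dx (1 : R); rewrite -[2]/(1 + 1).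
  have n0 : 0 < n%:R :> R by rewrite ltr0n.
  have : `|gamma| ^+ 2 < Num.sqrt (n%:R / expR 1) ^+ 2 by rewrite ltrXn2r.
  rewrite real_normK ?num_real// sqr_sqrtr ?divr_ge0 ?expR_ge0//.
  rewrite ltr_pdivlMr ?expR_gt0//; apply: le_lt_trans.
  by rewrite mulrC ler_wpM2l ?sqr_ge0.
have [M _ fM] := torus_bounded f_cont.
(* Powers of an odd number are odd, so a^l is the size 2k+1 of a grid with k = (a^l)./2; for l = 0
   this is k = 0. *)
have aE l : (a ^ l)%N = (a ^ l)./2.*2.+1.
  by rewrite -[LHS]odd_double_half oddX a_odd orbT.
have koo : (a ^ l)./2 @[l --> \oo] --> \oo.
  apply/cvgnyPge => A; near=> l.
  rewrite -leq_double -ltnS -aE (@leq_trans l)//.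
    by rewrite ltnW//; near: l; exact: nbhs_infty_gt.
  by rewrite (leq_trans (ltnW (ltn_expl l a_ge2))).
have E : (fun l w => \int[lqg_grid H gamma (a ^ l) (fun z => xi z w)]_x f x) =
    (fun l => grid_lqg H gamma xi (amplitude (eigenvalue_grid R (a ^ l)./2.*2.+1) (a ^ l)./2)
      (fun j : {ffun 'I_n -> 'I_(a ^ l)./2.*2.+1} => f (torus_proj (gridpt j)))).
  apply/funext => l; apply/funext => w.
  by rewrite [in LHS]aE (integral_lqg_grid H gamma n_ge1 f_cont).
rewrite E.
exact: (lqg_cvg_L1 H_half xi_iid n_ge1 gamma_n f_cont fM mu_lqg koo).
Unshelve. all: by end_near. Qed.
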